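(* Let $W\subset\mathbb{R}^2$ be a compact convex domain with non-empty interior, and let $H:\mathcal{T}_W\to\mathbb{R}$ be a measurable function (energy) such that, for some real constant $C$, $H(T)\ge C\,\#L(T)$ for every T-tessellation $T\in\mathcal{T}_W$. Then for any $\tau>0$ (the expected number of lines in the reference Poisson line process $\lambda_W^\tau$), the Gibbs measure $$\mu_H(A)=Z_H^{-1}\,\mathbb{E}\left[\sum_{T\in\mathcal{T}(L_W^\tau)}\mathbf{1}_A(T)\exp(-H(T))\right],\qquad A\in\sigma(\mathcal{T}_W),$$ is well-defined and finite; that is, the normalising constant $Z_H=\mathbb{E}\left[\sum_{T\in\mathcal{T}(L_W^\tau)}\exp(-H(T))\right]$ is finite.
   Context: Let $W$ be a compact convex domain in the plane with non-empty interior and boundary $\mathcal{B}$. A finite polygonal tessellation of $W$ is a finite partition of $W$ into convex sets with disjoint interiors, called cells, such that the boundary of each cell is a union of a finite number of line segments, called (inner) edges, and of parts of the boundary $\mathcal{B}$ of $W$. A segment of the tessellation is a maximal union of aligned and contiguous inner edges. A vertex is T-shaped if it has degree three and two of the incident edges are aligned, or if it has degree one and lies on $\mathcal{B}$ (only inner edges are counted in the degree of a vertex on $\mathcal{B}$). A T-tessellation is a polygonal tessellation such that all vertices in $W$ are T-shaped and no two segments are aligned. $\mathcal{T}_W$ is the set of T-tessellations of $W$ (including the one with no segment), and $\sigma(\mathcal{T}_W)$ is the standard hitting $\sigma$-algebra on it (generated by the events that the closed set formed by the union of the edges of $T$ hits a given compact set). For a T-tessellation $T$, $L(T)$ is the set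 of lines supporting its segments. For a finite set $L$ of lines, $\mathcal{T}(L)=\{T\in\mathcal{T}_W: L(T)=L\}$, with exactly one segment on each line of $L$. Poisson line process: for $\alpha\in[0,\pi)$ and $p\in\mathbb{R}$, let $D(p,\alpha)$ be the line through the point $P$ of polar coordinates $(p,\alpha)$ that is orthogonal to the direction of angle $\alpha$. Let $\mathcal{L}_{\mathring W}$ be the set of lines meeting the interior of $W$, so $D^{-1}(\mathcal{L}_{\mathring W})\subset\mathbb{R}\times[0,\pi)$. For $\tau>0$, $L_W^\tau$ is the random finite set of lines, with law $\lambda_W^\tau$, obtained as the image under $D$ of the Poisson point process on $D^{-1}(\mathcal{L}_{\mathring W})$ with intensity $\frac{\tau}{\mathrm{Vol}(D^{-1}(\mathcal{L}_{\mathring W}))}\mathrm{Vol}$, where $\mathrm{Vol}$ is Lebesgue measure. In particular $\#L_W^\tau$ is a Poisson variable with parameter $\tau$. The expectation $\mathbb{E}$ is with respect to $L_W^\tau$. *)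

(* Defs.v *)
From HB Require Import structures.
From mathcomp Require Import all_boot all_order all_algebra finmap.
From mathcomp Require Import all_classical all_reals all_analysis measurable_realfun.

Set Implicit Arguments.
Unset Strict Implicit.
Unset Printing Implicit Defensive.

Import Order.TTheory GRing.Theory Num.Theory.
Import numFieldNormedType.Exports.

Local Open Scope classical_set_scope.
Local Open Scope card_scope.
Local Open Scope ring_scope.

Section lines.
Context {R : realType}.

(* [line_at (p, alpha)] is the line through the point of polar coordinates
   [(p, alpha)] orthogonal to the direction of angle [alpha]. *)
Definition line_at (x : R * R) : set (R * R) :=
  [set z : R * R | (z.1 - x.1 * cos x.2) * cos x.2
                 + (z.2 - x.1 * sin x.2) * sin x.2 = 0].

Definition polar_strip : set (R * R) := [set x | 0 <= x.2 < pi].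

Definition is_line (l : set (R * R)) : Prop :=
  exists2 x, polar_strip x & l = line_at x.

Definition aligned (A B : set (R * R)) : Prop :=
  exists l, [/\ is_line l, A `<=` l & B `<=` l].

Definition segment (a b : R * R) : set (R * R) :=
  [set z : R * R | exists2 t : R, 0 <= t <= 1 &
     z = ((1 - t) * a.1 + t * b.1, (1 - t) * a.2 + t * b.2)].

Definition endpoint (v : R * R) (e : set (R * R)) : Prop :=
  exists2 w, v != w & e = segment v w.

End lines.

Definition frontier {T : topologicalType} (A : set T) : set T :=
  closure A `\` interior A.

Section tessellations.
Context {R : realType}.
Notation plane := (R * R)%type.

Record convex_domain := ConvexDomain {
  domain :> set plane;
  domain_compact : compact domain;
  domain_convex : convex_set domain;
  domain_interior : interior domain !=set0 }.

(* A tessellation is represented by the set [T] of its cells, taken closed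
   with non-empty interior, so that it is determined by its edges. *)

(* Edges run between consecutive vertices of the planar graph of [T], as
   needed for vertex degrees. By convexity two distinct cells meet in the
   empty set, a point or exactly one such edge. *)
Definition inner_edge (T : set (set plane)) (e : set plane) : Prop :=
  (exists c c', [/\ T c, T c', c <> c' & e = c `&` c']) /\
  (exists v, endpoint v e).

Definition polygonal_tessellation (W : set plane) (T : set (set plane)) :
    Prop :=
  [/\ finite_set T,
      (forall c, T c ->
         [/\ closed c, convex_set c & interior c !=set0]),
      \bigcup_(c in T) c = W,
      (forall c c', T c -> T c' -> c <> c' ->
         interior c `&` interior c' = set0) &
      (forall c, T c -> exists F B,
         [/\ finite_set F, F `<=` inner_edge T, B `<=` frontier W &
             frontier c = \bigcup_(e in F) e `|` B])].

Definition skeleton (T : set (set plane)) : set plane :=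
  \bigcup_(e in inner_edge T) e.

Definition incident (T : set (set plane)) (v : plane) : set (set plane) :=
  [set e | inner_edge T e /\ endpoint v e].

Definition vertex (T : set (set plane)) (v : plane) : Prop :=
  incident T v !=set0.

Definition T_shaped (W : set plane) (T : set (set plane)) (v : plane) :
    Prop :=
  (incident T v #= `I_3 /\
     exists e e', [/\ incident T v e, incident T v e', e <> e' &
                      aligned e e']) \/
  (incident T v #= `I_1 /\ frontier W v).

Definition aligned_contiguous_union (T : set (set plane)) (s : set plane) :
    Prop :=
  exists F, [/\ F !=set0, F `<=` inner_edge T, s = \bigcup_(e in F) e,
                connected s & exists2 l, is_line l & s `<=` l].

Definition tess_segment (T : set (set plane)) (s : set plane) : Prop :=
  aligned_contiguous_union T s /\
  forall s', aligned_contiguous_union T s' -> s `<=` s' -> s' = s.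

Definition T_tessellation (W : set plane) (T : set (set plane)) : Prop :=
  [/\ polygonal_tessellation W T,
      (forall v, vertex T v -> T_shaped W T v) &
      (forall s s', tess_segment T s -> tess_segment T s' -> s <> s' ->
         ~ aligned s s')].

Definition supporting_lines (T : set (set plane)) : set (set plane) :=
  [set l | is_line l /\ exists2 s, tess_segment T s & s `<=` l].

Lemma inner_edge_trivial (W e : set plane) : ~ inner_edge [set W] e.
Proof. by move=> [[c [c' [-> ->]]]]. Qed.

Lemma T_tessellation_trivial (W : convex_domain) :
  T_tessellation W [set (W : set plane)].
Proof.
have noseg s : ~ tess_segment [set (W : set plane)] s.
  by move=> [[F [[e Fe] FT _ _ _]] _]; apply: inner_edge_trivial (FT _ Fe).
split; last by move=> s s' /noseg.
- split.
  + exact: finite_set1.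
  + move=> c ->; split; last exact: domain_interior.
    * apply: compact_closed; last exact: domain_compact.
      exact: norm_hausdorff.
    * exact: domain_convex.
  + by rewrite bigcup_set1.
  + by move=> c c' -> ->.
  + move=> c ->; exists set0, (frontier W); split => //.
    by rewrite bigcup_set0 set0U.
- by move=> v [e [/inner_edge_trivial]].
Qed.

Definition tessT (W : convex_domain) : Type :=
  {T : set (set plane) | T_tessellation W T}.

HB.instance Definition _ (W : convex_domain) := gen_eqMixin (tessT W).
HB.instance Definition _ (W : convex_domain) := gen_choiceMixin (tessT W).
HB.instance Definition _ (W : convex_domain) :=
  isPointed.Build (tessT W) (exist _ _ (T_tessellation_trivial W)).

Definition hitting_events (W : convex_domain) : set (set (tessT W)) :=
  [set E | exists2 K : set plane, compact K &
     E = [set T : tessT W | skeleton (sval T) `&` K !=set0]].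

(* The measurable space of T-tessellations of [W], with the hitting
   sigma-algebra. *)
Definition T_W (W : convex_domain) := g_sigma_algebraType (@hitting_events W).

Definition L_of (W : convex_domain) (T : T_W W) : set (set plane) :=
  supporting_lines (sval T).

Definition nb_lines (W : convex_domain) (T : T_W W) : nat :=
  #|` fset_set (L_of T)|.

Definition T_on (W : convex_domain) (L : set (set plane)) : set (T_W W) :=
  [set T | L_of T = L].

End tessellations.

Arguments convex_domain : clear implicits.
Arguments T_on {R} W L.

Section poisson.
Context {R : realType}.
Notation plane := (R * R)%type.
Local Open Scope ereal_scope.

Definition Vol : set plane -> \bar R :=
  (@lebesgue_measure R \x @lebesgue_measure R)%E.

(* The parameters of the lines that meet the interior of [W]. *)
Definition hitting_params (W : set plane) : set plane :=
  polar_strip `&` [set x | line_at x `&` interior W !=set0].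

Definition line_intensity (W : set plane) (tau : R) (B : set plane) : R :=
  (tau / fine (Vol (hitting_params W)) *
   fine (Vol (B `&` hitting_params W)))%R.

Definition nb_points {Omega : Type} (X : Omega -> {fset plane}) (B : set plane)
    (w : Omega) : nat := #|` [fset x in X w | x \in B]%fset|.

(* [X] is a Poisson point process of intensity [m] (a finite measure). The
   formula for the Poisson law is also meant for the parameter 0, where
   [poisson_pmf] is not the Dirac mass at 0. *)
Definition poisson_point_process d (Omega : measurableType d)
    (P : probability Omega R) (m : set plane -> R)
    (X : Omega -> {fset plane}) : Prop :=
  [/\ (forall B : set plane, measurable B ->
         measurable_fun setT (nb_points X B)),
      (forall B : set plane, measurable B -> forall k,
         P [set w | nb_points X B w = k] =
         (expR (- m B) * m B ^+ k / k`!%:R)%:E) &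
      (forall n (B : 'I_n -> set plane), (forall i, measurable (B i)) ->
         trivIset setT B -> forall K : 'I_n -> set nat,
         P (\bigcap_i (nb_points X (B i) @^-1` K i)) =
         \prod_(i < n) P (nb_points X (B i) @^-1` K i))].

Definition poisson_line_params (W : convex_domain R) (tau : R) d
    (Omega : measurableType d) (P : probability Omega R)
    (X : Omega -> {fset plane}) : Prop :=
  (forall w, [set` X w] `<=` hitting_params W) /\
  poisson_point_process P (line_intensity W tau) X.

Definition line_set {Omega : Type} (X : Omega -> {fset plane}) (w : Omega) :
    set (set plane) := line_at @` [set` X w].

Definition gibbs_sum (W : convex_domain R) (H : T_W W -> R)
    (A : set (T_W W)) (L : set (set plane)) : \bar R :=
  \esum_(T in T_on W L) (\1_A T * expR (- H T))%:E.

Definition gibbs_weight (W : convex_domain R) (H : T_W W -> R) d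
    (Omega : measurableType d) (P : probability Omega R)
    (X : Omega -> {fset plane}) (A : set (T_W W)) : \bar R :=
  \int[P]_w gibbs_sum H A (line_set X w).

Definition partition_function (W : convex_domain R) (H : T_W W -> R) d
    (Omega : measurableType d) (P : probability Omega R)
    (X : Omega -> {fset plane}) : \bar R :=
  \int[P]_w \esum_(T in T_on W (line_set X w)) (expR (- H T))%:E.

End poisson.

(* Main.v *)
Require Import Defs.
From HB Require Import structures.
From mathcomp Require Import all_boot all_order all_algebra finmap ring lra zify.
From mathcomp Require Import all_classical all_reals all_analysis measurable_realfun.
Set Implicit Arguments.
Unset Strict Implicit.
Unset Printing Implicit Defensive.
Import Order.TTheory GRing.Theory Num.Theory.
Import numFieldNormedType.Exports.
Local Open Scope classical_set_scope.
Local Open Scope card_scope.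
Local Open Scope ring_scope.

(** The Gibbs sum over the T-tessellations on [n] given lines is at most [exp
    (- C n)] times their number. It has to be shown that this number does not
    grow too fast, and that the sums are measurable.

    Counting. A T-tessellation has one segment on each of the [n] lines. These
    segments do not cross, and each of their ends is inside another segment or
    on the boundary of [W] ([tessellation_system]); moreover they determine
    the tessellation ([skeleton_inj]). A bound of their number by [n!] would
    only suffice for small [tau].

    Suppose first that one point, the seed, is known inside each segment. Then
    there are at most [42 ^ n] systems of segments ([seeded_count]). Indeed,
    an end of a segment is inside at most one other segment, so that at least
    three fifths of the segments have at most four ends of other segments
    inside them. Remove such a segment and prolong the ends that it stopped
    ([completion]): this gives a system on the remaining lines. The removed
    segment crosses at most four segments of that system on each side of its
    seed, and it ends on a crossing or on the boundary, so that it is given by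
    two numbers less than five; the tips that it stopped are then known too
    ([filled_inj]). A double count yields the factor [25 * 5 / 3] per line.

    It remains to describe the seeds. The graph of the segments that touch has
    a covering by disjoint stars ([star_cover]), which is encoded by the
    idempotent map from the segments to the centres. Each segment that is not
    isolated then knows another one that it touches, and the contact point,
    moved slightly to one of the two sides, is inside the segment
    ([code_exists]). Hence the number of tessellations is at most [84 ^ n]
    times the number of idempotent maps of [n] points ([tessellation_count]).
    The exponential generating function of these maps is [exp (a exp a)],
    which is finite for all [a] ([idempotent_series]). As the number of lines
    has a Poisson law of parameter at most [tau], the partition function is
    finite ([partition_function_lty]).

    Measurability. A cell of a tessellation on given lines is the part of [W]
    on certain sides of these lines, so that a tessellation is coded by a
    finite set of sign vectors, and the Gibbs sum becomes a finite sum over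
    sets of codes ([esum_codes]). That given codes yield a T-tessellation with
    one segment on each line, and that its edges hit a compact set, can be
    tested on rational points and on the corners of the bounding boxes of the
    edges, which depend measurably on the lines ([event_tessellation_code],
    [event_skeleton_hit]). The random lines themselves are enumerated by boxes
    that isolate their parameters, chosen from a countable family
    ([measurable_esum]). *)

(** * Planar convexity *)

Section planar_convexity.
Context {R : realType}.
Notation plane := (R * R)%type.
Implicit Types (a b c z : plane) (A K : set plane) (t : R).

Lemma rational_near (a e : R) : 0 < e -> exists q : rat, `|a - ratr q| < e.
Proof.
move=> e0; have lt : a - e < a + e by lra.
have [q] := rat_in_itvoo lt; rewrite in_itv /= => /andP[q1 q2].
by exists q; rewrite ltr_norml; lra.
Qed.

Definition lerp a b t : plane :=
  ((1 - t) * a.1 + t * b.1, (1 - t) * a.2 + t * b.2).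

Lemma interiorP A z : interior A z <->
  exists2 e : R, 0 < e & forall x y, `|x - z.1| < e -> `|y - z.2| < e -> A (x, y).
Proof.
split.
- move=> /nbhs_ballP [e /= e0 eA]; exists e => // x y xe ye; apply: eA.
  by split; rewrite /ball /= distrC.
- move=> [e e0 eA]; apply/nbhs_ballP; exists e => // -[x y] [/= xe ye].
  by apply: eA; rewrite distrC.
Qed.

Lemma convex_setP A : convex_set A <->
  forall a b t, A a -> A b -> 0 <= t <= 1 -> A (lerp a b t).
Proof.
split.
- move=> cA a b t Aa Ab t01.
  have t01' : 0 <= 1 - t <= 1 by lra.
  have := cA a b (Itv01 (proj1 (andP t01')) (proj2 (andP t01'))).
  rewrite !inE => /(_ Aa Ab); congr A.
  by rewrite /conv /= /lerp; congr (_, _) => /=; rewrite /unstable.onem /GRing.scale /=; ring.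
- move=> cA a b l; rewrite !inE => Aa Ab.
  have l01 : 0 <= 1 - l%:num <= 1.
    by rewrite subr_ge0 le1 lerBlDr lerDl ge0.
  have := cA _ _ _ Aa Ab l01; congr A.
  by rewrite /conv /= /lerp; congr (_, _) => /=; rewrite /unstable.onem /GRing.scale /=; ring.
Qed.

(** Twice the signed area of the triangle [pqr]. *)
Definition orient p q r : R :=
  (q.1 - p.1) * (r.2 - p.2) - (q.2 - p.2) * (r.1 - p.1).

Lemma affine_pos_near (u v w : R) z : 0 < u * z.1 + v * z.2 + w ->
  exists2 e : R, 0 < e & forall x y, `|x - z.1| < e -> `|y - z.2| < e ->
    0 < u * x + v * y + w.
Proof.
set s := _ + _ => s0.
have M0 : 0 < `|u| + `|v| + 1 by have := normr_ge0 u; have := normr_ge0 v; lra.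
exists (s / (`|u| + `|v| + 1)); first by rewrite divr_gt0.
move=> x y; rewrite !ltr_pdivlMr // => xz yz.
have hx : - (u * (x - z.1)) <= `|u| * `|x - z.1|.
  by rewrite -normrM -normrN ler_norm.
have hy : - (v * (y - z.2)) <= `|v| * `|y - z.2|.
  by rewrite -normrM -normrN ler_norm.
have -> : u * x + v * y + w = s + u * (x - z.1) + v * (y - z.2).
  by rewrite /s; ring.
have := normr_ge0 (x - z.1); have := normr_ge0 (y - z.2).
have := normr_ge0 u; have := normr_ge0 v.
move: hx hy xz yz; move: `|u| `|v| `|x - z.1| `|y - z.2| => U V X Y.
case: (leP X Y) => XY hx hy xz yz V0 U0 Y0 X0.
- have : U * X <= U * Y by rewrite ler_wpM2l.
  nra.
- have : V * Y <= V * X by rewrite ler_wpM2l // ltW.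
  nra.
Qed.

(** The homothety of centre [z] that sends [y] to [lerp y z t] maps a
    neighbourhood of [y] in [A] to a neighbourhood of the image. *)
Lemma interior_lerp A y z t : convex_set A -> interior A y -> A z ->
  0 <= t < 1 -> interior A (lerp y z t).
Proof.
move=> /convex_setP cA /interiorP[e e0 eA] Az /andP[t0 t1].
have t1' : 0 < 1 - t by rewrite subr_gt0.
apply/interiorP; exists ((1 - t) * e); first by rewrite mulr_gt0.
move=> a b /= ae be.
have := cA ((a - t * z.1) / (1 - t), (b - t * z.2) / (1 - t)) z t.
rewrite /lerp /= !(mulrC (1 - t)) !divfK ?gt_eqF // !subrK; apply => //.
- apply: eA.
  + rewrite (_ : _ - y.1 = (a - ((1 - t) * y.1 + t * z.1)) / (1 - t)).
      by rewrite normrM normfV (gtr0_norm t1') ltr_pdivrMr // [e * _]mulrC.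
    by field; rewrite gt_eqF.
  + rewrite (_ : _ - y.2 = (b - ((1 - t) * y.2 + t * z.2)) / (1 - t)).
      by rewrite normrM normfV (gtr0_norm t1') ltr_pdivrMr // [e * _]mulrC.
    by field; rewrite gt_eqF.
- by rewrite t0 ltW.
Qed.

Definition bary p q r (s t : R) : plane :=
  (p.1 + s * (q.1 - p.1) + t * (r.1 - p.1),
   p.2 + s * (q.2 - p.2) + t * (r.2 - p.2)).

Lemma convex_bary A p q r s t : convex_set A -> A p -> A q -> A r ->
  0 <= s -> 0 <= t -> s + t <= 1 -> A (bary p q r s t).
Proof.
move=> /convex_setP cA Ap Aq Ar s0 t0 st1.
have [st0|st0] := eqVneq (s + t) 0.
  have -> : s = 0 by lra. have -> : t = 0 by lra.
  by rewrite /bary !mul0r !addr0 -surjective_pairing.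
have st_gt0 : 0 < s + t by rewrite lt_neqAle eq_sym st0; lra.
have Aqr : A (lerp q r (t / (s + t))).
  apply: cA => //; rewrite divr_ge0 ?addr_ge0 //= ler_pdivrMr //; lra.
have := cA _ _ (s + t) Ap Aqr.
have -> : lerp p (lerp q r (t / (s + t))) (s + t) = bary p q r s t.
  by rewrite /lerp /bary /=; congr (_, _); field.
by apply; lra.
Qed.

Lemma bary_coord p q r z : orient p q r != 0 ->
  z = bary p q r (orient p z r / orient p q r) (orient p q z / orient p q r).
Proof.
move=> D; rewrite [LHS]surjective_pairing /bary /orient in D *.
by congr (_, _); field.
Qed.

(** The coordinates of a point in the frame of the triangle are affine
    functions, so that their signs persist near the point. *)
Lemma triangle_interior A p q r s t : convex_set A -> A p -> A q -> A r ->
  orient p q r != 0 -> 0 < s -> 0 < t -> s + t < 1 ->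
  interior A (bary p q r s t).
Proof.
move=> cA Ap Aq Ar D s0 t0 st1.
set z := bary p q r s t.
have es : orient p z r / orient p q r = s.
  by rewrite /z /bary /orient /= in D *; field.
have et : orient p q z / orient p q r = t.
  by rewrite /z /bary /orient /= in D *; field.
have afs x y : orient p (x, y) r / orient p q r =
    (r.2 - p.2) / orient p q r * x + - ((r.1 - p.1) / orient p q r) * y +
    (p.2 * (r.1 - p.1) - p.1 * (r.2 - p.2)) / orient p q r.
  by rewrite /orient /=; ring.
have aft x y : orient p q (x, y) / orient p q r =
    - ((q.2 - p.2) / orient p q r) * x + (q.1 - p.1) / orient p q r * y +
    (p.1 * (q.2 - p.2) - p.2 * (q.1 - p.1)) / orient p q r.
  by rewrite /orient /=; ring.
have hs := afs z.1 z.2; have ht := aft z.1 z.2.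
rewrite -surjective_pairing es in hs; rewrite -surjective_pairing et in ht.
move: afs aft hs ht.
set a1 := _ / _; set a2 := _ / _; set a3 := _ / _.
set b1 := _ / _; set b2 := _ / _; set b3 := _ / _ => afs aft hs ht.
have [e1 e10 He1] : exists2 e : R, 0 < e & forall x y, `|x - z.1| < e ->
    `|y - z.2| < e -> 0 < a1 * x + - a2 * y + a3.
  by apply: affine_pos_near; rewrite -hs.
have [e2 e20 He2] : exists2 e : R, 0 < e & forall x y, `|x - z.1| < e ->
    `|y - z.2| < e -> 0 < - b1 * x + b2 * y + b3.
  by apply: affine_pos_near; rewrite -ht.
have [e3 e30 He3] : exists2 e : R, 0 < e & forall x y, `|x - z.1| < e ->
    `|y - z.2| < e -> 0 < (b1 - a1) * x + (a2 - b2) * y + (1 - a3 - b3).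
  apply: affine_pos_near; have -> : (b1 - a1) * z.1 + (a2 - b2) * z.2 +
    (1 - a3 - b3) = 1 - (s + t) by rewrite hs ht; ring.
  lra.
apply/interiorP; exists (Num.min e1 (Num.min e2 e3)).
  by rewrite !lt_min e10 e20.
move=> x y; rewrite !lt_min => /and3P[x1 x2 x3] /and3P[y1 y2 y3].
rewrite (bary_coord (x, y) D); apply: convex_bary => //.
- by rewrite afs ltW // He1.
- by rewrite aft ltW // He2.
- by rewrite afs aft; have := He3 x y x3 y3; lra.
Qed.

(** If an interior point lies on the line [pq], move it a little along the
    normal of that line. *)
Lemma interior_off_line A p q : p != q -> interior A !=set0 ->
  exists2 o, interior A o & orient p q o != 0.
Proof.
move=> pq [ o Ao].
have [oo|oo] := eqVneq (orient p q o) 0; last by exists o.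
have : interior (interior A) o.
  by move: (@open_interior _ A) => /interior_id ->.
move=> /interiorP[e e0 eA].
pose m := `|q.1 - p.1| + `|q.2 - p.2| + 1.
have m0 : 0 < m.
  by rewrite /m; have := normr_ge0 (q.1 - p.1); have := normr_ge0 (q.2 - p.2) => *; lra.
pose d := e / m.
have d0 : 0 < d by rewrite divr_gt0.
have dm : d * m = e by rewrite /d divfK // gt_eqF.
exists (o.1 - d * (q.2 - p.2), o.2 + d * (q.1 - p.1)).
- apply: eA.
  + rewrite addrAC subrr add0r normrN normrM gtr0_norm // -dm.
    by rewrite ltr_pM2l // /m; have := normr_ge0 (q.1 - p.1); lra.
  + rewrite addrAC subrr add0r normrM gtr0_norm // -dm.
    by rewrite ltr_pM2l // /m; have := normr_ge0 (q.2 - p.2); lra.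
- have -> : orient p q (o.1 - d * (q.2 - p.2), o.2 + d * (q.1 - p.1)) =
     orient p q o + d * ((q.1 - p.1) ^+ 2 + (q.2 - p.2) ^+ 2).
    by rewrite /orient /=; ring.
  rewrite oo add0r mulf_neq0 // ?gt_eqF //.
  rewrite lt_neqAle addr_ge0 ?sqr_ge0 // andbT eq_sym paddr_eq0 ?sqr_ge0 //.
  rewrite !sqrf_eq0 !subr_eq0; apply: contra pq => /andP[/eqP p1 /eqP p2].
  by rewrite [p]surjective_pairing [q]surjective_pairing p1 p2.
Qed.

Lemma affine_continuous (u v w : R) :
  continuous (fun z : plane => u * z.1 + v * z.2 + w).
Proof.
move=> z; apply: cvgD; last exact: cvg_cst.
apply: cvgD; (apply: cvgM; first exact: cvg_cst);
  [exact: cvg_fst | exact: cvg_snd].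
Qed.

Lemma lerp_continuous a b : continuous (lerp a b).
Proof.
move=> t; have h (x y : R) : (fun s => (1 - s) * x + s * y) @ t -->
    (1 - t) * x + t * y.
  apply: cvgD; apply: cvgM; [ | exact: cvg_cst | exact: cvg_id | exact: cvg_cst].
  by apply: cvgB; [exact: cvg_cst | exact: cvg_id].
exact: (cvg_pair (h a.1 b.1) (h a.2 b.2)).
Qed.

(** The last point of [A] on the way from [y] to [z] is a boundary point. *)
Lemma exit_point A y z : closed A -> A y -> ~ A z ->
  exists t, [/\ 0 <= t < 1, A (lerp y z t) & ~ interior A (lerp y z t)].
Proof.
move=> cA Ay Az.
pose S := [set t : R | A (lerp y z t)] `&` `[0, 1]%classic.
have l0 : lerp y z 0 = y.
  by rewrite /lerp subr0 !mul1r !mul0r !addr0 -surjective_pairing.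
have l1 : lerp y z 1 = z.
  by rewrite /lerp subrr !mul0r !mul1r !add0r -surjective_pairing.
have cS : compact S.
  rewrite /S setIC; apply: compact_closedI; first exact: segment_compact.
  by apply: preimage_closed => // t _; exact: lerp_continuous.
have S0 : S !=set0 by exists 0; split; rewrite /= ?l0 // in_itv /= lexx ler01.
have [t] := @compact_EVT_max _ R id S S0 cS
  (continuous_subspaceT (fun x => cvg_id)).
rewrite inE => -[/= At]; rewrite in_itv /= => /andP[t0 t1] tmax.
have {}t1 : t < 1.
  by rewrite lt_neqAle t1 andbT; apply/eqP => t1E; move: At; rewrite t1E l1.
exists t; split => //; first by rewrite t0.
move=> it; have : nbhs t [set s | A (lerp y z s)] by exact: lerp_continuous.
move=> /nbhs_ballP[e /= e0 eA].
pose s := Num.min (t + e / 2) 1.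
have ts : t < s by rewrite /s lt_min t1 andbT ltrDl divr_gt0.
have se : s - t < e.
  rewrite /s; have : Num.min (t + e / 2) 1 <= t + e / 2 by rewrite ge_min lexx.
  lra.
have : s <= t; last by lra.
apply: tmax; rewrite inE; split; last first.
  by rewrite /= in_itv /= (le_trans t0 (ltW ts)) ge_min lexx orbT.
by apply: eA; rewrite /ball /= distrC gtr0_norm ?subr_gt0.
Qed.

End planar_convexity.

(** * Segments *)

Section segments.
Context {R : realType}.
Notation plane := (R * R)%type.
Implicit Types (p q r v w z : plane) (A K c : set plane) (t : R).

Lemma segmentP p q z :
  segment p q z <-> exists2 t : R, 0 <= t <= 1 & z = lerp p q t.
Proof. by []. Qed.

Lemma lerp0 p q : lerp p q 0 = p.
Proof. by rewrite /lerp subr0 !mul1r !mul0r !addr0 -surjective_pairing. Qed.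

Lemma lerp1 p q : lerp p q 1 = q.
Proof. by rewrite /lerp subrr !mul0r !mul1r !add0r -surjective_pairing. Qed.

Lemma lerp_lerp p q s t u :
  lerp (lerp p q s) (lerp p q t) u = lerp p q ((1 - u) * s + u * t).
Proof. by rewrite /lerp /=; congr (_, _); ring. Qed.

Lemma segment_l p q : segment p q p.
Proof. by exists 0; rewrite ?lexx ?ler01 //; have := lerp0 p q. Qed.

Lemma segment_r p q : segment p q q.
Proof. by exists 1; rewrite ?lexx ?ler01 //; have := lerp1 p q. Qed.

Lemma segment_sym p q : segment p q = segment q p.
Proof.
apply/seteqP; split => z /segmentP[t t01 ->]; apply/segmentP;
  (exists (1 - t); [lra|rewrite /lerp; congr (_, _); ring]).
Qed.

Definition dist2 p q : R := (q.1 - p.1) ^+ 2 + (q.2 - p.2) ^+ 2.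

Lemma dist2_gt0 p q : p != q -> 0 < dist2 p q.
Proof.
move=> pq; rewrite lt_neqAle addr_ge0 ?sqr_ge0 // andbT eq_sym.
rewrite paddr_eq0 ?sqr_ge0 // !sqrf_eq0 !subr_eq0.
apply: contra pq => /andP[/eqP p1 /eqP p2].
by rewrite [p]surjective_pairing [q]surjective_pairing p1 p2.
Qed.

(** The position of the orthogonal projection of [z] on the line [pq], with [p]
    at [0] and [q] at [1]. *)
Definition along p q z : R :=
  ((z.1 - p.1) * (q.1 - p.1) + (z.2 - p.2) * (q.2 - p.2)) / dist2 p q.

Lemma collinear_lerp p q z : p != q -> orient p q z = 0 ->
  z = lerp p q (along p q z).
Proof.
move=> /dist2_gt0 D; rewrite /orient => o.
rewrite [LHS]surjective_pairing /lerp /along; congr (_, _);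
  apply: (mulfI (lt0r_neq0 D)).
- rewrite mulrDr [X in _ = _ + X]mulrA [X in _ + X * _]mulrC divfK ?gt_eqF //.
  rewrite (_ : _ * ((1 - _) * p.1) = (dist2 p q - ((z.1 - p.1) *
    (q.1 - p.1) + (z.2 - p.2) * (q.2 - p.2))) * p.1); last first.
    by field; rewrite gt_eqF.
  apply/eqP; rewrite -subr_eq0; apply/eqP; rewrite /dist2.
  by rewrite -[RHS](mulr0 (- (q.2 - p.2))) -o; ring.
- rewrite mulrDr [X in _ = _ + X]mulrA [X in _ + X * _]mulrC divfK ?gt_eqF //.
  rewrite (_ : _ * ((1 - _) * p.2) = (dist2 p q - ((z.1 - p.1) *
    (q.1 - p.1) + (z.2 - p.2) * (q.2 - p.2))) * p.2); last first.
    by field; rewrite gt_eqF.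
  apply/eqP; rewrite -subr_eq0; apply/eqP; rewrite /dist2.
  by rewrite -[RHS](mulr0 (q.1 - p.1)) -o; ring.
Qed.

Lemma along_lerp p q t : p != q -> along p q (lerp p q t) = t.
Proof.
move=> /dist2_gt0 D; rewrite /along /lerp /=; apply: (mulIf (lt0r_neq0 D)).
by rewrite divfK ?gt_eqF // /dist2; ring.
Qed.

Lemma along_continuous p q : continuous (along p q).
Proof.
have -> : along p q = (fun z => (q.1 - p.1) / dist2 p q * z.1 +
   (q.2 - p.2) / dist2 p q * z.2 +
   - (p.1 * (q.1 - p.1) + p.2 * (q.2 - p.2)) / dist2 p q).
  by apply/funext => z; rewrite /along; ring.
exact: affine_continuous.
Qed.

(** Otherwise [K] would contain a triangle. *)
Lemma convex_no_interior_collinear K p q r : convex_set K ->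
  (forall z, ~ interior K z) -> K p -> K q -> K r -> orient p q r = 0.
Proof.
move=> cK iK Kp Kq Kr; apply/eqP/negPn/negP => D.
have t0 : 0 < 1 / 3 :> R by lra.
by apply: (iK (bary p q r (1 / 3) (1 / 3))); apply: triangle_interior => //; lra.
Qed.

(** All points of [K] are on the line [pq]; the extreme ones are the ends of
    the segment. *)
Lemma compact_convex_segment K p q : compact K -> convex_set K ->
  (forall z, ~ interior K z) -> K p -> K q -> p != q ->
  exists v w, v != w /\ K = segment v w.
Proof.
move=> cK coK iK Kp Kq pq.
have col z : K z -> z = lerp p q (along p q z).
  move=> Kz; apply: collinear_lerp => //.
  exact: (convex_no_interior_collinear coK iK).
have K0 : K !=set0 by exists p.
have ca : {within K, continuous (along p q)}.
  by apply: continuous_subspaceT => z; exact: along_continuous.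
have [v] := compact_EVT_min K0 cK ca; rewrite inE => Kv vmin.
have [w] := compact_EVT_max K0 cK ca; rewrite inE => Kw wmax.
have ap : along p q p = 0 by rewrite -[X in along _ _ X](lerp0 p q) along_lerp.
have aq : along p q q = 1 by rewrite -[X in along _ _ X](lerp1 p q) along_lerp.
have vw : along p q v < along p q w.
  have := vmin p (mem_set Kp); have := wmax q (mem_set Kq); rewrite ap aq; lra.
exists v, w; split; first by apply/eqP => vwE; move: vw; rewrite vwE ltxx.
apply/seteqP; split => z.
- move=> Kz; have vz := vmin z (mem_set Kz); have zw := wmax z (mem_set Kz).
  apply/segmentP; exists ((along p q z - along p q v) /
    (along p q w - along p q v)).
    apply/andP; split; first by apply: divr_ge0; lra.
    by rewrite ler_pdivrMr; lra.
  rewrite {1}(col _ Kz); set s := _ / _.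
  have -> : lerp v w s = lerp p q ((1 - s) * along p q v + s * along p q w).
    by rewrite -lerp_lerp -!col.
  by congr lerp; rewrite /s; field; lra.
- by move=> /segmentP[t t01 ->]; move/convex_setP: coK; exact.
Qed.

Lemma segment_closed_convex v w : convex_set (segment v w).
Proof.
apply/convex_setP => a b t /segmentP[x x01 ->] /segmentP[y y01 ->] t01.
apply/segmentP; exists ((1 - t) * x + t * y); last by rewrite lerp_lerp.
by nra.
Qed.

Lemma segment_compact2 v w : compact (segment v w).
Proof.
have -> : segment v w = lerp v w @` `[0, 1]%classic.
  apply/seteqP; split => z.
    by move=> /segmentP[t t01 ->]; exists t => //=; rewrite in_itv.
  by move=> [t /=]; rewrite in_itv /= => t01 <-; apply/segmentP; exists t.
apply: continuous_compact; last exact: segment_compact.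
by apply: continuous_subspaceT => t; exact: lerp_continuous.
Qed.

End segments.

(** * Partitions of a convex domain into convex cells *)

Section pretessellations.
Context {R : realType}.
Notation plane := (R * R)%type.
Implicit Types (p q x y z : plane) (c e : set plane) (T : set (set plane)).

(** Tessellations without the condition on the frontiers of the cells, which
    then holds by itself: see [cell_partition_polygonal]. *)
Definition cell_partition (W : set plane) T : Prop :=
  [/\ finite_set T,
      (forall c, T c -> [/\ closed c, convex_set c & interior c !=set0]),
      \bigcup_(c in T) c = W &
      (forall c c', T c -> T c' -> c <> c' ->
         interior c `&` interior c' = set0)].

Lemma convex_interior_dense c z (U : set plane) : convex_set c ->
  interior c !=set0 -> c z -> nbhs z U -> exists2 y, interior c y & U y.
Proof.
move=> cc [ o co] cz Uz.
have : nbhs (1 : R) [set t | U (lerp o z t)].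
  by apply: lerp_continuous; rewrite lerp1.
move=> /nbhs_ballP[e /= e0 eU].
pose d := Num.min (e / 2) 1.
have d0 : 0 < d by rewrite lt_min ltr01 divr_gt0.
have d1 : d <= 1 by rewrite ge_min lexx orbT.
have de : d < e.
  have : d <= e / 2 by rewrite ge_min lexx.
  by lra.
exists (lerp o z (1 - d)); last first.
  by apply: eU; rewrite /ball /= opprB addrCA subrr addr0 gtr0_norm.
by apply: interior_lerp => //; lra.
Qed.

Lemma opposite_signs (a b d : R) : a != 0 -> b != 0 -> d != 0 -> ~ 0 < a * b ->
  0 < a * d \/ 0 < b * d.
Proof.
move=> a0 b0 d0 ab; have {}ab : a * b < 0.
  by rewrite lt_neqAle mulf_neq0 //= leNgt; apply/negP.
case: (ltgtP (a * d) 0) => [da|da|/eqP]; [right|by left|].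
  have : 0 < (a * d) * (a * b) by rewrite nmulr_rgt0.
  rewrite (_ : _ * _ = a ^+ 2 * (b * d)); last by ring.
  by rewrite pmulr_rgt0 // exprn_even_gt0.
by rewrite mulf_eq0 (negbTE a0) (negbTE d0).
Qed.

Section cells.
Variables (W : set plane) (T : set (set plane)).
Hypothesis TW : cell_partition W T.

Lemma interior_cell_unique c c' x :
  T c -> T c' -> interior c x -> c' x -> c = c'.
Proof.
move=> Tc Tc' cx c'x; apply: contrapT => cc'.
have [_ TC _ dT] := TW; have ii := dT _ _ Tc Tc' cc'.
have [_ co' i'] := TC _ Tc'.
have nx : nbhs x (interior c) by apply: nbhs_interior.
have [y iy iy'] := convex_interior_dense co' i' c'x nx.
by have : (interior c `&` interior c') y by []; rewrite ii.
Qed.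

(** The cells that do not contain [x] form a finite family of closed sets. *)
Lemma near_cells x : nbhs x [set y | forall c, T c -> c y -> c x].
Proof.
have [fT TC _ _] := TW.
have cF : closed (\bigcup_(c in T `&` [set c | ~ c x]) c).
  apply: closed_bigcup; first by apply: finite_setIl.
  by move=> c [/TC[]].
have : (~` \bigcup_(c in T `&` [set c | ~ c x]) c)° x.
  move/closed_openC: cF => /interior_id ->.
  by move=> [c [Tc ncx]].
apply: filterS => y ny c Tc cy; apply: contrapT => ncx.
by apply: ny; exists c.
Qed.

(** Near an inner point of the segment [pq], a convex set that contains [p],
    [q] and a point off their line fills the side of that point. *)
Lemma same_side c1 c2 p q t o y : T c1 -> T c2 -> p != q ->
  c1 p -> c1 q -> c1 o -> 0 < t < 1 -> c2 (lerp p q t) -> c2 y ->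
  0 < orient p q o * orient p q y -> c1 = c2.
Proof.
move=> T1 T2 pq c1p c1q c1o t01 c2m c2y oy.
have [_ TC _ _] := TW.
have [_ co1 _] := TC _ T1; have [_ co2 _] := TC _ T2.
have D : orient p q o != 0.
  by apply/eqP => D; move: oy; rewrite D mul0r ltxx.
have := bary_coord y D.
set A := _ / _; set B := _ / _ => yE.
have B0 : 0 < B.
  have -> : B = orient p q o * orient p q y / (orient p q o) ^+ 2.
    by rewrite /B; field.
  by rewrite divr_gt0 // exprn_even_gt0.
(* a step of length [e] from the point [lerp p q t] to [y] stays in the
   triangle [pqo] *)
pose m := Num.min t (1 - t).
have [mt m1t m0] : [/\ m <= t, m <= 1 - t & 0 < m].
  rewrite /m lt_min !ge_min !lexx orbT; split=> //; lra.
pose e := m / (2 * (`|A| + B + 1)).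
have M0 : 0 < `|A| + B + 1 by have := normr_ge0 A; lra.
have eM : e * (`|A| + B + 1) = m / 2 by rewrite /e; field; lra.
have e0 : 0 < e by rewrite /e divr_gt0 // mulr_gt0.
have e1 : e <= 1.
  by have := normr_ge0 A; nra.
have eA1 : e * A <= e * `|A| by rewrite ler_pM2l // ler_norm.
have eA2 : - (e * A) <= e * `|A|.
  by rewrite -mulrN ler_pM2l // -normrN ler_norm.
have eB : 0 < e * B by rewrite mulr_gt0.
have eA0 : 0 <= e * `|A| by rewrite mulr_ge0 // ltW.
apply: (@interior_cell_unique _ _ (lerp (lerp p q t) y e)) => //; last first.
  by move/convex_setP: co2; apply => //; rewrite e1 ltW.
have -> : lerp (lerp p q t) y e =
    bary p q o ((1 - e) * t + e * A) (e * B).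
  by rewrite yE /lerp /bary /=; congr (_, _); ring.
apply: triangle_interior => //; nra.
Qed.

(** Each cell contains a point off the line [pq]; of three cells, two have such
    points on the same side. *)
Lemma common_segment_cells c1 c2 c3 p q : T c1 -> T c2 -> T c3 -> c1 <> c2 ->
  p != q -> c1 p -> c1 q -> c2 p -> c2 q -> c3 p -> c3 q ->
  c3 = c1 \/ c3 = c2.
Proof.
move=> T1 T2 T3 n12 pq p1 q1 p2 q2 p3 q3.
have [_ TC _ _] := TW.
have off c : T c -> exists2 o, c o & orient p q o != 0.
  move=> Tc; have [_ _ ic] := TC _ Tc.
  by have [ o /interior_subset co oo] := interior_off_line pq ic; exists o.
have [ o1 c1o1 D1] := off _ T1.
have [ o2 c2o2 D2] := off _ T2.
have [ o3 c3o3 D3] := off _ T3.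
have half : 0 < (1 / 2 : R) < 1 by lra.
have mid c : T c -> c p -> c q -> c (lerp p q (1 / 2)).
  by move=> /TC[_ /convex_setP cc _] cp cq; apply: cc => //; lra.
have S c c' o o' : T c -> T c' -> c p -> c q -> c o -> c' p -> c' q -> c' o' ->
    0 < orient p q o * orient p q o' -> c = c'.
  move=> Tc Tc' cp cq co cp' cq' co' oo.
  by apply: (same_side Tc Tc' pq cp cq co half) co' oo; exact: mid.
have n12' : ~ 0 < orient p q o1 * orient p q o2.
  by move=> /(S c1 c2 o1 o2) h; apply: n12; exact: h.
have [h|h] := opposite_signs D1 D2 D3 n12'; rewrite mulrC in h; [left|right].
  exact: (S c3 c1 o3 o1).
exact: (S c3 c2 o3 o2).
Qed.

(** Two cells with the common points [p] and [q] leave no room for an edge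
    that crosses the segment [pq]. *)
Lemma no_crossing_cells c1 c2 c3 c4 p q t y :
  T c1 -> T c2 -> T c3 -> T c4 -> c1 <> c2 -> p != q ->
  c1 p -> c1 q -> c2 p -> c2 q -> 0 < t < 1 ->
  c3 (lerp p q t) -> c3 y -> c4 (lerp p q t) -> c4 y -> orient p q y != 0 ->
  c3 = c4.
Proof.
move=> T1 T2 T3 T4 n12 pq p1 q1 p2 q2 t01 x3 y3 x4 y4 Dy.
have [_ TC _ _] := TW.
have off c : T c -> exists2 o, c o & orient p q o != 0.
  move=> Tc; have [_ _ ic] := TC _ Tc.
  by have [ o /interior_subset co oo] := interior_off_line pq ic; exists o.
have [ o1 c1o1 D1] := off _ T1.
have [ o2 c2o2 D2] := off _ T2.
have mid : c2 (lerp p q t).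
  by have [_ /convex_setP cc _] := TC _ T2; apply: cc => //; lra.
have n12' : ~ 0 < orient p q o1 * orient p q o2.
  by move=> oo; apply: n12; exact: (same_side T1 T2 pq p1 q1 c1o1 t01 mid c2o2).
have [h|h] := opposite_signs D1 D2 Dy n12'.
- have <- : c1 = c3 by exact: (same_side T1 T3 pq p1 q1 c1o1 t01 x3 y3).
  exact: (same_side T1 T4 pq p1 q1 c1o1 t01 x4 y4).
- have <- : c2 = c3 by exact: (same_side T2 T3 pq p2 q2 c2o2 t01 x3 y3).
  exact: (same_side T2 T4 pq p2 q2 c2o2 t01 x4 y4).
Qed.

(** Reflect a point [y1] of the interior of [c] close to [x] through [x]: the
    image [z] is not in [c]. A path to [z] from an interior point off the line
    of [x] and [y1] leaves [c] at a point other than [x]. The neighbouring cell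
    met there contains [x] too, if everything takes place close enough to [x].
    *)
Lemma shared_boundary c x : T c -> c x -> ~ interior c x -> interior W x ->
  exists c' x', [/\ T c', c' <> c, c' x, x' != x & c x' /\ c' x'].
Proof.
move=> Tc cx ncx Wx.
have [fT TC UT dT] := TW.
have [clc coc ic] := TC _ Tc.
have : nbhs x (interior W `&` [set y | forall c, T c -> c y -> c x]).
  by apply: filterI; [apply: nbhs_interior|exact: near_cells].
move=> /interiorP[e e0 eB].
pose B := [set z : plane | `|z.1 - x.1| < e /\ `|z.2 - x.2| < e].
have BW z : B z -> interior W z /\ forall c, T c -> c z -> c x.
  by case: z => a b [/= a1 b1]; exact: eB.
have Bx : nbhs x B.
  by apply/interiorP; exists e => // a b a1 b1.
have [y1 cy1 By1] := convex_interior_dense coc ic cx Bx.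
have xy1 : x != y1 by apply/eqP => xy; apply: ncx; rewrite xy.
have oB : open B.
  apply/interior_id/seteqP; split; first exact: interior_subset.
  move=> z [z1 z2]; apply/interiorP.
  exists (Num.min (e - `|z.1 - x.1|) (e - `|z.2 - x.2|)).
    by rewrite lt_min !subr_gt0 z1.
  move=> a b; rewrite !lt_min => /andP[a1 _] /andP[_ b1]; split => /=.
    rewrite -(subrK z.1 a) -addrA (le_lt_trans (ler_normD _ _)) //.
    by move: a1; rewrite ltrBrDr.
  rewrite -(subrK z.2 b) -addrA (le_lt_trans (ler_normD _ _)) //.
  by move: b1; rewrite ltrBrDr.
have [y2] : exists2 o, interior (interior c `&` B) o & orient x y1 o != 0.
  apply: interior_off_line => //; exists y1.
  rewrite interiorI; split; first exact: nbhs_interior.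
  by move/interior_id: oB => ->.
move=> /interior_subset[cy2 By2] Dy2.
pose z : plane := (x.1 + x.1 - y1.1, x.2 + x.2 - y1.2).
have Bz : B z.
  by case: By1 => h1 h2; split; rewrite /z /= addrAC addrK distrC.
have ncz : ~ c z.
  move=> cz; apply: ncx.
  have -> : x = lerp y1 z (1 / 2).
    by rewrite [LHS]surjective_pairing /lerp /z /=; congr (_, _); field.
  by apply: interior_lerp => //; lra.
have [t [t01 ct nct]] := exit_point clc (interior_subset cy2) ncz.
set x' := lerp y2 z t in ct nct.
have Bx' : B x'.
  have conv (a b u : R) : `|a - u| < e -> `|b - u| < e ->
      `|(1 - t) * a + t * b - u| < e.
    by rewrite !ltr_norml => ? ?; nra.
  by case: By2 Bz => [? ?] [? ?]; split; exact: conv.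
have x'x : x' != x.
  apply/eqP => /(congr1 (orient x y1)).
  have -> : orient x y1 x = 0 by rewrite /orient; ring.
  have -> : orient x y1 x' = (1 - t) * orient x y1 y2.
    by rewrite /orient /x' /lerp /z /=; ring.
  by move/eqP; rewrite mulf_eq0 (negbTE Dy2) orbF => /eqP; lra.
have [c' [Tc' c'c c'x']] : exists c', [/\ T c', c' <> c & c' x'].
  apply: contrapT => /forallNP H; apply: nct.
  have [Wx' _] := BW _ Bx'.
  have : nbhs x' (interior W `&` [set y | forall c, T c -> c y -> c x']).
    by apply: filterI; [apply: nbhs_interior|exact: near_cells].
  apply: filterS => y [/interior_subset]; rewrite -UT => -[c' Tc' c'y] yx'.
  have [<-//|c'c] := pselect (c' = c).
  by case: (H c'); split => //; exact: yx' c'y.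
exists c', x'; split => //.
by have [_ /(_ _ Tc' c'x')] := BW _ Bx'.
Qed.

End cells.

Lemma polygonal_cell_partition (W : set plane) T :
  polygonal_tessellation W T -> cell_partition W T.
Proof. by case. Qed.

Section convex_domain.
Variables (W : convex_domain R) (T : set (set plane)).
Hypothesis TW : cell_partition W T.

Lemma domain_closed : closed W.
Proof. by apply: compact_closed; [exact: norm_hausdorff|exact: domain_compact]. Qed.

Lemma cell_sub c : T c -> c `<=` W.
Proof. by case: TW => _ _ <- _ Tc z cz; exists c. Qed.

Lemma cell_compact c : T c -> compact c.
Proof.
move=> Tc; apply: subclosed_compact (@domain_compact _ W) (cell_sub Tc).
by case: TW => _ /(_ _ Tc)[].
Qed.

Lemma shared_edge c c' p q : T c -> T c' -> c <> c' -> p != q ->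
  c p -> c q -> c' p -> c' q -> inner_edge T (c `&` c').
Proof.
move=> Tc Tc' n pq cp cq cp' cq'; split; first by exists c, c'.
have [_ TC _ dT] := TW.
have [v [w [vw ->]]] : exists v w, v != w /\ c `&` c' = segment v w.
  apply: (@compact_convex_segment _ _ p q) => //.
  - by apply: compact_closedI (cell_compact Tc) _; case: (TC _ Tc').
  - apply/convex_setP => a b t [ca ca'] [cb cb'] t01.
    have [_ /convex_setP co _] := TC _ Tc.
    have [_ /convex_setP co' _] := TC _ Tc'.
    by split; [exact: co|exact: co'].
  - by move=> z; rewrite interiorI dT.
by exists v, w.
Qed.

Lemma edge_not_interior e c x : inner_edge T e -> e x -> T c -> ~ interior c x.
Proof.
move=> [[c1 [c2 [T1 T2 n12 ->]]] _] [x1 x2] Tc cx; apply: n12.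
rewrite -(interior_cell_unique TW Tc T1 cx x1).
exact: (interior_cell_unique TW Tc T2 cx x2).
Qed.

Lemma frontier_edge c x : T c -> c x -> ~ interior c x -> interior W x ->
  exists e, [/\ inner_edge T e, e x & e `<=` c].
Proof.
move=> Tc cx ncx Wx.
have [c' [x' [Tc' c'c c'x xx' [cx' cx'']]]] := shared_boundary TW Tc cx ncx Wx.
exists (c `&` c'); split => //.
by apply: (@shared_edge c c' x x') => //; [exact/nesym|rewrite eq_sym].
Qed.

Lemma edge_in_cell e : inner_edge T e -> exists2 c, T c & e `<=` c.
Proof. by move=> [[c [c' [Tc _ _ ->]]] _]; exists c. Qed.

(** Inside [W] the frontier of a cell consists of edges by [frontier_edge], and
    a cell shares at most one edge with each other cell. *)
Lemma cell_partition_polygonal : polygonal_tessellation W T.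
Proof.
have [fT TC UT dT] := TW; split => // c Tc.
have [clc coc ic] := TC _ Tc.
have cl : closure c = c by apply/esym/closure_id.
exists [set e | inner_edge T e /\ e `<=` c], (frontier c `&` frontier W).
split.
- apply: (@sub_finite_set _ _ ((fun c' => c `&` c') @` T)); last first.
    exact: finite_image.
  move=> e [[[c1 [c2 [T1 T2 n12 eE]]] [v [w vw eE']]] ec].
  have ev : e v by rewrite eE'; exact: segment_l.
  have ew : e w by rewrite eE'; exact: segment_r.
  move: (ev) (ew); rewrite {1 2}eE => -[v1 v2] [w1 w2].
  have [cE|cE] := common_segment_cells TW T1 T2 Tc n12 vw v1 w1 v2 w2
    (ec _ ev) (ec _ ew).
    by exists c2 => //; rewrite eE cE.
  by exists c1 => //; rewrite eE cE setIC.
- by move=> e [].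
- by move=> z [].
- apply/seteqP; split => x.
    move=> fx; have [Wx|nWx] := pselect (interior W x); last first.
      right; split => //; split => //; apply: subset_closure.
      by case: fx; rewrite cl => cx _; exact: cell_sub cx.
    left; case: fx; rewrite cl => cx ncx.
    by have [e [ie ex ec]] := frontier_edge Tc cx ncx Wx; exists e.
  move=> [[e [ie ec] ex]|[]] //; split; first by rewrite cl; exact: ec.
  exact: edge_not_interior ie ex Tc.
Qed.

End convex_domain.
End pretessellations.

(** * Lines in polar coordinates *)

Section lines.
Context {R : realType}.
Notation plane := (R * R)%type.
Implicit Types (x p q z : plane) (s t : R).

(** The signed distance to the line of parameters [x]. *)
Definition offset x z : R := z.1 * cos x.2 + z.2 * sin x.2 - x.1.

(** An arc length coordinate on the line of parameters [x], and its inverse. *)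
Definition abscissa x z : R := z.2 * cos x.2 - z.1 * sin x.2.
Definition line_point x t : plane :=
  (x.1 * cos x.2 - t * sin x.2, x.1 * sin x.2 + t * cos x.2).

Lemma line_atP x z : line_at x z <-> offset x z = 0.
Proof.
rewrite /line_at /= /offset.
have h : (z.1 - x.1 * cos x.2) * cos x.2 + (z.2 - x.1 * sin x.2) * sin x.2 =
  z.1 * cos x.2 + z.2 * sin x.2 - x.1 * (cos x.2 ^+ 2 + sin x.2 ^+ 2) by ring.
by rewrite h cos2Dsin2 mulr1.
Qed.

Lemma offset_line_point x t : offset x (line_point x t) = 0.
Proof.
rewrite /offset /line_point /=.
have -> : (x.1 * cos x.2 - t * sin x.2) * cos x.2 +
  (x.1 * sin x.2 + t * cos x.2) * sin x.2 - x.1 =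
  x.1 * (cos x.2 ^+ 2 + sin x.2 ^+ 2) - x.1 by ring.
by rewrite cos2Dsin2 mulr1 subrr.
Qed.

Lemma abscissa_line_point x t : abscissa x (line_point x t) = t.
Proof.
rewrite /abscissa /line_point /=.
have -> : (x.1 * sin x.2 + t * cos x.2) * cos x.2 -
  (x.1 * cos x.2 - t * sin x.2) * sin x.2 =
  t * (cos x.2 ^+ 2 + sin x.2 ^+ 2) by ring.
by rewrite cos2Dsin2 mulr1.
Qed.

Lemma line_point_abscissa x z :
  offset x z = 0 -> line_point x (abscissa x z) = z.
Proof.
rewrite /offset /line_point /abscissa => /eqP; rewrite subr_eq0 => /eqP <-.
rewrite [RHS]surjective_pairing -[in RHS](mulr1 z.1) -[in RHS](mulr1 z.2).
by rewrite -(cos2Dsin2 x.2); congr (_, _); ring.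
Qed.

Lemma line_point_inj x : injective (line_point x).
Proof. by move=> s t /(congr1 (abscissa x)); rewrite !abscissa_line_point. Qed.

Lemma line_at_line_point x t : line_at x (line_point x t).
Proof. by apply/line_atP; exact: offset_line_point. Qed.

Lemma line_at_abscissa x z : line_at x z -> z = line_point x (abscissa x z).
Proof. by move=> /line_atP /line_point_abscissa. Qed.

Lemma line_point_lerp x s t u :
  lerp (line_point x s) (line_point x t) u =
  line_point x ((1 - u) * s + u * t).
Proof. by rewrite /lerp /line_point /=; congr (_, _); ring. Qed.

Lemma offset_lerp x p q t :
  offset x (lerp p q t) = (1 - t) * offset x p + t * offset x q.
Proof. by rewrite /offset /lerp /=; ring. Qed.

Lemma abscissa_lerp x p q t :
  abscissa x (lerp p q t) = (1 - t) * abscissa x p + t * abscissa x q.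
Proof. by rewrite /abscissa /lerp /=; ring. Qed.

Lemma orient_offset x p q z : line_at x p -> line_at x q ->
  orient p q z = (abscissa x p - abscissa x q) * offset x z.
Proof.
move=> /line_at_abscissa pE /line_at_abscissa qE.
rewrite pE qE !abscissa_line_point /orient /offset /line_point /=.
move: (abscissa x p) (abscissa x q) => s t.
transitivity ((s - t) * (z.1 * cos x.2 + z.2 * sin x.2 -
  x.1 * (cos x.2 ^+ 2 + sin x.2 ^+ 2))); first by ring.
by rewrite cos2Dsin2 mulr1.
Qed.

Lemma abscissa_inj x p q : line_at x p -> line_at x q ->
  abscissa x p = abscissa x q -> p = q.
Proof. by move=> /line_at_abscissa pE /line_at_abscissa qE; rewrite pE qE !abscissa_line_point => ->. Qed.

Lemma offset_continuous x : continuous (offset x).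
Proof.
have -> : offset x = (fun z => cos x.2 * z.1 + sin x.2 * z.2 + - x.1).
  by apply/funext => z; rewrite /offset; ring.
exact: affine_continuous.
Qed.

Lemma abscissa_continuous x : continuous (abscissa x).
Proof.
have -> : abscissa x = (fun z => - sin x.2 * z.1 + cos x.2 * z.2 + 0).
  by apply/funext => z; rewrite /abscissa; ring.
exact: affine_continuous.
Qed.

Lemma line_point_continuous x : continuous (line_point x).
Proof.
have -> : line_point x = lerp (line_point x 0) (line_point x 1).
  by apply/funext => t; rewrite line_point_lerp; congr line_point; ring.
exact: lerp_continuous.
Qed.

(** For two lines with two common points [sin (x.2 - y.2)] vanishes, hence so
    does [x.2 - y.2], since the strip contains one angle for each direction. *)
Lemma two_points_line x y p q : polar_strip x -> polar_strip y -> p != q ->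
  line_at x p -> line_at x q -> line_at y p -> line_at y q -> x = y.
Proof.
move=> px py pq xp xq yp yq.
have st : abscissa x p - abscissa x q != 0.
  by rewrite subr_eq0; apply: contra pq => /eqP /(abscissa_inj xp xq) ->.
have off z : line_at y z -> line_at x z.
  move=> yz; apply/line_atP.
  have := orient_offset z yp yq; move/line_atP: yz => ->; rewrite mulr0.
  by rewrite (orient_offset z xp xq) => /eqP; rewrite mulf_eq0 (negbTE st) => /eqP.
have /line_atP h0 := off _ (line_at_line_point y 0).
have /line_atP h1 := off _ (line_at_line_point y 1).
have s0 : sin (x.2 - y.2) = 0.
  rewrite sinB; move: h0 h1; rewrite /offset /line_point /=; lra.
have e2 : x.2 = y.2.
  move: px py; rewrite /polar_strip /= => /andP[x0 x1] /andP[y0 y1].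
  apply/eqP; rewrite eq_le !leNgt; apply/andP; split; apply/negP => lt.
    by have : 0 < sin (x.2 - y.2); [apply: sin_gt0_pi|]; lra.
  have : 0 < sin (y.2 - x.2); first by apply: sin_gt0_pi; lra.
  by rewrite -opprB sinN s0 oppr0 ltxx.
move: xp yp => /line_atP + /line_atP; rewrite /offset e2 => xp yp.
by rewrite [x]surjective_pairing [y]surjective_pairing e2; congr (_, _); lra.
Qed.

Lemma line_at_inj x y : polar_strip x -> polar_strip y ->
  line_at x = line_at y -> x = y.
Proof.
move=> px py xy.
apply: (@two_points_line _ _ (line_point x 0) (line_point x 1)) => //.
- by apply/eqP => /line_point_inj; apply/eqP; rewrite eq_sym oner_eq0.
- exact: line_at_line_point.
- exact: line_at_line_point.
- by rewrite -xy; exact: line_at_line_point.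
- by rewrite -xy; exact: line_at_line_point.
Qed.

Lemma line_through p q : p != q ->
  exists x, [/\ polar_strip x, line_at x p & line_at x q].
Proof.
move=> pq.
(* a unit normal in the upper half plane *)
have [u [v [uv pos perp]]] : exists u v : R, [/\ u ^+ 2 + v ^+ 2 = 1,
    (0 < v) || ((v == 0) && (u == 1)) &
    u * (q.1 - p.1) + v * (q.2 - p.2) = 0].
  have := dist2_gt0 pq; rewrite /dist2 => D0.
  set X := q.1 - p.1 in D0 *; set Y := q.2 - p.2 in D0 *.
  have [X0|X0] := eqVneq X 0.
    by exists 1, 0; rewrite eqxx eqxx orbT; split => //; [ring|rewrite X0; ring].
  pose r := Num.sqrt (X ^+ 2 + Y ^+ 2).
  have r0 : 0 < r by rewrite sqrtr_gt0.
  have r2 : r ^+ 2 = X ^+ 2 + Y ^+ 2 by rewrite sqr_sqrtr // ltW.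
  have rn : r != 0 by rewrite gt_eqF.
  have unit (a b : R) : a ^+ 2 + b ^+ 2 = r ^+ 2 ->
      (a / r) ^+ 2 + (b / r) ^+ 2 = 1.
    by move=> h; rewrite !expr_div_n -mulrDl h divff // expf_neq0.
  case: (ltgtP X 0) X0 => // X0 _.
    exists (Y / r), (- X / r); split.
    - by apply: unit; rewrite r2; ring.
    - by rewrite divr_gt0 // oppr_gt0.
    - by field.
  exists (- Y / r), (X / r); split.
  - by apply: unit; rewrite r2; ring.
  - by rewrite divr_gt0.
  - by field.
have v0 : 0 <= v by case/orP: pos => [/ltW//|/andP[/eqP -> _]].
have u1 : -1 <= u <= 1 by nra.
have cu : cos (acos u) = u by apply: acosK; rewrite in_itv.
have su : sin (acos u) = v.
  by rewrite sin_acos // -uv addrAC subrr add0r sqrtr_sqr ger0_norm.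
exists (p.1 * u + p.2 * v, acos u); split.
- rewrite /polar_strip /= acos_ge0 //=.
  case/orP: pos => [v0'|/andP[_ /eqP ->]]; last by rewrite acos1 pi_gt0.
  by apply: acos_ltpi; nra.
- by apply/line_atP; rewrite /offset /= cu su subrr.
- apply/line_atP; rewrite /offset /= cu su -[RHS]perp; ring.
Qed.

(** The abscissas of the points of [W] on the line form a compact interval. It
    is not reduced to a point because the line meets the interior of [W], and a
    point strictly between its ends lies between an end and an interior point
    of [W]. *)
Lemma chord_exists (W : set plane) x : compact W -> convex_set W ->
  line_at x `&` interior W !=set0 ->
  exists lo hi, [/\ lo < hi,
    forall t, W (line_point x t) <-> lo <= t <= hi &
    forall t, lo < t < hi -> interior W (line_point x t)].
Proof.
move=> cW coW [z [xz Wz]].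
pose S := abscissa x @` (W `&` line_at x).
have SP t : S t <-> W (line_point x t).
  split; last first.
    move=> Wt; exists (line_point x t); last exact: abscissa_line_point.
    by split => //; exact: line_at_line_point.
  by move=> [y [Wy xy] <-]; rewrite -line_at_abscissa.
have cS : compact S.
  apply: continuous_compact.
    by apply: continuous_subspaceT => y; exact: abscissa_continuous.
  apply: compact_closedI; first by [].
  have -> : line_at x = offset x @^-1` [set 0].
    by apply/seteqP; split => y /line_atP.
  apply: preimage_closed => [y _|]; first exact: offset_continuous.
  exact: closed_eq.
have S0 : S !=set0.
  by exists (abscissa x z); apply/SP; rewrite -line_at_abscissa //; exact: interior_subset.
have cid := continuous_subspaceT (fun x : R => cvg_id) : {within S, continuous id}.
have [lo] := compact_EVT_min S0 cS cid; rewrite inE => Slo lomin.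
have [hi] := compact_EVT_max S0 cS cid; rewrite inE => Shi himax.
have [e e0 eW] : exists2 e : R, 0 < e & forall t, `|abscissa x z - t| < e -> S t.
  have : nbhs (abscissa x z) [set t | W (line_point x t)].
    by apply: line_point_continuous; rewrite -line_at_abscissa.
  move=> /nbhs_ballP[e /= e0 eB]; exists e => // t te; apply/SP.
  by apply: eB.
pose t0 := abscissa x z.
have lt0 : lo < t0.
  have : lo <= t0 - e / 2.
    apply: lomin; rewrite inE; apply: eW; rewrite -/t0 opprB addrCA subrr addr0.
    by rewrite gtr0_norm ?divr_gt0 //; lra.
  by lra.
have t0h : t0 < hi.
  have : t0 + e / 2 <= hi.
    apply: himax; rewrite inE; apply: eW; rewrite -/t0 opprD addNKr normrN.
    by rewrite gtr0_norm ?divr_gt0 //; lra.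
  by lra.
exists lo, hi; split; first exact: lt_trans t0h.
- move=> t; split.
    by move=> /SP St; rewrite lomin ?inE //= himax // inE.
  move=> /andP[lt th].
  have /SP Wlo := Slo; have /SP Whi := Shi.
  have d0 : 0 < hi - lo by lra.
  have -> : line_point x t =
    lerp (line_point x lo) (line_point x hi) ((t - lo) / (hi - lo)).
    by rewrite line_point_lerp; congr line_point; field; lra.
  move/convex_setP: coW; apply => //.
  by apply/andP; split; [apply: divr_ge0; lra|rewrite ler_pdivrMr //; lra].
- move=> t /andP[lt th].
  have zE : z = line_point x t0 by rewrite -line_at_abscissa.
  have /SP Wlo := Slo; have /SP Whi := Shi.
  have [tt0|t0t] := leP t t0.
    have -> : line_point x t = lerp z (line_point x lo) ((t0 - t) / (t0 - lo)).
      by rewrite zE line_point_lerp; congr line_point; field; lra.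
    apply: interior_lerp => //.
    by apply/andP; split; [apply: divr_ge0; lra|rewrite ltr_pdivrMr; lra].
  have -> : line_point x t = lerp z (line_point x hi) ((t - t0) / (hi - t0)).
    by rewrite zE line_point_lerp; congr line_point; field; lra.
  apply: interior_lerp => //.
  by apply/andP; split; [apply: divr_ge0; lra|rewrite ltr_pdivrMr; lra].
Qed.

End lines.

(** * Edges and segments, line by line *)

Section traces.
Context {R : realType}.
Notation plane := (R * R)%type.
Variables (W : convex_domain R) (T : set (set plane)).
Hypothesis TW : cell_partition W T.
Implicit Types (x p q v z : plane) (e s : set plane).

(** Two distinct common points of two cells belong to no third cell. *)
Lemma edge_overlap e e' p q : inner_edge T e -> inner_edge T e' -> p != q ->
  e p -> e q -> e' p -> e' q -> e = e'.
Proof.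
move=> [[c1 [c2 [T1 T2 n12 ->]]] _] [[c3 [c4 [T3 T4 n34 ->]]] _] pq.
move=> [p1 p2] [q1 q2] [p3 p4] [q3 q4].
have [e3|e3] := common_segment_cells TW T1 T2 T3 n12 pq p1 q1 p2 q2 p3 q3;
have [e4|e4] := common_segment_cells TW T1 T2 T4 n12 pq p1 q1 p2 q2 p4 q4;
rewrite e3 e4 in n34 *; by [case: n34|rewrite setIC|].
Qed.

Lemma finite_edges : finite_set (inner_edge T).
Proof.
have [fT _ _ _] := TW.
apply: (@sub_finite_set _ _ ((fun c => c.1 `&` c.2) @` (T `*` T))).
  by move=> e [[c [c' [Tc Tc' _ ->]]] _]; exists (c, c').
by apply: finite_image; exact: finite_setX.
Qed.

Lemma edge_segment e : inner_edge T e -> exists p q, p != q /\ e = segment p q.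
Proof. by move=> [_ [v [w vw ->]]]; exists v, w. Qed.

Lemma edge_closed e : inner_edge T e -> closed e.
Proof.
have [_ TC _ _] := TW.
by move=> [[c [c' [/TC[? _ _] /TC[? _ _] _ ->]]] _]; exact: closedI.
Qed.

Lemma edge_sub e : inner_edge T e -> e `<=` W.
Proof.
by move=> /edge_in_cell[c Tc ec]; apply: subset_trans ec _; exact: cell_sub Tc.
Qed.

Lemma edge_convex e : inner_edge T e -> convex_set e.
Proof.
by move=> /edge_segment[p [q [_ ->]]]; exact: segment_closed_convex.
Qed.

Lemma near_edges z : nbhs z [set y | forall e, inner_edge T e -> e y -> e z].
Proof.
have cF : closed (\bigcup_(e in inner_edge T `&` [set e | ~ e z]) e).
  apply: closed_bigcup; first by apply: finite_setIl; exact: finite_edges.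
  by move=> e [/edge_closed].
have : (~` \bigcup_(e in inner_edge T `&` [set e | ~ e z]) e)° z.
  move/closed_openC: cF => /interior_id ->.
  by move=> [e [Te nez]].
apply: filterS => y ny e Te ey; apply: contrapT => nez.
by apply: ny; exists e.
Qed.

Definition edges_on x : set (set plane) :=
  [set e | inner_edge T e /\ e `<=` line_at x].

(** The part of the skeleton carried by the line of parameters [x]. *)
Definition trace x : set plane := \bigcup_(e in edges_on x) e.

Lemma segment_sub_line x p q : line_at x p -> line_at x q ->
  segment p q `<=` line_at x.
Proof.
move=> /line_atP xp /line_atP xq z /segmentP[t t01 ->]; apply/line_atP.
by rewrite offset_lerp xp xq !mulr0 addr0.
Qed.

Lemma edge_line e : inner_edge T e ->
  exists2 x, polar_strip x & e `<=` line_at x.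
Proof.
move=> /edge_segment[p [q [pq ->]]].
have [x [px xp xq]] := line_through pq; exists x => //.
exact: segment_sub_line.
Qed.

Lemma edge_line_unique e x y : inner_edge T e -> polar_strip x ->
  polar_strip y -> e `<=` line_at x -> e `<=` line_at y -> x = y.
Proof.
move=> /edge_segment[p [q [pq ->]]] px py ex ey.
by apply: (two_points_line px py pq);
  [apply: ex|apply: ex|apply: ey|apply: ey];
  (exact: segment_l || exact: segment_r).
Qed.

Lemma edge_nonempty e : inner_edge T e -> exists z, e z.
Proof. by move=> /edge_segment[p [q [_ ->]]]; exists p; exact: segment_l. Qed.

Lemma edge_connected e : inner_edge T e -> connected e.
Proof.
move=> /edge_segment[p [q [_ ->]]].
have -> : segment p q = lerp p q @` `[0, 1]%classic.
  apply/seteqP; split => z.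
    by move=> /segmentP[t t01 ->]; exists t => //=; rewrite in_itv.
  by move=> [t /=]; rewrite in_itv /= => t01 <-; apply/segmentP; exists t.
apply: connected_continuous_connected; first exact: segment_connected.
by apply: continuous_subspaceT => t; exact: lerp_continuous.
Qed.

(** The union of all aligned contiguous unions that contain [e] is one of them:
    they all are on the line of [e], and connected through [e]. *)
Lemma edge_in_segment e : inner_edge T e ->
  exists2 s, tess_segment T s & e `<=` s.
Proof.
move=> ie; have [x px ex] := edge_line ie; have [z ez] := edge_nonempty ie.
pose P s := aligned_contiguous_union T s /\ e `<=` s.
have Pe : P e.
  split => //; exists [set e]; split.
  - by exists e.
  - by move=> _ ->.
  - by rewrite bigcup_set1.
  - exact: edge_connected.
  - by exists (line_at x) => //; exists x.
pose F := [set f | exists s G, [/\ P s, G f, G `<=` inner_edge T &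
                                 s = \bigcup_(g in G) g]].
have PF : \bigcup_(f in F) f = \bigcup_(s in P) s.
  apply/seteqP; split => y.
    move=> [f [s [G [Ps Gf GT sE]]] fy]; exists s => //.
    by rewrite sE; exists f.
  move=> [s Ps sy]; have [[G [_ GT sE _ _]] _] := Ps.
  by move: (sy); rewrite sE => -[f Gf fy]; exists f => //; exists s, G.
exists (\bigcup_(s in P) s); last by move=> y ey; exists e.
split.
- exists F; split.
  + have [[G [[f Gf] GT sE _ _]] _] := Pe.
    by exists f, e, G.
  + by move=> f [s [G [_ Gf GT _]]]; exact: GT.
  + by rewrite PF.
  + apply: bigcup_connected; first by exists z => s [_]; exact.
    by move=> s [[G []]].
  + exists (line_at x); first by exists x.
    move=> y [s [[G [_ _ _ _ [l [x' px' ->] sl]]] es] sy].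
    have <- : x' = x by apply: (edge_line_unique ie) => //; exact: subset_trans sl.
    exact: sl.
- move=> s' as' ss'; apply/seteqP; split => // y s'y.
  by exists s' => //; split => // y' ey'; apply: ss'; exists e.
Qed.

Lemma trace_line x : trace x `<=` line_at x.
Proof. by move=> z [e [_ ex] ez]; exact: ex. Qed.

Lemma tess_segment_edges s : tess_segment T s ->
  exists x e, [/\ polar_strip x, s `<=` line_at x, inner_edge T e,
                  e `<=` s & e `<=` line_at x].
Proof.
move=> [[F [[f Ff] FT sE _ [l [x px ->] sl]]] _].
exists x, f; split => //; first exact: FT.
  by move=> z fz; rewrite sE; exists f.
by move=> z fz; apply: sl; rewrite sE; exists f.
Qed.

Lemma segment_sub_trace x s : tess_segment T s -> s `<=` line_at x ->
  s `<=` trace x.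
Proof.
move=> [[F [_ FT sE _ _]] _] sx z; rewrite sE => -[f Ff fz].
exists f => //; split; first exact: FT.
by move=> y fy; apply: sx; rewrite sE; exists f.
Qed.

Lemma trace_contiguous x : polar_strip x -> edges_on x !=set0 ->
  connected (trace x) -> aligned_contiguous_union T (trace x).
Proof.
move=> px x0 cx; exists (edges_on x); split => //; first by move=> e [].
exists (line_at x); [by exists x|exact: trace_line].
Qed.

Lemma segment_eq_trace x s : polar_strip x -> connected (trace x) ->
  tess_segment T s -> s `<=` line_at x -> s = trace x.
Proof.
move=> px cx ts sx; have st := segment_sub_trace ts sx.
have [_ ms] := ts; apply/esym; apply: ms => //.
apply: trace_contiguous => //.
have [y [e [_ _ ie es _]]] := tess_segment_edges ts.
by exists e; split => //; exact: subset_trans sx.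
Qed.

Lemma trace_tess_segment x : polar_strip x -> edges_on x !=set0 ->
  connected (trace x) -> tess_segment T (trace x).
Proof.
move=> px x0 cx; split; first exact: trace_contiguous.
have [e [ie ex]] := x0.
have [s ts es] := edge_in_segment ie.
have sx : s `<=` line_at x.
  have [y [f [py sy _ _ _]]] := tess_segment_edges ts.
  have <- // : y = x.
  by apply: (edge_line_unique ie) => //; exact: subset_trans sy.
by rewrite -(segment_eq_trace px cx ts sx); case: ts.
Qed.

(** Two segments on the same line are aligned, so that there is one segment on
    each line precisely when the edges on each line form a connected set. *)
Lemma segments_by_lines (I : Type) (x : I -> plane) :
  (forall i, polar_strip (x i)) ->
  ((forall s s', tess_segment T s -> tess_segment T s' -> s <> s' ->
      ~ aligned s s') /\
   supporting_lines T = [set line_at (x i) | i in setT]) <->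
  ((forall e, inner_edge T e -> exists i, e `<=` line_at (x i)) /\
   (forall i, edges_on (x i) !=set0 /\ connected (trace (x i)))).
Proof.
move=> px; split.
- move=> [na sl].
  have key s y : tess_segment T s -> polar_strip y -> s `<=` line_at y ->
      exists2 i, y = x i & s `<=` line_at (x i).
    move=> ts py sy; have : supporting_lines T (line_at y).
      by split; [exists y|exists s].
    by rewrite sl => -[i _ /line_at_inj yE]; exists i; rewrite yE //.
  split.
    move=> e ie; have [s ts es] := edge_in_segment ie.
    have [y [f [py sy _ _ _]]] := tess_segment_edges ts.
    have [i _ si] := key _ _ ts py sy; exists i; exact: subset_trans si.
  move=> i; have : supporting_lines T (line_at (x i)) by rewrite sl; exists i.
  move=> [_ [s ts si]].
  have [_ [e [_ _ ie es _]]] := tess_segment_edges ts.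
  split; first by exists e; split => //; exact: subset_trans si.
  suff <- : s = trace (x i) by case: ts => -[F []].
  apply/seteqP; split; first exact: segment_sub_trace.
  move=> z [e' [ie' ei'] ez']; have [s' ts' es'] := edge_in_segment ie'.
  have s'i : s' `<=` line_at (x i).
    have [y [f [py sy _ _ _]]] := tess_segment_edges ts'.
    have <- // : y = x i.
    by apply: (edge_line_unique ie') => //; exact: subset_trans sy.
  have [-> |ss'] := pselect (s = s'); first exact: es'.
  exfalso; apply: (na s s' ts ts' ss'); exists (line_at (x i)); split => //.
  by exists (x i).
- move=> [el tr].
  have key s y : tess_segment T s -> polar_strip y -> s `<=` line_at y ->
      exists i, y = x i.
    move=> ts py sy; have [_ [e [_ _ ie es _]]] := tess_segment_edges ts.
    have [i ei] := el _ ie; exists i.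
    by apply: (edge_line_unique ie) => //; exact: subset_trans sy.
  split.
    move=> s s' ts ts' ss' [l [[y py ->] sy sy']]; apply: ss'.
    have [i yi] := key _ _ ts py sy; rewrite yi in py sy sy'.
    have [_ ci] := tr i.
    by rewrite (segment_eq_trace py ci ts sy) (segment_eq_trace py ci ts' sy').
  apply/seteqP; split => l.
    by move=> [[y py ->] [s ts sy]]; have [i ->] := key _ _ ts py sy; exists i.
  move=> [i _ <-]; split; first by exists (x i).
  have [i0 ci] := tr i.
  by exists (trace (x i)); [exact: trace_tess_segment|exact: trace_line].
Qed.

Lemma trace_sub x : trace x `<=` W.
Proof. by move=> z [e [/edge_sub ie _]]; exact: ie. Qed.

Lemma trace_compact x : compact (trace x).
Proof.
apply: subclosed_compact (@domain_compact _ W) (@trace_sub x).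
apply: closed_bigcup; last by move=> e [/edge_closed].
by apply: sub_finite_set finite_edges => e [].
Qed.

(** The abscissas of the trace form a compact interval. *)
Lemma connected_trace x : edges_on x !=set0 -> connected (trace x) ->
  exists a b, a < b /\ trace x = line_point x @` `[a, b]%classic.
Proof.
move=> [e [ie ex]] ct; pose S := abscissa x @` trace x.
have ca : {within trace x, continuous (abscissa x)}.
  by apply: continuous_subspaceT => z; exact: abscissa_continuous.
have cS : compact S by apply: continuous_compact => //; exact: trace_compact.
have iS : is_interval S.
  by apply/connected_intervalP; exact: connected_continuous_connected.
have [p [q [pq eE]]] := edge_segment ie.
have tp : trace x p by exists e => //; rewrite eE; exact: segment_l.
have tq : trace x q by exists e => //; rewrite eE; exact: segment_r.
have Sp : S (abscissa x p) by exists p.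
have Sq : S (abscissa x q) by exists q.
have S0 : S !=set0 by exists (abscissa x p).
have cid := continuous_subspaceT (fun x : R => cvg_id) :
  {within S, continuous id}.
have [a] := compact_EVT_min S0 cS cid; rewrite inE => Sa amin.
have [b] := compact_EVT_max S0 cS cid; rewrite inE => Sb bmax.
have npq : abscissa x p <> abscissa x q.
  move=> /(abscissa_inj (trace_line tp) (trace_line tq)) pqE.
  by rewrite pqE eqxx in pq.
exists a, b; split.
  have := amin _ (mem_set Sp); have := amin _ (mem_set Sq).
  have := bmax _ (mem_set Sp); have := bmax _ (mem_set Sq).
  by case: (ltgtP (abscissa x p) (abscissa x q)) npq; lra.
apply/seteqP; split => z.
  move=> tz; have Sz : S (abscissa x z) by exists z.
  exists (abscissa x z); last by rewrite -line_at_abscissa //; exact: trace_line.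
  by rewrite /= in_itv /= amin ?inE // bmax // inE.
move=> [t /=]; rewrite in_itv /= => abt <-.
have [y ty <-] := iS _ _ Sa Sb _ abt.
by rewrite -line_at_abscissa //; exact: trace_line.
Qed.

End traces.

(** * The segments of a T-tessellation block each other *)

Section blocked_systems.
Context {R : realType} {I : eqType} {P : Type}.
Variables (line : I -> R -> P) (lo hi : I -> R).
Implicit Types (J : pred I) (s : I -> R * R) (i j : I) (t u : R).

Definition inside (ab : R * R) t : Prop := ab.1 < t < ab.2.

Definition stopped J s i t : Prop :=
  exists j u, [/\ J j, j != i, inside (s j) u & line i t = line j u].

(** What counting retains of a T-tessellation: [s i] is the interval of the
    abscissas on the line [i] of its segment, and [lo i], [hi i] are the ends
    of the chord of the domain on that line. Points may form any type, since it
    only matters which points of two lines coincide. *)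
Definition blocked_system J s : Prop :=
  [/\ (forall i, J i -> [/\ lo i <= (s i).1, (s i).1 < (s i).2 &
                            (s i).2 <= hi i]),
      (forall i j t u, J i -> J j -> i != j -> inside (s i) t ->
         inside (s j) u -> line i t <> line j u),
      (forall i, J i -> (s i).1 = lo i \/ stopped J s i (s i).1) &
      (forall i, J i -> (s i).2 = hi i \/ stopped J s i (s i).2)].

End blocked_systems.

Section from_tessellation.
Context {R : realType}.
Notation plane := (R * R)%type.
Variables (W : convex_domain R) (T : set (set plane)).
Hypothesis TT : T_tessellation W T.
Variables (I : eqType) (x : I -> plane).
Hypothesis px : forall i, polar_strip (x i).
Hypothesis x_inj : injective x.
Hypothesis supp : supporting_lines T = [set line_at (x i) | i in setT].
Variables (lo hi : I -> R).
Hypothesis chord : forall i, [/\ lo i < hi i,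
    forall t, (W : set plane) (line_point (x i) t) <-> lo i <= t <= hi i &
    forall t, lo i < t < hi i -> interior W (line_point (x i) t)].
Implicit Types (p q v z : plane) (e : set plane).

Let TW : cell_partition W T.
Proof. by case: TT => /polygonal_cell_partition. Qed.

Let by_lines : (forall e, inner_edge T e -> exists i, e `<=` line_at (x i)) /\
  (forall i, edges_on T (x i) !=set0 /\ connected (trace T (x i))).
Proof. by have [_ _ na] := TT; exact: (segments_by_lines T px).1 (conj na supp). Qed.

Lemma incident_edge e z : inner_edge T e -> e z -> incident T z e \/
  exists p q t, [/\ e = segment p q, p != q, 0 < t < 1 & z = lerp p q t].
Proof.
move=> ie ez; have [p [q [pq eE]]] := edge_segment ie.
have /segmentP[t /andP[t0 t1] zE] : segment p q z by rewrite -eE.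
have [t0'|t0'] := eqVneq t 0.
  by left; split => //; rewrite eE zE t0' lerp0; exists q.
have [t1'|t1'] := eqVneq t 1.
  left; split => //; rewrite eE zE t1' lerp1; exists p; first by rewrite eq_sym.
  exact: segment_sym.
right; exists p, q, t; split => //.
by rewrite !lt_neqAle eq_sym t0' t0 t1' t1.
Qed.

(** At an inner point of the segment on a line, either one edge passes
    through or two edges meet. *)
Lemma trace_inner_point i (a b t : R) :
  trace T (x i) = line_point (x i) @` `[a, b]%classic -> a < t < b ->
  (exists p q u, [/\ edges_on T (x i) (segment p q), p != q, 0 < u < 1 &
                     line_point (x i) t = lerp p q u]) \/
  (exists e e', [/\ edges_on T (x i) e, edges_on T (x i) e', e <> e',
     incident T (line_point (x i) t) e & incident T (line_point (x i) t) e']).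
Proof.
move=> tr /andP[at_ tb]; set z := line_point (x i) t.
have nz : nbhs t (line_point (x i) @^-1`
    [set y | forall e, inner_edge T e -> e y -> e z]).
  by apply: line_point_continuous; exact: (near_edges TW).
move: nz => /nbhs_ballP[d /= d0 dB].
have near u : `|t - u| < d -> a <= u <= b ->
    exists e, [/\ edges_on T (x i) e, e z & e (line_point (x i) u)].
  move=> ud abu; have : trace T (x i) (line_point (x i) u).
    by rewrite tr; exists u => //=; rewrite in_itv.
  move=> [e [ie ei] eu]; exists e; split => //.
  exact: (dB u ud).
pose h1 := Num.min (d / 2) (b - t); pose h2 := Num.min (d / 2) (t - a).
have [h1d h1b h10] : [/\ h1 <= d / 2, h1 <= b - t & 0 < h1].
  by rewrite /h1 lt_min !ge_min !lexx orbT; split => //; lra.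
have [h2d h2b h20] : [/\ h2 <= d / 2, h2 <= t - a & 0 < h2].
  by rewrite /h2 lt_min !ge_min !lexx orbT; split => //; lra.
have [e [[ie ei] ez eu]] : exists e, [/\ edges_on T (x i) e, e z &
    e (line_point (x i) (t + h1))].
  apply: near; last lra.
  by rewrite opprD addNKr normrN gtr0_norm //; lra.
have [e' [[ie' ei'] ez' eu']] : exists e, [/\ edges_on T (x i) e, e z &
    e (line_point (x i) (t - h2))].
  apply: near; last lra.
  by rewrite opprB addrCA subrr addr0 gtr0_norm //; lra.
have [inc|[p [q [u [eE pq u01 zE]]]]] := incident_edge ie ez; last first.
  by left; exists p, q, u; rewrite -eE.
have [inc'|[p [q [u [eE pq u01 zE]]]]] := incident_edge ie' ez'; last first.
  by left; exists p, q, u; rewrite -eE.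
right; exists e, e'; split => // ee'; rewrite -{}ee' in eu'.
case: inc => _ [w zw eE].
move: eu eu'; rewrite eE => /segmentP[u u01 uE] /segmentP[v v01 vE].
move: uE vE => /(congr1 (abscissa (x i))) + /(congr1 (abscissa (x i))).
rewrite !abscissa_lerp !abscissa_line_point => uE vE.
move: (abscissa (x i) w) uE vE => k uE vE.
have : 0 <= u by lra. have : 0 <= v by lra.
have [kt|kt] := leP k t; nra.
Qed.

(** Vertices have degree one or three. *)
Lemma incident_card z e1 e2 e3 e4 : incident T z e1 -> incident T z e2 ->
  incident T z e3 -> incident T z e4 -> e1 <> e2 -> e1 <> e3 -> e1 <> e4 ->
  e2 <> e3 -> e2 <> e4 -> e3 <> e4 -> False.
Proof.
move=> i1 i2 i3 i4 n12 n13 n14 n23 n24 n34.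
have vz : vertex T z by exists e1.
have [k k3 /card_fset_set ck] : exists2 k, (k <= 3)%N & incident T z #= `I_k.
  have [_ /(_ _ vz) [[c3 _]|[c1 _]] _] := TT; [by exists 3%N|by exists 1%N].
have fi : finite_set (incident T z).
  by apply: sub_finite_set (finite_edges TW) => e [].
have : (size [:: e1; e2; e3; e4] <= size (fset_set (incident T z)))%N.
  apply: uniq_leq_size => [|e].
    rewrite !cons_uniq !in_cons !in_nil !orbF !negb_or [~~ false]/= !andbT.
    by apply/and3P; split; [apply/and3P; split|apply/andP; split|]; case: pselect.
  by rewrite in_fset_set // !in_cons in_nil orbF inE => /or4P[]/eqP ->.
by move: ck; rewrite /= => ->; rewrite leqNgt ltnS k3.
Qed.

(** At a crossing, either an edge of one segment passes through an edge of the
    other, which [no_crossing_cells] excludes, or four edges meet. *)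
Lemma traces_no_crossing i j (a b a' b' t t' : R) : i != j ->
  trace T (x i) = line_point (x i) @` `[a, b]%classic -> a < t < b ->
  trace T (x j) = line_point (x j) @` `[a', b']%classic -> a' < t' < b' ->
  line_point (x i) t <> line_point (x j) t'.
Proof.
move=> ij tri abt trj abt' zE; set z := line_point (x i) t in zE.
have nij e : edges_on T (x i) e -> edges_on T (x j) e -> False.
  move=> [ie ei] [_ ej]; move/eqP: ij; apply; apply: x_inj.
  exact: (edge_line_unique ie).
have through k l (p q y : plane) (u : R) f : k != l ->
    edges_on T (x k) (segment p q) -> p != q ->
    0 < u < 1 -> edges_on T (x l) f -> f (lerp p q u) -> False.
  move=> kl [ie ek] pq u01 [jf fl] fz.
  have [v [w [vw fE]]] := edge_segment jf.
  (* a point of [f] outside the line [k] *)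
  have [y' fy' ny'] : exists2 y, f y & ~ line_at (x k) y.
    apply: contrapT => H; move/eqP: kl; apply; apply: x_inj.
    apply: (edge_line_unique jf) => //.
    by move=> y' fy'; apply: contrapT => ny'; apply: H; exists y'.
  have kp : line_at (x k) p by apply: ek; exact: segment_l.
  have kq : line_at (x k) q by apply: ek; exact: segment_r.
  have Dy : orient p q y' != 0.
    have a1 : abscissa (x k) p - abscissa (x k) q != 0.
      by rewrite subr_eq0; apply: contra pq => /eqP /(abscissa_inj kp kq) ->.
    have a2 : offset (x k) y' != 0.
      by apply/eqP => h; apply: ny'; apply/line_atP.
    by rewrite (orient_offset y' kp kq) mulf_neq0.
  have [[c1 [c2 [T1 T2 n12 eE]]] _] := ie.
  have [[c3 [c4 [T3 T4 n34 fE']]] _] := jf.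
  have [p1 p2] : (c1 `&` c2) p by rewrite -eE; exact: segment_l.
  have [q1 q2] : (c1 `&` c2) q by rewrite -eE; exact: segment_r.
  move: fz fy'; rewrite fE' => -[z3 z4] [y3 y4].
  apply: n34.
  exact: (no_crossing_cells TW T1 T2 T3 T4 n12 pq p1 q1 p2 q2 u01 z3 y3 z4 y4 Dy).
have on k (c d r : R) : trace T (x k) = line_point (x k) @` `[c, d]%classic ->
    c < r < d -> exists2 f, edges_on T (x k) f & f (line_point (x k) r).
  move=> tr cd; have : trace T (x k) (line_point (x k) r).
    by rewrite tr; exists r => //=; rewrite in_itv /=; lra.
  by move=> [f kf fr]; exists f.
have [[p [q [u [ek pq u01 zu]]]]|[e1 [e2 [k1 k2 n12 i1 i2]]]] :=
  trace_inner_point tri abt.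
  have [f jf] := on _ _ _ _ trj abt'; rewrite -zE /z zu.
  exact: (through i j p q z u f ij ek pq u01 jf).
have [[p [q [u [ek pq u01 zu]]]]|[e3 [e4 [k3 k4 n34 i3 i4]]]] :=
  trace_inner_point trj abt'.
  have [f jf] := on _ _ _ _ tri abt; rewrite -/z zE zu.
  by apply: (through j i p q z u f _ ek pq u01 jf); rewrite eq_sym.
have ne e f : edges_on T (x i) e -> edges_on T (x j) f -> e <> f.
  by move=> ei fj ef; apply: (nij e); rewrite // ef.
rewrite -zE in i3 i4.
by apply: (incident_card i1 i2 i3 i4) => //; exact: ne.
Qed.

(** The end of a segment is a vertex. If it is not on the boundary of [W], two
    aligned edges meet there; they are on opposite sides of the vertex, which
    is thus inside the segment that contains them. *)
Lemma trace_end i (s : I -> R * R) (r : R) :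
  (forall k, trace T (x k) = line_point (x k) @` `[(s k).1, (s k).2]%classic) ->
  (s i).1 < (s i).2 -> r = (s i).1 \/ r = (s i).2 -> lo i < r < hi i ->
  stopped (fun k => line_point (x k)) predT s i r.
Proof.
move=> tr ab rE lr; set z := line_point (x i) r.
have trz : trace T (x i) z.
  by rewrite tr; exists r => //=; rewrite in_itv /=; case: rE => ->; lra.
have [e [ie ei] ez] := trz.
have inc : incident T z e.
  have [//|[p [q [u [eE pq u01 zE]]]]] := incident_edge ie ez.
  have pe : e p by rewrite eE; exact: segment_l.
  have qe : e q by rewrite eE; exact: segment_r.
  have bd y : e y -> (s i).1 <= abscissa (x i) y <= (s i).2.
    move=> ey; have : trace T (x i) y by exists e.
    by rewrite tr => -[k /=]; rewrite in_itv /= => kk <-; rewrite abscissa_line_point.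
  have := bd _ pe; have := bd _ qe; have := congr1 (abscissa (x i)) zE.
  rewrite abscissa_lerp abscissa_line_point.
  have npq : abscissa (x i) p <> abscissa (x i) q.
    move=> /(abscissa_inj (ei _ pe) (ei _ qe)) pqE.
    by rewrite pqE eqxx in pq.
  by case: rE => ->; case: (ltgtP (abscissa (x i) p) (abscissa (x i) q)) npq => //; nra.
have vz : vertex T z by exists e.
have [_ /(_ _ vz) [[c3 al]|[_ [_ nW]]] _] := TT; last first.
  by have [_ _ /(_ _ lr)] := chord i.
have [e1 [e2 [i1 i2 n12 [l [[y py ->] e1y e2y]]]]] := al.
have [el tr'] := by_lines.
have [ie1 [w1 zw1 eE1]] := i1; have [ie2 [w2 zw2 eE2]] := i2.
have [j e1j] := el _ ie1.
have yE : y = x j by apply: (edge_line_unique ie1).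
rewrite yE in e1y e2y.
have on k y' f : edges_on T (x k) f -> f y' ->
    (s k).1 <= abscissa (x k) y' <= (s k).2.
  move=> kf fy; have : trace T (x k) y' by exists f.
  by rewrite tr => -[m /=]; rewrite in_itv /= => mm <-; rewrite abscissa_line_point.
have e1w : e1 w1 by rewrite eE1; exact: segment_r.
have e2w : e2 w2 by rewrite eE2; exact: segment_r.
have e1z : e1 z by rewrite eE1; exact: segment_l.
have e2z : e2 z by rewrite eE2; exact: segment_l.
have zl := e1y _ e1z.
have b1 := on j w1 e1 (conj ie1 e1y) e1w.
have b2 := on j w2 e2 (conj ie2 e2y) e2w.
have [jw1 jw2] := (e1y _ e1w, e2y _ e2w).
have n1 : abscissa (x j) z <> abscissa (x j) w1.
  by move=> /(abscissa_inj zl jw1) zE; rewrite zE eqxx in zw1.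
have n2 : abscissa (x j) z <> abscissa (x j) w2.
  by move=> /(abscissa_inj zl jw2) zE; rewrite zE eqxx in zw2.
(* edges on the same side of [z] would overlap *)
have side (f g : set plane) (v w : plane) : inner_edge T f -> inner_edge T g ->
    f = segment z v -> g = segment z w -> line_at (x j) v -> line_at (x j) w ->
    0 < (abscissa (x j) v - abscissa (x j) z) *
        (abscissa (x j) w - abscissa (x j) z) ->
    `|abscissa (x j) v - abscissa (x j) z| <=
      `|abscissa (x j) w - abscissa (x j) z| -> f = g.
  move=> jf jg fE gE jv jw pos le.
  have nv : z != v.
    by apply/eqP => zv; move: pos; rewrite -zv subrr mul0r ltxx.
  apply: (edge_overlap TW jf jg nv).
  - by rewrite fE; exact: segment_l.
  - by rewrite fE; exact: segment_r.
  - by rewrite gE; exact: segment_l.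
  - rewrite gE; apply/segmentP.
    exists ((abscissa (x j) v - abscissa (x j) z) /
            (abscissa (x j) w - abscissa (x j) z)).
      have w0 : abscissa (x j) w - abscissa (x j) z != 0.
        by apply/eqP => w0; move: pos; rewrite w0 mulr0 ltxx.
      have k0 : 0 < (abscissa (x j) v - abscissa (x j) z) /
            (abscissa (x j) w - abscissa (x j) z).
        have -> : (abscissa (x j) v - abscissa (x j) z) /
            (abscissa (x j) w - abscissa (x j) z) =
          (abscissa (x j) v - abscissa (x j) z) *
        (abscissa (x j) w - abscissa (x j) z) /
         (abscissa (x j) w - abscissa (x j) z) ^+ 2 by field.
        by rewrite divr_gt0 // exprn_even_gt0.
      rewrite ltW //= -(ger0_norm (ltW k0)) normrM normfV ler_pdivrMr ?mul1r //.
      by rewrite normr_gt0.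
    rewrite [LHS](line_at_abscissa jv) {1}(line_at_abscissa zl).
    rewrite {1}(line_at_abscissa jw) line_point_lerp; congr line_point.
    by field; apply/eqP => w0; move: pos; rewrite w0 mulr0 ltxx.
have opp : (abscissa (x j) w1 - abscissa (x j) z) *
           (abscissa (x j) w2 - abscissa (x j) z) < 0.
  rewrite ltNge le_eqVlt; apply/negP => /orP[|pos].
    by rewrite eq_sym mulf_eq0 !subr_eq0 => /orP[]/eqP h; [exact: n1|exact: n2].
  case: (leP `|abscissa (x j) w1 - abscissa (x j) z|
             `|abscissa (x j) w2 - abscissa (x j) z|) => [le|/ltW le].
    exact: n12 (side e1 e2 w1 w2 _ _ _ _ _ _ pos le).
  by apply/n12/esym/(side e2 e1 w2 w1) => //; rewrite mulrC.
have ins : inside (s j) (abscissa (x j) z).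
  rewrite /inside; move: opp b1 b2 n1 n2.
  move: (abscissa (x j) w1) (abscissa (x j) w2) (abscissa (x j) z) => u v w.
  case: (ltgtP w u) => //; case: (ltgtP w v) => //; nra.
exists j, (abscissa (x j) z); split => //; last first.
  by rewrite -line_at_abscissa.
apply/eqP => ji; move: ins; rewrite ji /inside abscissa_line_point.
by case: rE => ->; rewrite ltxx ?andbF.
Qed.

Lemma tessellation_system : exists s : I -> R * R,
  (forall i, trace T (x i) = line_point (x i) @` `[(s i).1, (s i).2]%classic) /\
  blocked_system (fun i => line_point (x i)) lo hi predT s.
Proof.
have [_ tr] := by_lines.
have /choice[s sP] : forall i, exists ab : R * R, ab.1 < ab.2 /\
    trace T (x i) = line_point (x i) @` `[ab.1, ab.2]%classic.
  move=> i; have [i0 ci] := tr i.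
  by have [a [b [ab trE]]] := connected_trace TW i0 ci; exists (a, b).
exists s; have trE i : trace T (x i) =
    line_point (x i) @` `[(s i).1, (s i).2]%classic by case: (sP i).
have ch i t : (s i).1 <= t <= (s i).2 -> lo i <= t <= hi i.
  move=> abt; have [_ /(_ t) <- _] := chord i; apply: (trace_sub TW (x := x i)).
  by rewrite trE; exists t => //=; rewrite in_itv.
split => //; split.
- move=> i _; have [ab _] := sP i.
  by have := ch i (s i).1; have := ch i (s i).2; split => //; lra.
- move=> i j t u _ _ ij it ju.
  exact: (traces_no_crossing ij (trE i) it (trE j) ju).
- move=> i _; have [ab _] := sP i; have := ch i (s i).1 => lh.
  have [->|ne] := eqVneq (s i).1 (lo i); [by left|right].
  apply: trace_end => //; first by left.
  have := ch i (s i).2; lra.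
- move=> i _; have [ab _] := sP i; have := ch i (s i).2 => lh.
  have [->|ne] := eqVneq (s i).2 (hi i); [by left|right].
  apply: trace_end => //; first by right.
  have := ch i (s i).1; lra.
Qed.

Lemma skeleton_traces : skeleton T = \bigcup_i trace T (x i).
Proof.
apply/seteqP; split => z [].
  move=> e ie ez; have [i ei] := by_lines.1 _ ie.
  by exists i => //; exists e.
by move=> i _ [e [ie _] ez]; exists e.
Qed.

End from_tessellation.

(** A path in the interior of a cell meets no edge of the skeleton, so that it
    stays inside one cell of the other partition. *)
Lemma skeleton_inj {R : realType} (W : convex_domain R) (T T' : set (set (R * R))) :
  cell_partition W T -> cell_partition W T' -> skeleton T = skeleton T' ->
  T = T'.
Proof.
suff H T1 T2 : cell_partition W T1 -> cell_partition W T2 ->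
    skeleton T1 = skeleton T2 -> T1 `<=` T2.
  by move=> TW TW' E; apply/seteqP; split; apply: H.
move=> W1 W2 E c1 Tc1.
have [f1 C1 U1 _] := W1; have [f2 C2 U2 _] := W2.
have sub T3 T4 c3 c4 y : cell_partition W T3 -> cell_partition W T4 ->
    skeleton T3 = skeleton T4 -> T3 c3 -> T4 c4 -> interior c3 y ->
    interior c4 y -> c4 `<=` c3.
  move=> W3 W4 E34 Tc3 Tc4 y3 y4.
  have [_ C3 _ _] := W3; have [_ C4 _ _] := W4.
  have [cl3 co3 i3] := C3 _ Tc3; have [cl4 co4 i4] := C4 _ Tc4.
  have ic z : interior c4 z -> c3 z.
    move=> z4; apply: contrapT => nz.
    have [t [t01 c3t nt]] := exit_point cl3 (interior_subset y3) nz.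
    have c4t : interior c4 (lerp y z t).
      exact: interior_lerp (interior_subset z4) t01.
    have Wt : interior W (lerp y z t).
      by apply: (interiorS _ c4t) => //; exact: cell_sub Tc4.
    have [e [ie ez _]] := frontier_edge W3 Tc3 c3t nt Wt.
    have : skeleton T4 (lerp y z t) by rewrite -E34; exists e.
    move=> [e' ie' ez'].
    exact: (edge_not_interior W4 ie' ez' Tc4 c4t).
  move=> z c4z; apply: contrapT => nz.
  have nz' : nbhs z (~` c3).
    by apply: open_nbhs_nbhs; split => //; exact: closed_openC.
  by have [z' z'4 nz3] := convex_interior_dense co4 i4 c4z nz'; apply: nz3; exact: ic.
have [cl1 co1 [y y1]] := C1 _ Tc1.
have : (W : set (R * R)) y by exact: cell_sub Tc1 _ (interior_subset y1).
rewrite -U2 => -[c2 Tc2 y2]; have [cl2 co2 i2] := C2 _ Tc2.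
have ny : nbhs y (interior c1) by apply: nbhs_interior.
have [y' y'2 y'1] := convex_interior_dense co2 i2 y2 ny.
suff -> : c1 = c2 by [].
apply/seteqP; split.
  exact: (sub T2 T1 c2 c1 y' W2 W1).
exact: (sub T1 T2 c1 c2 y' W1 W2).
Qed.

(** * Prolonging segments until they are blocked *)

Section completion.
Context {R : realType} {I : finType} {P : Type}.
Variables (line : I -> R -> P) (lo hi : I -> R).
Hypothesis one_crossing : forall i j s s' t t', i != j ->
  line i s = line j t -> line i s' = line j t' -> s = s'.
Implicit Types (J : pred I) (s : {ffun I -> R * R}) (i j k : I) (t u : R).

(** A blocked system whose segments may also have free ends. *)
Definition noncrossing_system J s : Prop :=
  (forall i, J i -> [/\ lo i <= (s i).1, (s i).1 < (s i).2 & (s i).2 <= hi i]) /\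
  (forall i t, J i -> inside (s i) t -> ~ stopped line J s i t).

(** Each [Q j] holds at most at one point, and there are finitely many [j]. *)
Lemma first_hit (Q : I -> R -> Prop) (b h : R) :
  (forall j t t', Q j t -> Q j t' -> t = t') -> b < h ->
  exists t, [/\ b < t, t <= h, forall j u, b < u -> u < t -> ~ Q j u &
                t = h \/ exists j, Q j t].
Proof.
move=> Qu bh.
pose A := [pred j | `[< exists t, [/\ b < t, t < h & Q j t] >]].
have [j0 Aj0|A0] := pickP A; last first.
  exists h; split => //; last by left.
  move=> j u bu uh Qju; have := A0 j; rewrite /= => /asboolP; apply.
  by exists u.
have /choice[f fP] : forall j, exists t, A j -> [/\ b < t, t < h & Q j t].
  move=> j; have [/asboolP[t tP]|nA] := boolP (A j); first by exists t.
  by exists 0.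
have [j Aj jmin] := @arg_minP _ _ _ j0 A f Aj0.
have [bj jh Qj] := fP j Aj.
exists (f j); split => //; first exact: ltW; last by right; exists j.
move=> k u bu uj Qku.
have Ak : A k by apply/asboolP; exists u; split => //; exact: lt_trans jh.
have [_ _ Qk] := fP k Ak; have := jmin k Ak.
by rewrite (Qu _ _ _ Qk Qku) leNgt uj.
Qed.

Definition upd s k (ab : R * R) : {ffun I -> R * R} :=
  [ffun j => if j == k then ab else s j].

Lemma stopped_upd J s k ab t :
  stopped line J (upd s k ab) k t <-> stopped line J s k t.
Proof.
by split => -[j [u [Jj jk iu lu]]]; exists j, u; split => //;
  move: iu; rewrite /upd ffunE (negbTE jk).
Qed.

Lemma noncrossing_upd J s k (a b : R) : noncrossing_system J s -> J k ->
  lo k <= a -> a <= (s k).1 -> (s k).2 <= b -> b <= hi k ->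
  (forall t, a < t < b -> ~ stopped line J s k t) ->
  noncrossing_system J (upd s k (a, b)).
Proof.
move=> [bd nc] Jk loa a1 b2 bhi ns; split.
  move=> i Ji; rewrite /upd ffunE; case: eqP => [->|_]; last exact: bd.
  by have [_ ab _] := bd _ Jk; split => //=; lra.
move=> i t Ji; have [->|ik] := eqVneq i k.
  by rewrite {1}/upd ffunE eqxx => /ns n /stopped_upd.
rewrite {1}/upd ffunE (negbTE ik) => it [j [u [Jj ji]]].
rewrite /upd ffunE; have [->|jk] := eqVneq j k => ju lu.
  by apply: (ns u ju); exists i, t; split.
by apply: (nc i t Ji it); exists j, u.
Qed.

Definition grows s s' : Prop :=
  forall k, (s' k).1 <= (s k).1 /\ (s k).2 <= (s' k).2.

Lemma inside_grows s s' k t : grows s s' -> inside (s k) t -> inside (s' k) t.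
Proof. by move=> g; have [g1 g2] := g k; rewrite /inside; lra. Qed.

Lemma stopped_grows J s s' k t : grows s s' ->
  stopped line J s k t -> stopped line J s' k t.
Proof.
move=> g [j [u [Jj jk ju lu]]]; exists j, u; split => //.
exact: inside_grows g ju.
Qed.

Definition tip (ab : R * R) (e : bool) : R := if e then ab.2 else ab.1.

Definition free_tip J s (ke : I * bool) : bool :=
  [&& J ke.1, `[< tip (s ke.1) ke.2 <> (if ke.2 then hi ke.1 else lo ke.1) >] &
      `[< ~ stopped line J s ke.1 (tip (s ke.1) ke.2) >]].

(** Free tips can be prolonged, one after the other, up to the next obstacle.
    No other tip is set free by this, so that their number decreases. *)
Lemma completion J s : noncrossing_system J s ->
  exists s', [/\ blocked_system line lo hi J s', grows s s',
    (forall k e, tip (s' k) e <> tip (s k) e -> free_tip J s (k, e)) &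
    (forall k, ~~ J k -> s' k = s k)].
Proof.
have [n] := ubnP #|free_tip J s|; elim: n s => // n IH s; rewrite ltnS => sn ws.
have [ke fke|f0] := pickP (free_tip J s); last first.
  exists s; split => //.
  have [bd nc] := ws; split => //.
  - move=> i j t u Ji Jj ij it ju lij; apply: (nc i t Ji it).
    by exists j, u; split => //; rewrite eq_sym.
  - move=> i Ji; have := f0 (i, false); rewrite /free_tip /= Ji /=.
    case: asboolP => /=; first by move=> _ /asboolP/contrapT; right.
    by move=> /contrapT; left.
  - move=> i Ji; have := f0 (i, true); rewrite /free_tip /= Ji /=.
    case: asboolP => /=; first by move=> _ /asboolP/contrapT; right.
    by move=> /contrapT; left.
case: ke fke => k e fke; have /and3P[/= Jk /asboolP ne /asboolP nst] := fke.
have [bd nc] := ws; have [b1 b2 b3] := bd _ Jk.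
have [ab [[la a1 b2' bh] ns oth end_]] : exists ab : R * R,
  [/\ [/\ lo k <= ab.1, ab.1 <= (s k).1, (s k).2 <= ab.2 & ab.2 <= hi k],
     (forall t, ab.1 < t < ab.2 -> ~ stopped line J s k t),
     tip ab (~~ e) = tip (s k) (~~ e) &
     tip ab e = (if e then hi k else lo k) \/ stopped line J s k (tip ab e)].
  pose Q j t := [/\ J j, j != k & exists2 u, inside (s j) u & line k t = line j u].
  have Qu j t t' : Q j t -> Q j t' -> t = t'.
    move=> [_ jk [u _ lu]] [_ _ [u' _ lu']].
    by apply: (one_crossing _ lu lu'); rewrite eq_sym.
  have QP t : stopped line J s k t <-> exists j, Q j t.
    split; first by move=> [j [u [Jj jk ju lu]]]; exists j; split => //; exists u.
    by move=> [j [Jj jk [u ju lu]]]; exists j, u.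
  case: e ne nst {fke} => /= ne nst.
    have bh : (s k).2 < hi k by rewrite lt_neqAle b3 andbT; apply/eqP.
    have [t [bt th nQ tE]] := first_hit Qu bh.
    exists ((s k).1, t); split => //=; first by split => //; exact: ltW.
      move=> u /andP[au ut]; case: (ltgtP u (s k).2) => [ub|bu|->] //.
        by apply: nc; rewrite /inside ?au.
      by move=> /QP[j]; exact: nQ.
    by case: tE => [->|/QP]; [left|right].
  have al : - (s k).1 < - lo k.
    by rewrite ltrN2 lt_neqAle b1 andbT; apply/eqP/nesym.
  have Qu' j t t' : Q j (- t) -> Q j (- t') -> t = t'.
    by move=> h h'; apply: oppr_inj; exact: Qu h h'.
  have [t [bt th nQ tE]] := first_hit Qu' al.
  exists (- t, (s k).2); split => //=; first by split => //; lra.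
    move=> u /andP[tu ub]; case: (ltgtP u (s k).1) => [ua|au|->] //.
      move=> /QP[j Qj]; apply: (nQ j (- u)); rewrite ?opprK //; lra.
    by apply: nc; rewrite /inside ?au.
  case: tE => [->|[j Qj]]; first by left; rewrite opprK.
  by right; apply/QP; exists j.
have w1 : noncrossing_system J (upd s k ab).
  by case: ab la a1 b2' bh ns {oth end_} => a b /= *; exact: noncrossing_upd.
have g1 : grows s (upd s k ab).
  move=> j; rewrite /upd ffunE; case: eqP => [->|_] //; lra.
have sub ke : free_tip J (upd s k ab) ke -> (ke != (k, e)) && free_tip J s ke.
  case: ke => j f; rewrite /free_tip /= => /and3P[Jj /asboolP n1 /asboolP n2].
  have [jk|jk] := eqVneq j k; last first.
    rewrite Jj xpair_eqE (negbTE jk) /=.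
    move: n1 n2; rewrite {1 3}/upd ffunE (negbTE jk) => n1 n2.
    apply/andP; split; apply/asboolP => // st; apply: n2.
    exact: stopped_grows st.
  move: n1 n2; rewrite jk /upd ffunE eqxx -/(upd s k ab) => n1 n2.
  have n2' : ~ stopped line J s k (tip ab f).
    by move=> st; apply: n2; exact/stopped_upd.
  have [fe|fe] := eqVneq f e.
    by move: n1 n2'; rewrite fe; case: end_.
  have fE : f = ~~ e by case: (f) (e) fe => [] [].
  rewrite xpair_eqE (negbTE fe) andbF Jk /=.
  by apply/andP; split; apply/asboolP; rewrite fE -oth -fE.
have [|s' [bs' g' ch' out']] := IH (upd s k ab) _ w1.
  apply: leq_trans sn; apply: proper_card; apply/properP; split.
    apply/fintype.subsetP => ke; rewrite !unfold_in => /sub /andP[_].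
    by [].
  exists (k, e) => //; apply/negP; rewrite unfold_in => /sub.
  by rewrite eqxx.
exists s'; split => //.
- move=> j; have [h1 h2] := g1 j; have [h3 h4] := g' j; split; lra.
- move=> j f; have [[-> ->] _ //|ne'] := eqVneq (j, f) (k, e).
  have same : tip (upd s k ab j) f = tip (s j) f.
    rewrite /upd ffunE; have [jk|//] := eqVneq j k.
    have -> : f = ~~ e.
      by move: ne'; rewrite jk xpair_eqE eqxx /=; case: (f) (e) => [] [].
    by rewrite oth jk.
  by rewrite -same => /ch' /sub /andP[].
- move=> j nJ; rewrite out' // /upd ffunE; case: eqP nJ => // ->.
  by rewrite Jk.
Qed.

End completion.

(** * Counting blocked systems with a known point on each segment *)

Lemma size_fibers (A : eqType) (B : finType) (f : A -> B) (l : seq A) :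
  size l = (\sum_(b : B) size [seq a <- l | f a == b])%N.
Proof.
rewrite -sum1_size (eq_bigr (fun a => (\sum_(b : B) (f a == b))%N)); last first.
  move=> a _; rewrite (bigD1 (f a)) //= eqxx big1 // => b.
  by rewrite eq_sym => /negbTE ->.
rewrite exchange_big; apply: eq_bigr => b _.
by rewrite size_filter -sum1_count [RHS]big_mkcond.
Qed.

Section seeded_systems.
Context {R : realType} {I : finType} {P : Type}.
Variables (line : I -> R -> P) (lo hi : I -> R).
Hypothesis one_crossing : forall i j s s' t t', i != j ->
  line i s = line j t -> line i s' = line j t' -> s = s'.
Variable q : I -> R.
Implicit Types (J : {set I}) (s : {ffun I -> R * R}) (i j k : I) (t u : R).

(** The seed [q i] is a point that is known to be inside the segment [i]. The
    value outside [J] is fixed in order that distinct systems be distinct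
    functions. *)
Definition seeded_system J s : Prop :=
  [/\ blocked_system line lo hi [in J] s,
      (forall i, i \in J -> inside (s i) (q i)) &
      (forall i, i \notin J -> s i = (0, 0))].

Lemma blocked_not_stopped J s i t : blocked_system line lo hi [in J] s ->
  i \in J -> inside (s i) t -> ~ stopped line [in J] s i t.
Proof.
move=> [_ nc _ _] iJ it [j [u [jJ ji ju lu]]].
by apply: (nc i j t u iJ jJ _ it ju lu); rewrite eq_sym.
Qed.

(** The tips that the segment [i] stops. *)
Definition pinned J s i : {set I * bool} :=
  [set ke | [&& ke.1 \in J, ke.1 != i &
     `[< exists2 u, inside (s i) u & line ke.1 (tip (s ke.1) ke.2) = line i u >]]].

Definition lightly_pinned J s : {set I} :=
  [set i in J | (#|pinned J s i| <= 4)%N].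

(** A segment has two tips, and two segments that do not cross cannot both have
    the same tip inside them. *)
Lemma pinned_sum J s : blocked_system line lo hi [in J] s ->
  (\sum_(i in J) #|pinned J s i| <= 2 * #|J|)%N.
Proof.
move=> bs.
have -> : (\sum_(i in J) #|pinned J s i|)%N =
    (\sum_(k in J) \sum_(e : bool) \sum_(i in J) ((k, e) \in pinned J s i))%N.
  rewrite pair_big_dep /= exchange_big /=; apply: eq_bigr => i iJ.
  rewrite -sum1_card big_mkcond /= [RHS]big_mkcond /=.
  apply: eq_bigr => -[k e] _; rewrite !inE /= andbT.
  by case: (k \in J).
rewrite mulnC -sum_nat_const; apply: leq_sum => k kJ.
apply: leq_trans (_ : \sum_(e : bool) 1 <= _)%N; last first.
  by rewrite sum1_card card_bool.
apply: leq_sum => e _.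
have [i /andP[iJ ip]|none] := pickP [pred i | (i \in J) && ((k, e) \in pinned J s i)];
  last first.
  by rewrite big1 // => i iJ; have := none i; rewrite /= iJ /= => ->.
rewrite (bigD1 i) //= ip big1 // => j /andP[jJ ji].
apply/eqP; rewrite eqb0; apply/negP => jp.
move: ip jp; rewrite !inE /= => /and3P[_ _ /asboolP[u iu lu]].
move=> /and3P[_ _ /asboolP[v jv lv]].
have [_ nc _ _] := bs.
by apply: (nc i j u v iJ jJ _ iu jv); rewrite ?lu -?lv // eq_sym.
Qed.

(** A segment stops on average at most two tips, so that at most two fifths of
    the segments stop five or more. *)
Lemma many_lightly_pinned J s : blocked_system line lo hi [in J] s ->
  (3 * #|J| <= 5 * #|lightly_pinned J s|)%N.
Proof.
move=> /pinned_sum le2.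
have sub : lightly_pinned J s \subset J by apply/fintype.subsetP => i; rewrite inE => /andP[].
have : (\sum_(i in J :\: lightly_pinned J s) 5 <= \sum_(i in J) #|pinned J s i|)%N.
  rewrite [X in (_ <= X)%N](big_setID (lightly_pinned J s)) /=.
  apply: leq_trans (leq_addl _ _); apply: leq_sum => i.
  by rewrite !inE => /andP[+ iJ]; rewrite iJ /= -ltnNge.
rewrite sum_nat_const => le5.
have := cardsID (lightly_pinned J s) J; rewrite (finset.setIidPr sub) => cJ.
move: le2 le5 cJ; set A := #|J|; set B := #|_ :\: _|; set D := #|_|.
set S := (\sum_(_ in _) _)%N; lia.
Qed.

Section removal.
Variables (J : {set I}) (i : I).
Hypothesis iJ : i \in J.

(** [s'] is [s] without the segment [i], the tips on [i] being prolonged. *)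
Definition filled s s' : Prop :=
  [/\ seeded_system (J :\ i) s', grows [ffun k => if k == i then (0, 0) else s k] s' &
   forall k e, k != i -> tip (s' k) e <> tip (s k) e -> (k, e) \in pinned J s i].

Lemma filled_exists s : seeded_system J s -> exists s', filled s s'.
Proof.
move=> [bs qs out].
pose s0 : {ffun I -> R * R} := [ffun k => if k == i then (0, 0) else s k].
have s0E k : k \in J :\ i -> s0 k = s k.
  by rewrite !inE /s0 ffunE => /andP[/negbTE ->].
have stE k t : k \in J :\ i -> stopped line [in J :\ i] s0 k t ->
    stopped line [in J] s k t.
  move=> kJ [j [u [jJ jk ju lu]]]; exists j, u; rewrite -(s0E j) //; split => //.
  by move: jJ; rewrite !inE => /andP[].
have [bd _ _ _] := bs.
have w0 : noncrossing_system line lo hi [in J :\ i] s0.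
  split=> [k kJ|k t kJ].
    by rewrite s0E //; apply: bd; move: kJ; rewrite !inE => /andP[].
  rewrite s0E // => kt /(stE _ _ kJ); apply: blocked_not_stopped bs _ kt.
  by move: kJ; rewrite !inE => /andP[].
have [s' [bs' g ch out']] := completion one_crossing w0.
exists s'; split => //.
  split => //.
    move=> k kJ; apply: inside_grows g _; rewrite s0E //; apply: qs.
    by move: kJ; rewrite !inE => /andP[].
  move=> k kJ; rewrite out' // /s0 ffunE; case: eqP => // ki; apply: out.
  by move: kJ; rewrite !inE negb_and negbK; case: eqP ki.
move=> k e ki; have -> : s k = s0 k by rewrite /s0 ffunE (negbTE ki).
move=> /ch /and3P[/= kJ /asboolP ne /asboolP nst].
rewrite s0E // in ne nst.
have kJ' : k \in J by move: kJ; rewrite !inE => /andP[].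
rewrite !inE kJ' ki /=; apply/asboolP.
have [_ _ b1 b2] := bs.
have : stopped line [in J] s k (tip (s k) e).
  by case: e ne {nst} => /= ne; [case: (b2 _ kJ')|case: (b1 _ kJ')].
move=> [j [u [jJ jk ju lu]]].
have [ji|ji] := eqVneq j i; first by exists u; rewrite -?ji.
exfalso; apply: nst; exists j, u; split => //; first by rewrite !inE ji jJ.
by rewrite s0E // !inE ji jJ.
Qed.

Lemma filled_grows s s' k : filled s s' -> k != i ->
  (s' k).1 <= (s k).1 /\ (s k).2 <= (s' k).2.
Proof. by move=> [_ /(_ k) + _] ki; rewrite ffunE (negbTE ki). Qed.

Lemma pinned_tip s s' k e : filled s s' -> k != i ->
  tip (s' k) e = tip (s k) e \/
  exists2 u, inside (s i) u & line k (tip (s k) e) = line i u.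
Proof.
move=> [_ _ ch] ki; have [|ne] := pselect (tip (s' k) e = tip (s k) e); first by left.
by right; have := ch k e ki ne; rewrite inE => /and3P[_ _ /asboolP].
Qed.

(** The segments did not cross in [s], so that the crossing with [i] belongs to
    the prolongation of a tip. *)
Lemma hit_is_tip s s' k t u : seeded_system J s -> filled s s' ->
  k \in J :\ i -> inside (s i) t -> inside (s' k) u -> line i t = line k u ->
  exists e, (k, e) \in pinned J s i.
Proof.
move=> [bs _ _] fs kJ it ku lu.
have ki : k != i by move: kJ; rewrite !inE => /andP[].
have kJ' : k \in J by move: kJ; rewrite !inE => /andP[].
have [_ _ ch] := fs.
have nk : ~ inside (s k) u.
  move=> ku'; apply: (blocked_not_stopped bs iJ it).
  by exists k, u.
have [uk|uk] := leP u (s k).1.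
  exists false; apply: ch => //= e1; move: ku; rewrite /inside e1; lra.
exists true; apply: ch => //= e1; move: ku nk; rewrite /inside e1; lra.
Qed.

(** What the line [i] crosses in the filled system. The ends of the removed
    segment are recovered by counting these crossings from the seed [q i]. *)
Definition between (a b : R) s' : {set I} :=
  [set k in J :\ i | `[< exists t u, [/\ a < t < b, inside (s' k) u &
                                        line i t = line k u] >]].

Lemma between_le4 s s' (a b : R) : seeded_system J s -> filled s s' ->
  i \in lightly_pinned J s -> (s i).1 <= a -> b <= (s i).2 ->
  (#|between a b s'| <= 4)%N.
Proof.
move=> ss fs; rewrite inE => /andP[_ le4] sa bs.
apply: leq_trans le4; apply: leq_trans (leq_imset_card fst _).
apply: subset_leq_card; apply/fintype.subsetP => k.
rewrite inE => /andP[kJ /asboolP[t [u [tab ku lu]]]].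
have [|e ep] := hit_is_tip ss fs kJ _ ku lu; first by rewrite /inside; lra.
by apply/imsetP; exists (k, e).
Qed.

Lemma between_sub s' (a b a' b' : R) : a' <= a -> b <= b' ->
  between a b s' \subset between a' b' s'.
Proof.
move=> aa bb; apply/fintype.subsetP => k.
rewrite !inE => /andP[-> /asboolP[t [u [tab ku lu]]]] /=.
by apply/asboolP; exists t, u; split => //; lra.
Qed.

Lemma between_crossing s' (a b a' b' t u : R) k : a' <= a -> b <= b' ->
  k \in J :\ i -> inside (s' k) u -> line i t = line k u -> a' < t < b' ->
  ~ a < t < b -> (#|between a b s'| < #|between a' b' s'|)%N.
Proof.
move=> aa bb kJ ku lu tab' tab; apply: proper_card; apply/properP.
split; first exact: between_sub.
have ki : i != k by move: kJ; rewrite !inE eq_sym => /andP[].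
exists k; rewrite inE kJ /=; first by apply/asboolP; exists t, u.
apply/asboolP => -[t' [u' [tab2 ku' lu']]]; apply: tab.
by rewrite (one_crossing ki lu lu').
Qed.

Definition rank_left s s' : nat := #|between (s i).1 (q i) s'|.
Definition rank_right s s' : nat := #|between (q i) (s i).2 s'|.

Lemma stopped_filled s s' t : filled s s' -> stopped line [in J] s i t ->
  exists k u, [/\ k \in J :\ i, inside (s' k) u & line i t = line k u].
Proof.
move=> fs [k [u [kJ ki ku lu]]]; exists k, u; split => //.
  by rewrite !inE ki.
by have := filled_grows fs ki; move: ku; rewrite /inside; lra.
Qed.

(** If the segments [i] of [s1] and [s2] had different ends on one side, the
    longer one would cross strictly more segments of [s'], since the shorter
    one ends on one of them. Once the segment [i] is known, a tip of [s'] that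
    was prolonged was at the crossing with the line [i], and which tips were
    prolonged is also determined: a tip that only one of the two systems
    prolongs would make the other system cross. *)
Lemma filled_inj s1 s2 s' : seeded_system J s1 -> seeded_system J s2 ->
  filled s1 s' -> filled s2 s' -> rank_left s1 s' = rank_left s2 s' ->
  rank_right s1 s' = rank_right s2 s' -> s1 = s2.
Proof.
move=> ss1 ss2 f1 f2 rl rr.
have le_right s3 s4 : seeded_system J s3 -> seeded_system J s4 ->
    filled s3 s' -> filled s4 s' -> rank_right s3 s' = rank_right s4 s' ->
    (s4 i).2 <= (s3 i).2.
  move=> [bs3 qs3 _] [bs4 qs4 _] f3 f4 r; rewrite leNgt; apply/negP => lt.
  have [bd4 _ _ _] := bs4; have [_ _ _ b3] := bs3.
  have [_ _ h4] := bd4 _ iJ; have q3 := qs3 _ iJ.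
  have [h3|/(stopped_filled f3)[k [u [kJ ku lu]]]] := b3 _ iJ.
    by move: h4 lt; rewrite h3; lra.
  have : (#|between (q i) (s3 i).2 s'| < #|between (q i) (s4 i).2 s'|)%N.
    apply: (between_crossing _ _ kJ ku lu); rewrite ?lexx ?(ltW lt) //.
      by move: q3; rewrite /inside; lra.
    by rewrite ltxx andbF.
  by rewrite -/(rank_right s3 s') -/(rank_right s4 s') r ltnn.
have le_left s3 s4 : seeded_system J s3 -> seeded_system J s4 ->
    filled s3 s' -> filled s4 s' -> rank_left s3 s' = rank_left s4 s' ->
    (s3 i).1 <= (s4 i).1.
  move=> [bs3 qs3 _] [bs4 qs4 _] f3 f4 r; rewrite leNgt; apply/negP => lt.
  have [bd4 _ _ _] := bs4; have [_ _ b3 _] := bs3.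
  have [h4 _ _] := bd4 _ iJ; have q3 := qs3 _ iJ.
  have [h3|/(stopped_filled f3)[k [u [kJ ku lu]]]] := b3 _ iJ.
    by move: h4 lt; rewrite h3; lra.
  have : (#|between (s3 i).1 (q i) s'| < #|between (s4 i).1 (q i) s'|)%N.
    apply: (between_crossing _ _ kJ ku lu); rewrite ?lexx ?(ltW lt) //.
      by move: q3; rewrite /inside; lra.
    by rewrite ltxx.
  by rewrite -/(rank_left s3 s') -/(rank_left s4 s') r ltnn.
have eqi : s1 i = s2 i.
  rewrite [s1 i]surjective_pairing [s2 i]surjective_pairing.
  congr (_, _); apply/eqP; rewrite eq_le.
    by rewrite (le_left s1 s2) //= (le_left s2 s1).
  by rewrite (le_right s2 s1) //= (le_right s1 s2).
have tips s3 s4 k e : seeded_system J s3 -> seeded_system J s4 ->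
    filled s3 s' -> filled s4 s' -> s3 i = s4 i -> k \in J :\ i ->
    tip (s' k) e = tip (s3 k) e ->
    (exists2 u, inside (s4 i) u & line k (tip (s4 k) e) = line i u) ->
    tip (s3 k) e = tip (s4 k) e.
  move=> [bs3 qs3 _] [bs4 qs4 _] f3 f4 e34 kJ te [u iu lu].
  have ki : k != i by move: kJ; rewrite !inE => /andP[].
  have kJ' : k \in J by move: kJ; rewrite !inE => /andP[].
  apply: contrapT => ne.
  apply: (blocked_not_stopped bs3 iJ (t := u)); first by rewrite e34.
  exists k, (tip (s4 k) e); split => //.
  have := filled_grows f4 ki; have := qs3 _ kJ'; have := qs4 _ kJ'.
  by case: e te ne {lu} => /= te ne; rewrite /inside;
    move: ne; rewrite -te => /eqP; rewrite eq_sym => ne h3 h4 [g1 g2];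
    move: ne; rewrite neq_lt => /orP[] ?; lra.
apply/ffunP => k; have [kJ|kJ] := boolP (k \in J :\ i); last first.
  have [->//|ki] := eqVneq k i.
  have kJ' : k \notin J by move: kJ; rewrite !inE ki.
  by have [_ _ ->] := ss1 => //; have [_ _ ->] := ss2.
have ki : k != i by move: kJ; rewrite !inE => /andP[].
have te e : tip (s1 k) e = tip (s2 k) e.
  have [t1|[u1 iu1 lu1]] := pinned_tip e f1 ki.
    have [t2|p2] := pinned_tip e f2 ki; first by rewrite -t1 -t2.
    exact: (tips s1 s2 k e ss1 ss2 f1 f2 eqi kJ t1 p2).
  have [t2|[u2 iu2 lu2]] := pinned_tip e f2 ki.
    apply/esym/(tips s2 s1 k e ss2 ss1 f2 f1 (esym eqi) kJ t2).
    by exists u1.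
  exact: (one_crossing ki lu1 lu2).
rewrite [s1 k]surjective_pairing [s2 k]surjective_pairing.
by congr (_, _); [exact: (te false)|exact: (te true)].
Qed.

(** In the filled system, a lightly pinned segment meets at most four others on
    each side of its seed, which leaves [5 * 5] pairs of ranks. *)
Lemma removal_count (N : nat) (l : seq {ffun I -> R * R}) :
  (forall l', uniq l' -> (forall s, s \in l' -> seeded_system (J :\ i) s) ->
     (size l' <= N)%N) ->
  uniq l -> (forall s, s \in l -> seeded_system J s /\ i \in lightly_pinned J s) ->
  (size l <= 25 * N)%N.
Proof.
move=> HN ul lP.
have /choice[fill fillP] : forall s, exists s', seeded_system J s -> filled s s'.
  move=> s; have [ss|ns] := pselect (seeded_system J s); last by exists s.
  by have [s' fs] := filled_exists ss; exists s'.
pose f s : 'I_5 * 'I_5 :=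
  (inord (rank_left s (fill s)), inord (rank_right s (fill s))).
have rk s : s \in l -> (rank_left s (fill s) < 5)%N /\ (rank_right s (fill s) < 5)%N.
  move=> /lP[ss il]; have fs := fillP _ ss; have [_ qs _] := ss.
  have := qs _ iJ; rewrite /inside => /andP[q1 q2].
  by split; rewrite ltnS; apply: (between_le4 ss fs il); rewrite ?lexx // ltW.
rewrite (size_fibers f).
apply: leq_trans (_ : \sum_(b : 'I_5 * 'I_5) N <= _)%N; last first.
  by rewrite sum_nat_const card_prod card_ord.
apply: leq_sum => b _; rewrite -(size_map fill); apply: HN.
  rewrite map_inj_in_uniq ?filter_uniq // => s1 s2.
  rewrite !mem_filter => /andP[/eqP b1 l1] /andP[/eqP b2 l2] fE.
  have [ss1 _] := lP _ l1; have [ss2 _] := lP _ l2.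
  have f2 := fillP _ ss2; rewrite -fE in f2.
  have [r1 r1'] := rk _ l1; have [r2 r2'] := rk _ l2.
  have /(congr1 val) := congr1 fst (etrans b1 (esym b2)).
  have /(congr1 val) := congr1 snd (etrans b1 (esym b2)).
  rewrite /= !inordK // -fE => rr rl.
  exact: (filled_inj ss1 ss2 (fillP _ ss1) f2 rl rr).
move=> s' /mapP[s]; rewrite mem_filter => /andP[_ /lP[ss _]] ->.
by have [] := fillP _ ss.
Qed.

End removal.

(** Count the pairs of a system and a lightly pinned segment of it: a system
    has at least [3 / 5 * #|J|] such segments, and by induction each line has
    one in at most [25 * 42 ^ #|J|.-1] systems; finally [25 * 5 / 3 <= 42]. *)
Lemma seeded_count J (l : seq {ffun I -> R * R}) : uniq l ->
  (forall s, s \in l -> seeded_system J s) -> (size l <= 42 ^ #|J|)%N.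
Proof.
have [n] := ubnP #|J|; elim: n J l => // n IH J l; rewrite ltnS => Jn ul lP.
have [JE|[i0 iJ0]] := set_0Vmem J.
  rewrite JE cards0 expn0.
  have sub : {subset l <= [:: [ffun=> (0, 0)]]}.
    move=> s /lP[_ _ out]; rewrite inE; apply/eqP/ffunP => k.
    by rewrite ffunE out // JE inE.
  exact: uniq_leq_size ul sub.
have J0 : (0 < #|J|)%N by apply/card_gt0P; exists i0.
have cnt : (3 * #|J| * size l <= 5 * (#|J| * (25 * 42 ^ #|J|.-1)))%N.
  apply: leq_trans (_ : \sum_(s <- l) 5 * #|lightly_pinned J s| <= _)%N.
    rewrite -sum1_size big_distrr /= !big_seq; apply: leq_sum => s sl.
    by rewrite muln1; apply: many_lightly_pinned; have [] := lP _ sl.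
  rewrite -big_distrr leq_mul2l /=.
  rewrite (eq_bigr (fun s => \sum_(i in J) (i \in lightly_pinned J s))%N); last first.
    move=> s _; rewrite -sum1_card big_mkcond [RHS]big_mkcond /=.
    by apply: eq_bigr => i _; rewrite !inE; case: (i \in J).
  rewrite exchange_big /= -sum_nat_const; apply: leq_sum => i iJ.
  have -> : (\sum_(s <- l) (i \in lightly_pinned J s) =
    size [seq s <- l | i \in lightly_pinned J s])%N.
    by rewrite size_filter -sum1_count [RHS]big_mkcond.
  have cJ : #|J :\ i| = #|J|.-1 by rewrite (cardsD1 i J) iJ.
  apply: (removal_count iJ); rewrite ?filter_uniq //.
    move=> l' ul' lP'; rewrite -cJ; apply: IH => //.
    by rewrite cJ -ltnS prednK.
  by move=> s; rewrite mem_filter => /andP[il /lP].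
have -> : (42 ^ #|J| = 42 * 42 ^ #|J|.-1)%N by rewrite -expnS prednK.
have : (#|J| * (3 * size l) <= #|J| * (125 * 42 ^ #|J|.-1))%N.
  by move: cnt; rewrite -!mulnA (mulnCA 3) (mulnCA 5) (mulnA 5 25).
rewrite leq_pmul2l //; move: (42 ^ #|J|.-1)%N => K; lia.
Qed.

End seeded_systems.

(** * Finding a point on each segment *)

Section star_cover.
Variables (I : finType) (g : rel I).
Hypothesis g_sym : symmetric g.
Hypothesis g_irr : irreflexive g.
Implicit Types (c : {ffun I -> I}) (i j : I).

Definition idempotent_ffun c : bool := [forall i, c (c i) == c i].

(** [c] sends each vertex to the centre of its star. *)
Definition star_map c : bool :=
  idempotent_ffun c && [forall i, (c i != i) ==> g i (c i)].

Definition moved c : {set I} := [set i | c i != i].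

Lemma star_mapP c : reflect
  ((forall i, c (c i) = c i) /\ (forall i, c i != i -> g i (c i))) (star_map c).
Proof.
apply: (iffP andP) => -[h1 h2]; split.
- by move=> i; apply/eqP; move/forallP: h1; exact.
- by move=> i; move/forallP: h2 => /(_ i)/implyP.
- by apply/forallP => i; rewrite h1.
- by apply/forallP => i; apply/implyP; exact: h2.
Qed.

(** A graph is covered by disjoint stars, and only its isolated vertices form
    stars without leaves: among the star maps that move the most vertices, one
    with the most centres is such a cover. *)
Lemma star_cover : exists c, star_map c /\
  forall i, c i = i -> (forall j, j != i -> c j != i) -> forall j, ~~ g i j.
Proof.
(* compares the number of moved vertices first, then the number of centres *)
pose Phi c := (#|moved c| * #|I|.+1 + #|c @: moved c|)%N.
have id0 : star_map [ffun i => i].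
  by apply/star_mapP; split => i; rewrite !ffunE ?eqxx.
have [c /star_mapP[cc cg] cmax] := @arg_maxnP _ [ffun i => i] star_map Phi id0.
have more c' : star_map c' -> (#|moved c| < #|moved c'|)%N -> False.
  move=> /cmax; rewrite /Phi => le lt.
  have : (#|c @: moved c| <= #|I|)%N by exact: max_card.
  by have := leq_mul lt (leqnn #|I|.+1); rewrite mulSn; lia.
exists c; split; first by apply/star_mapP.
move=> d cd nd u; apply/negP => gdu.
have ud : u != d by apply: contraTneq gdu => ->; rewrite g_irr.
have [cu|cu] := eqVneq (c u) u.
  (* [u] is a centre, whose star can take [d] *)
  pose c' := [ffun i => if i == d then u else c i].
  apply: (more c').
    apply/star_mapP; split => i; rewrite !ffunE.
      case: (eqVneq i d) => [_|id_]; first by rewrite (negbTE ud).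
      by rewrite (negbTE (nd _ id_)).
    by case: (eqVneq i d) => [->|_] // ; exact: cg.
  rewrite [X in (_ < X)%N](cardsD1 d) inE ffunE eqxx ud.
  apply: subset_leq_card; apply/fintype.subsetP => i; rewrite !inE ffunE.
  case: (eqVneq i d) => [->|] //=; by rewrite cd eqxx.
pose v := c u.
have vu : v != u by [].
have cv : c v = v by exact: cc.
have vd : v != d by apply: nd.
have nu i : c i != u by apply: contra_neq cu => <-; rewrite cc.
have du : (d == u) = false by rewrite eq_sym; apply/negbTE.
have [/existsP[w /andP[/andP[wu /eqP cw] wv]]|no] :=
    boolP [exists w, (w != u) && (c w == v) && (w != v)]; last first.
  (* the star of [u] is the edge [uv] alone: taken with centre [u], it can take
     [d] *)
  pose c' := [ffun i => if [|| i == u, i == d | i == v] then u else c i].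
  apply: (more c').
    apply/star_mapP; split => i; rewrite !ffunE.
      have [_|] := boolP [|| i == u, i == d | i == v]; first by rewrite eqxx.
      rewrite !negb_or => /and3P[iu id_ iv].
      rewrite (negbTE (nu i)) (negbTE (nd _ id_)) /=.
      case: (eqVneq (c i) v) => [civ|_]; last by rewrite cc.
      case/negP: no; apply/existsP; exists i.
      by rewrite iu civ eqxx iv.
    have [|_] := boolP [|| i == u, i == d | i == v]; last exact: cg.
    case/or3P => /eqP -> //; first by rewrite eqxx.
    by move=> _; rewrite g_sym; exact: cg.
  have m' : moved c' = v |: (d |: (moved c :\ u)).
    apply/setP => i; rewrite !inE ffunE.
    case: (eqVneq i u) => [->|iu] /=.
      by rewrite eqxx !(eq_sym u) (negbTE vu) du.
    case: (eqVneq i d) => [->|id_] /=; first by rewrite ud orbT.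
    by case: (eqVneq i v) => [->|iv] //=; rewrite eq_sym vu.
  rewrite m' !cardsU1 !inE (negbTE vd) /= cv cd !eqxx !andbF /=.
  by rewrite (cardsD1 u (moved c)) inE cu.
(* the star of [u] has another leaf [w], so that [u] can leave it and form a
   new star with [d] *)
pose c' := [ffun i => if (i == u) || (i == d) then u else c i].
have sc' : star_map c'.
  apply/star_mapP; split => i; rewrite !ffunE.
    have [_|] := boolP ((i == u) || (i == d)); first by rewrite eqxx.
    rewrite negb_or => /andP[iu id_].
    by rewrite (negbTE (nu i)) (negbTE (nd _ id_)) cc.
  have [|_] := boolP ((i == u) || (i == d)); last exact: cg.
  by case/orP => /eqP -> //; rewrite eqxx.
have m' : moved c' = d |: (moved c :\ u).
  apply/setP => i; rewrite !inE ffunE.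
  case: (eqVneq i u) => [->|iu] /=; first by rewrite eqxx eq_sym du.
  by case: (eqVneq i d) => [->|id_] /=; first by rewrite ud.
have cm : #|moved c'| = #|moved c|.
  rewrite m' cardsU1 !inE cd eqxx andbF /=.
  by rewrite (cardsD1 u (moved c)) inE cu.
have : (#|c @: moved c| < #|c' @: moved c'|)%N.
  apply: proper_card; apply/properP; split.
    apply/fintype.subsetP => y /imsetP[i im ->].
    have [iu|iu] := eqVneq i u.
      apply/imsetP; exists w.
        by rewrite m' !inE wu cw (eq_sym v) wv orbT.
      have wd : w != d by apply: contra_neq wv => wd; rewrite -cw wd cd.
      by rewrite iu ffunE (negbTE wu) (negbTE wd) /= cw.
    apply/imsetP; exists i; first by rewrite m' !inE iu; move: im; rewrite inE => ->; rewrite orbT.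
    have id_ : i != d by apply: contraTneq im => ->; rewrite inE cd eqxx.
    by rewrite ffunE (negbTE iu) (negbTE id_).
  exists u.
    apply/imsetP; exists d; first by rewrite m' !inE eqxx.
    by rewrite ffunE eqxx orbT.
  by apply/imsetP => -[i _ /esym/eqP]; apply/negP.
by have := cmax _ sc'; rewrite /= /Phi cm leq_add2l leqNgt => /negP.
Qed.

End star_cover.

Section counting.
Variable I : finType.

(** An idempotent map is given by the set [A] of its fixed points and the
    images in [A] of the other points. *)
Lemma idempotent_count :
  (#|[set c : {ffun I -> I} | idempotent_ffun c]%SET| <=
   \sum_(A : {set I}) #|A| ^ (#|I| - #|A|))%N.
Proof.
rewrite -sum1_card (partition_big (fun c : {ffun I -> I} => [set i | c i == i]%SET) predT) //=.
apply: leq_sum => A _.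
pose F i : {pred I} := fun y => if i \in A then y == i else y \in A.
apply: leq_trans (_ : #|family F| <= _)%N.
  rewrite sum1_card; apply: subset_leq_card; apply/fintype.subsetP => c.
  rewrite unfold_in inE => /andP[/forallP ic /eqP cA].
  apply/familyP => i; rewrite /F unfold_in.
  have [iA|iA] := boolP (i \in A).
    by move: iA; rewrite -cA inE.
  by rewrite -cA inE.
rewrite card_family foldrE big_map big_enum /=.
rewrite (bigID [in A]) /= [X in (X * _)%N]big1 ?mul1n; last first.
  by move=> i iA; apply: (@fintype.eq_card1 _ i) => y; rewrite unfold_in /F iA.
rewrite (eq_bigr (fun=> #|A|)); last first.
  by move=> i /negbTE iA; apply: fintype.eq_card => y; rewrite unfold_in /F iA.
rewrite prod_nat_const; have -> : #|[pred i | i \notin A]| = (#|I| - #|A|)%N.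
  by rewrite -(cardC A) addKn.
by [].
Qed.

End counting.

Section blocked_count.
Context {R : realType} {I : finType} {P : Type}.
Variables (line : I -> R -> P) (lo hi : I -> R).
Hypothesis one_crossing : forall i j s s' t t', i != j ->
  line i s = line j t -> line i s' = line j t' -> s = s'.
Implicit Types (s : {ffun I -> R * R}) (i j k : I) (t u : R).

Lemma below_positive (l : seq R) :
  exists2 e : R, 0 < e & forall x, x \in l -> 0 < x -> e < x.
Proof.
elim: l => [|y l [e e0 el]]; first by exists 1.
have [y0|y0] := ltP 0 y; last first.
  exists e => // x; rewrite inE => /orP[/eqP ->|]; last exact: el.
  by rewrite ltNge y0.
exists (Num.min e (y / 2)); first by rewrite lt_min e0 divr_gt0.
move=> x; rewrite inE => /orP[/eqP -> _|xl x0].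
  by rewrite gt_min; apply/orP; right; lra.
by rewrite gt_min el.
Qed.

(** The centre of the star of [k] or, for a centre, a leaf. *)
Definition neighbour (c : {ffun I -> I}) k : I :=
  if c k != k then c k else odflt k [pick m | (m != k) && (c m == k)].

Definition touching s : rel I := fun i j => (i != j) &&
  `[< exists t u, [/\ (s i).1 <= t <= (s i).2, (s j).1 <= u <= (s j).2 &
                      line i t = line j u] >].

Lemma touching_sym s : symmetric (touching s).
Proof.
suff H i j : touching s i j -> touching s j i by move=> i j; apply/idP/idP; exact: H.
move=> /andP[ij /asboolP[t [u [ti uj l]]]]; rewrite /touching eq_sym ij /=.
by apply/asboolP; exists u, t.
Qed.

(** By [star_cover], a star map names for each segment that touches another one
    such a segment, hence a contact point. A segment that touches none starts
    at the end [lo] of its chord. This point, moved to the side where the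
    segment continues by less than the distance of any two possible ends, is
    inside the segment; the side is the only further information. *)
Lemma code_exists : exists seed : {ffun I -> I} * {ffun I -> bool} -> I -> R,
  forall s, blocked_system line lo hi predT s ->
  exists b, idempotent_ffun b.1 /\ forall k, inside (s k) (seed b k).
Proof.
have /choice[cr crP] : forall ij : I * I, exists t, forall t' u, ij.1 != ij.2 ->
    line ij.1 t' = line ij.2 u -> t' = t.
  move=> [i j]; have [[t [u [ij l]]]|none] :=
      pselect (exists t u, i != j /\ line i t = line j u).
    by exists t => t' u' _ /= l'; exact: (one_crossing ij l' l).
  by exists 0 => t' u' ij l'; exfalso; apply: none; exists t', u'.
pose vals i := lo i :: hi i :: [seq cr (i, j) | j <- enum I].
have [e e0 eP] := below_positive
  [seq `|(vw.1 : R) - vw.2| | i <- enum I, vw <- [seq (v, w) | v <- vals i, w <- vals i]].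
have gap i v w : v \in vals i -> w \in vals i -> v != w -> e < `|v - w|.
  move=> vi wi vw; apply: eP; last by rewrite normr_gt0 subr_eq0.
  apply/allpairsPdep; exists i, (v, w); split => //; first by rewrite mem_enum.
  by apply/allpairsP; exists (v, w).
have loV i : lo i \in vals i by rewrite inE eqxx.
have hiV i : hi i \in vals i by rewrite !inE eqxx orbT.
have crV i j : cr (i, j) \in vals i.
  by rewrite !inE; apply/orP; right; apply/orP; right; apply/map_f; rewrite mem_enum.
pose anchor c k := if neighbour c k == k then lo k else cr (k, neighbour c k).
exists (fun (b : {ffun I -> I} * {ffun I -> bool}) k => anchor b.1 k + (if b.2 k then e else - e)).
move=> s [bd nc b1 b2].
have tipV k f : tip (s k) f \in vals k.
  have st t : stopped line predT s k t -> t \in vals k.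
    move=> [j [u [_ jk _ l]]]; rewrite (crP (k, j) t u) //= eq_sym //.
  case: f => /=.
    by case: (b2 k isT) => [->//|]; exact: st.
  by case: (b1 k isT) => [->//|]; exact: st.
have tirr : irreflexive (touching s) by move=> i; rewrite /touching eqxx.
have [c [sc cover]] := star_cover (touching_sym s) tirr.
have /star_mapP[cc cg] := sc.
have anchorV k : anchor c k \in vals k.
  by rewrite /anchor; case: ifP.
have on k : (s k).1 <= anchor c k <= (s k).2.
  have [lk lt kh] := bd k isT.
  have hit j : touching s k j -> (s k).1 <= cr (k, j) <= (s k).2.
    by move=> /andP[kj /asboolP[t [u [tk uj l]]]]; rewrite -(crP (k, j) t u).
  rewrite /anchor /neighbour; have [ck|ck] := boolP (c k != k).
    by rewrite (negbTE ck); apply: hit; exact: cg.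
  case: pickP => [m /andP[mk /eqP cm]|none] /=.
    rewrite (negbTE mk); apply: hit; rewrite touching_sym -cm; apply: cg.
    by rewrite cm eq_sym.
  rewrite eqxx; have [->|] := b1 k isT; first by rewrite lexx (le_trans lk (ltW lt)).
  move=> [j [u [_ jk uj l]]]; exfalso.
  have ck' : c k = k by apply/eqP; rewrite -[_ == _]negbK.
  have nl m : m != k -> c m != k by move=> mk; have := none m; rewrite mk /= => ->.
  have /negP := cover k ck' nl j; apply.
  rewrite /touching eq_sym jk /=; apply/asboolP; exists (s k).1, u; split => //.
    by rewrite lexx ltW.
  by move: uj; rewrite /inside => /andP[/ltW -> /ltW ->].
pose d := [ffun k => anchor c k < (s k).2].
exists (c, d); split; first by case/andP: sc.
move=> k /=; rewrite /d ffunE /inside; have [_ lt _] := bd k isT.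
have /andP[ o1 o2] := on k.
  have [an|an] := ltP (anchor c k) (s k).2.
    have := gap k _ _ (tipV k true) (anchorV k); rewrite /= gt_eqF // gtr0_norm ?subr_gt0 // => /(_ isT).
    by lra.
  have aE : anchor c k = (s k).2 by apply/eqP; rewrite eq_le o2.
  have := gap k _ _ (tipV k true) (tipV k false); rewrite /= gt_eqF // gtr0_norm ?subr_gt0 // => /(_ isT).
  by rewrite aE; lra.
Qed.

(** Systems with the same code have the same seeds, so that there are at most
    [42 ^ #|I|] of them; a code is an idempotent map and [#|I|] bits. *)
Lemma blocked_count (l : seq {ffun I -> R * R}) : uniq l ->
  (forall s, s \in l -> blocked_system line lo hi predT s) ->
  (size l <= 84 ^ #|I| * \sum_(A : {set I}) #|A| ^ (#|I| - #|A|))%N.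
Proof.
move=> ul lP; have [seed seedP] := code_exists.
have /choice[code codeP] : forall s, exists b,
    blocked_system line lo hi predT s ->
    idempotent_ffun b.1 /\ forall k, inside (s k) (seed b k).
  move=> s; have [/seedP[b bP]|ns] := pselect (blocked_system line lo hi predT s).
    by exists b.
  by exists ([ffun i => i], [ffun=> true]).
rewrite (size_fibers code).
apply: leq_trans (_ : \sum_(b : {ffun I -> I} * {ffun I -> bool} |
    idempotent_ffun b.1 && true) 42 ^ #|I| <= _)%N.
  rewrite [X in (_ <= X)%N]big_mkcond; apply: leq_sum => b _; rewrite andbT.
  set lb := [seq _ <- _ | _].
  have lbP s : s \in lb -> s \in l /\ code s = b.
    by rewrite mem_filter => /andP[/eqP].
  have [->|] := eqVneq lb [::]; first by [].
  rewrite -size_eq0; case E : lb => [//|s0 l0] _.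
  have /lbP[s0l s0b] : s0 \in lb by rewrite E mem_head.
  have [ib _] := codeP s0 (lP _ s0l); rewrite s0b in ib.
  rewrite ib -E -(cardsT I).
  apply: (seeded_count one_crossing (q := seed b)); first by rewrite filter_uniq.
  move=> s /lbP[sl sb]; have [_ ins] := codeP s (lP _ sl); rewrite sb in ins.
  split; [|by move=> i _; exact: ins|by move=> i; rewrite inE].
  have [h1 h2 h3 h4] := lP _ sl.
  have st i t : stopped line predT s i t -> stopped line [in [set: I]%SET] s i t.
    by move=> [j [u [_ ? ? ?]]]; exists j, u; split => //; rewrite inE.
  split.
  - by move=> i _; exact: h1.
  - by move=> i j t u _ _; exact: h2.
  - by move=> i _; case: (h3 i isT); [left|right; exact: st].
  - by move=> i _; case: (h4 i isT); [left|right; exact: st].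
rewrite -(pair_big (fun c : {ffun I -> I} => idempotent_ffun c) (fun=> true)
  (fun _ _ => 42 ^ #|I|)%N) /=.
under eq_bigr do rewrite sum_nat_const card_ffun card_bool -expnMn.
rewrite sum_nat_const mulnC leq_mul2l; apply/orP; right.
by have := @idempotent_count I; rewrite cardsE.
Qed.

End blocked_count.

(** * Cells as sets of signs *)

Section sign_cells.
Context {R : realType} {I : finType}.
Notation plane := (R * R)%type.
Notation code := {ffun I -> option bool}.
Variables (W : convex_domain R) (x : I -> plane).
Implicit Types (s : code) (z y : plane) (i : I).

Definition on_side (o : option bool) (v : R) : Prop :=
  match o with
  | None => True
  | Some b => if b then 0 <= v else v <= 0
  end.

Definition strictly_on_side (o : option bool) (v : R) : Prop :=
  match o with
  | None => True
  | Some b => if b then 0 < v else v < 0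
  end.

Definition sign_cell s : set plane :=
  [set z | (W : set plane) z /\ forall i, on_side (s i) (offset (x i) z)].

Definition open_sign_cell s : set plane :=
  [set z | interior W z /\ forall i, strictly_on_side (s i) (offset (x i) z)].

Lemma on_side_closed o : closed [set v : R | on_side o v].
Proof.
case: o => [[]|] /=; [exact: closed_ge|exact: closed_le|].
exact: closedT.
Qed.

Lemma strictly_on_side_open o : open [set v : R | strictly_on_side o v].
Proof.
case: o => [[]|] /=; [exact: open_gt|exact: open_lt|].
exact: openT.
Qed.

Lemma sign_cell_closed s : closed (sign_cell s).
Proof.
have -> : sign_cell s = W `&`
    \bigcap_(i in setT) (offset (x i) @^-1` [set v | on_side (s i) v]).
  by apply/seteqP; split => z [Wz h]; split => // i; [move=> _|]; exact: h.
apply: closedI.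
  exact: domain_closed.
apply: closed_bigI => i _; apply: preimage_closed; last exact: on_side_closed.
by move=> z _; exact: offset_continuous.
Qed.

Lemma sign_cell_convex s : convex_set (sign_cell s).
Proof.
apply/convex_setP => a b t [Wa ha] [Wb hb] t01.
have /convex_setP cW := @domain_convex _ W.
split; first exact: cW.
move=> i; rewrite offset_lerp; move: (ha i) (hb i); rewrite /on_side.
by case: (s i) => [[]|] // h1 h2; nra.
Qed.

(** An interior point can be moved a little along the normal of each line,
    hence is strictly on the prescribed side. *)
Lemma interior_sign_cell s : interior (sign_cell s) = open_sign_cell s.
Proof.
apply/seteqP; split => z.
  move=> iz; split.
    by apply: (interiorS _ iz) => y [].
  move=> i; have := interior_subset iz => -[_ /(_ i)].
  have shift (d : R) : exists2 h, 0 < h &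
      sign_cell s (z.1 + d * h * cos (x i).2, z.2 + d * h * sin (x i).2).
    have /interiorP[e e0 eB] := iz.
    pose h := e / (`|d| + 1).
    have d1 : 0 < `|d| + 1 by have := normr_ge0 d; lra.
    have h0 : 0 < h by rewrite divr_gt0.
    have dh : `|d * h| < e.
      rewrite normrM (gtr0_norm h0) /h mulrCA -[ltRHS]mulr1 ltr_pM2l //.
      by rewrite ltr_pdivrMr //; lra.
    exists h => //; apply: eB; rewrite addrAC subrr add0r normrM.
      apply: le_lt_trans dh; rewrite ler_piMr ?normr_ge0 //.
      by rewrite ler_norml cos_geN1 cos_le1.
    apply: le_lt_trans dh; rewrite ler_piMr ?normr_ge0 //.
    by rewrite ler_norml sin_geN1 sin_le1.
  have sE (d : R) : offset (x i) (z.1 + d * cos (x i).2, z.2 + d * sin (x i).2) =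
      offset (x i) z + d.
    rewrite /offset /= -[in RHS](mulr1 d) -(cos2Dsin2 (x i).2); ring.
  rewrite /on_side /strictly_on_side; case E : (s i) => [[]|] // le.
    have [h h0 [_ /(_ i)]] := shift (- 1); rewrite E sE /=; lra.
  have [h h0 [_ /(_ i)]] := shift 1; rewrite E sE /=; lra.
move=> [Wz hz].
have : nbhs z (interior W `&`
    \bigcap_(i in setT) (offset (x i) @^-1` [set v | strictly_on_side (s i) v])).
  apply: filterI; first exact: nbhs_interior.
  have h : nbhs z [set y | forall i, strictly_on_side (s i) (offset (x i) y)].
    have hi i : nbhs z (offset (x i) @^-1` [set v | strictly_on_side (s i) v]).
      apply: offset_continuous; apply: open_nbhs_nbhs; split.
        exact: strictly_on_side_open.
      exact: hz.
    exact: (filter_forall (nbhs_filter z) hi).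
  by apply: filterS h => y hy i _; exact: hy.
apply: filterS => y [/interior_subset Wy hy]; split => // i.
by have := hy i Logic.I; rewrite /= /on_side /strictly_on_side; case: (s i) => [[]|] // /ltW.
Qed.

Lemma open_sign_cell_nbhs s z : open_sign_cell s z -> nbhs z (open_sign_cell s).
Proof.
rewrite -interior_sign_cell => iz; have : interior (sign_cell s) z by [].
exact: nbhs_interior.
Qed.

(** The code is [None] precisely at the lines that cut the interior of the
    cell, which makes it unique. *)
Definition full_code s : Prop := [/\ open_sign_cell s !=set0 &
  forall i, s i = None -> (exists2 z, open_sign_cell s z & 0 < offset (x i) z) /\
                          (exists2 z, open_sign_cell s z & offset (x i) z < 0)].

Lemma full_code_inj s s' : full_code s -> full_code s' ->
  sign_cell s = sign_cell s' -> s = s'.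
Proof.
move=> [[z sz] f] [_ f'] E.
have O : open_sign_cell s = open_sign_cell s' by rewrite -!interior_sign_cell E.
have sz' := sz; rewrite O in sz'.
apply/ffunP => i; have [_ /(_ i)] := sz; have [_ /(_ i)] := sz'.
move: (f i) (f' i); rewrite /strictly_on_side.
case E1 : (s i) => [b1|]; case E2 : (s' i) => [b2|] // g1 g2.
- by case: b1 E1 {g1}; case: b2 E2 {g2} => // _ _ h1 h2; exfalso; clear E O; lra.
- have [[y1 + p1] [y2 + p2]] := g2 erefl.
  rewrite -O => -[_ /(_ i)] + [_ /(_ i)]; rewrite E1 /=.
  by case: b1 {E1 g1} => h1 h2; exfalso; clear E O E2 g2; lra.
- have [[y1 + p1] [y2 + p2]] := g1 erefl.
  rewrite O => -[_ /(_ i)] + [_ /(_ i)]; rewrite E2 /=.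
  by case: b2 {E2 g2} => h1 h2; exfalso; clear E O E1 g1; lra.
Qed.

Definition sign_tessellation (C : {set code}) : set (set plane) :=
  [set sign_cell s | s in [set s | s \in C]].

Lemma sign_tessellation_inj (C C' : {set code}) : (forall s, s \in C -> full_code s) ->
  (forall s, s \in C' -> full_code s) ->
  sign_tessellation C = sign_tessellation C' -> C = C'.
Proof.
suff H (C1 C2 : {set code}) : (forall s, s \in C1 -> full_code s) ->
    (forall s, s \in C2 -> full_code s) ->
    sign_tessellation C1 = sign_tessellation C2 -> C1 \subset C2.
  by move=> f f' E; apply/eqP; rewrite finset.eqEsubset !H.
move=> f1 f2 E; apply/fintype.subsetP => s sC.
have : sign_tessellation C1 (sign_cell s) by exists s.
rewrite E => -[s' s'C E'].
by rewrite (full_code_inj (f1 _ sC) (f2 _ s'C) (esym E')).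
Qed.

Section from_partition.
Variable T : set (set plane).
Hypothesis TW : cell_partition W T.
Hypothesis on_lines : forall e, inner_edge T e -> exists i, e `<=` line_at (x i).

(** Otherwise a point of [e] would be strictly between [z] and a point of the
    cell, hence in its interior, or [z] would be in [e]. *)
Lemma edge_line_not_interior c e i z : T c -> inner_edge T e -> e `<=` c ->
  e `<=` line_at (x i) -> interior c z -> offset (x i) z <> 0.
Proof.
move=> Tc ie ec ei cz; have [_ TC _ _] := TW; have [_ coc _] := TC _ Tc.
have [u [v [uv eE]]] := edge_segment ie.
move=> /line_atP zi.
wlog lt : u v uv eE / abscissa (x i) u < abscissa (x i) v.
  move=> H; have eu : e u by rewrite eE; exact: segment_l.
  have ev : e v by rewrite eE; exact: segment_r.
  case: (ltgtP (abscissa (x i) u) (abscissa (x i) v)) => [|lt|].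
  - exact: H.
  - by apply: (H v u) => //; [rewrite eq_sym|rewrite eE segment_sym].
  - by move=> /(abscissa_inj (ei _ eu) (ei _ ev)) uvE; rewrite uvE eqxx in uv.
have eu : e u by rewrite eE; exact: segment_l.
have ev : e v by rewrite eE; exact: segment_r.
have eS y : segment u v y -> e y by rewrite eE.
have uE := line_at_abscissa (ei _ eu); have vE := line_at_abscissa (ei _ ev).
have zE := line_at_abscissa zi.
move: lt uE vE zE {eE}; set a := abscissa _ u; set b := abscissa _ v.
set k := abscissa _ z => lt uE vE zE.
have [ka|ak] := ltP k a.
  apply: (edge_not_interior TW ie eu Tc).
  have -> : u = lerp z v ((a - k) / (b - k)).
    by rewrite uE zE vE line_point_lerp; congr line_point; field; lra.
  apply: interior_lerp coc cz (ec _ ev) _.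
  by apply/andP; split; [apply: divr_ge0; lra|rewrite ltr_pdivrMr; lra].
have [kb|bk] := leP k b.
  apply: (edge_not_interior TW ie _ Tc cz); apply/eS/segmentP.
  exists ((k - a) / (b - a)).
    by apply/andP; split; [apply: divr_ge0; lra|rewrite ler_pdivrMr; lra].
  by rewrite [LHS]zE uE vE line_point_lerp; congr line_point; field; lra.
apply: (edge_not_interior TW ie ev Tc).
have -> : v = lerp z u ((k - b) / (k - a)).
  by rewrite vE zE uE line_point_lerp; congr line_point; field; lra.
apply: interior_lerp coc cz (ec _ eu) _.
by apply/andP; split; [apply: divr_ge0; lra|rewrite ltr_pdivrMr; lra].
Qed.

(** The signs are those that the lines have on the interior of [c]. If the sign
    cell were larger, a path out of [c] inside it would cross an edge of [c]
    and get to the wrong side of the line of that edge. *)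
Lemma cell_code c : T c -> exists2 s, c = sign_cell s & full_code s.
Proof.
move=> Tc; have [_ TC _ _] := TW; have [clc coc ic] := TC _ Tc.
pose pos i := exists2 z, interior c z & 0 < offset (x i) z.
pose neg i := exists2 z, interior c z & offset (x i) z < 0.
pose s : code := [ffun i => if `[< pos i >] then
  (if `[< neg i >] then None else Some true) else Some false].
have sint i z : interior c z -> on_side (s i) (offset (x i) z).
  move=> cz; rewrite /s ffunE; case: asboolP => [p|np].
    case: asboolP => [n|nn] //=.
    by rewrite leNgt; apply/negP => h; apply: nn; exists z.
  by rewrite /= leNgt; apply/negP => h; apply: np; exists z.
have sub : c `<=` sign_cell s.
  move=> z cz; split; first exact: cell_sub TW _ Tc z cz.
  move=> i; apply: contrapT => nz.
  have nz' : nbhs z (offset (x i) @^-1` (~` [set v | on_side (s i) v])).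
    apply: offset_continuous; apply: open_nbhs_nbhs; split => //.
    by apply: closed_openC; exact: on_side_closed.
  have [y cy] := convex_interior_dense coc ic cz nz'.
  by apply; exact: sint.
have cE : c = sign_cell s.
  apply/seteqP; split => // z sz; apply: contrapT => nz.
  have is0 : interior (sign_cell s) !=set0.
    by have [y cy] := ic; exists y; exact: interiorS cy.
  have nz' : nbhs z (~` c).
    by apply: open_nbhs_nbhs; split => //; exact: closed_openC.
  have [z' sz' cz'] := convex_interior_dense (@sign_cell_convex s) is0 sz nz'.
  have [y cy] := ic.
  have [t [t01 ct nct]] := exit_point clc (interior_subset cy) cz'.
  have Wy : interior W y by apply: interiorS cy; exact: cell_sub Tc.
  have Wz' : (W : set plane) z' by have [] := interior_subset sz'.
  have Wt : interior W (lerp y z' t).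
    by apply: interior_lerp => //; exact: domain_convex.
  have [e [ie et ec]] := frontier_edge TW Tc ct nct Wt.
  have [i ei] := on_lines ie.
  have noff := edge_line_not_interior Tc ie ec ei.
  have /line_atP := ei _ et; rewrite offset_lerp.
  have [_ /(_ i)] := interior_subset sz'.
  have := noff _ cy; have := sint i y cy.
  have nn : s i <> None.
    rewrite /s ffunE; case: asboolP => // -[z1 c1 p1].
    case: asboolP => // -[z2 c2 p2] _.
    have := noff (lerp z1 z2 (offset (x i) z1 / (offset (x i) z1 - offset (x i) z2))).
    rewrite offset_lerp; apply.
      apply: interior_lerp => //; first exact: interior_subset.
      by apply/andP; split; [apply: divr_ge0; lra|rewrite ltr_pdivrMr; lra].
    by field; lra.
  rewrite /on_side; case E : (s i) nn => [b|] // _.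
  move: (offset (x i) y) (offset (x i) z') => u v.
  by case: b {E} => h1 /eqP h2 h3; move: h2; rewrite neq_lt => /orP[] h2; nra.
exists s => //; have oE : open_sign_cell s = interior c.
  by rewrite -interior_sign_cell -cE.
rewrite /full_code oE; split => // i.
rewrite /s ffunE; case: asboolP => // -[z1 c1 p1].
case: asboolP => // -[z2 c2 p2] _.
by split; [exists z1|exists z2].
Qed.

Lemma partition_code : exists2 C, T = sign_tessellation C &
  forall s, s \in C -> full_code s.
Proof.
pose C : {set code} := [set s | `[< T (sign_cell s) /\ full_code s >]]%SET.
exists C; last by move=> s; rewrite inE => /asboolP[].
apply/seteqP; split => [c Tc|c [s + <-]].
  have [s cE fs] := cell_code Tc; exists s => //.
  by rewrite /= inE; apply/asboolP; rewrite -cE.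
by rewrite /= inE => /asboolP[].
Qed.

End from_partition.

Definition rational_point (q : rat * rat) : plane := (ratr q.1, ratr q.2).

Lemma rational_point_dense z (U : set plane) : nbhs z U ->
  exists q, U (rational_point q).
Proof.
move=> zU; have : interior U z by [].
move=> /interiorP[e e0 eU].
have [q1 h1] := rational_near z.1 e0; have [q2 h2] := rational_near z.2 e0.
by exists (q1, q2); apply: eU; rewrite distrC.
Qed.

(** Cells are closed with open interiors, so that rational points can tell
    whether they form a partition. *)
Definition partition_test (C : {set code}) : Prop :=
  [/\ (forall s, s \in C -> exists q, open_sign_cell s (rational_point q)),
      (forall q, interior W (rational_point q) ->
         exists2 s, s \in C & sign_cell s (rational_point q)),
      (forall s s', s \in C -> s' \in C -> s != s' -> forall q,
         ~ (open_sign_cell s (rational_point q) /\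
            open_sign_cell s' (rational_point q))) &
      (forall s i, s \in C -> s i = None ->
         (exists2 q, open_sign_cell s (rational_point q) &
                     0 < offset (x i) (rational_point q)) /\
         (exists2 q, open_sign_cell s (rational_point q) &
                     offset (x i) (rational_point q) < 0))].

Lemma open_cell_rational s (f : plane -> R) z : continuous f ->
  open_sign_cell s z -> 0 < f z ->
  exists2 q, open_sign_cell s (rational_point q) & 0 < f (rational_point q).
Proof.
move=> cf sz fz.
have : nbhs z (open_sign_cell s `&` (f @^-1` [set v | 0 < v])).
  apply: filterI; first exact: open_sign_cell_nbhs.
  by apply: cf; apply: open_nbhs_nbhs; split => //; exact: open_gt.
by move=> /rational_point_dense[q [h1 h2]]; exists q.
Qed.

Lemma partition_testP C : partition_test C <->
  cell_partition W (sign_tessellation C) /\ forall s, s \in C -> full_code s.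
Proof.
split.
- move=> [t1 t2 t3 t4].
  have fc s : s \in C -> full_code s.
    move=> sC; split; first by have [q sq] := t1 _ sC; exists (rational_point q).
    move=> i si; have [[q1 ? ?] [q2 ? ?]] := t4 s i sC si.
    by split; [exists (rational_point q1)|exists (rational_point q2)].
  split => //; split.
  + by apply: finite_image; exact: finite_finset.
  + move=> c [s /= sC <-]; split; first exact: sign_cell_closed.
      exact: sign_cell_convex.
    by rewrite interior_sign_cell; have [] := fc _ sC.
  + apply/seteqP; split => [z [c [s _ <-] []] //|z Wz].
    have cU : closed (\bigcup_(c in sign_tessellation C) c).
      apply: closed_bigcup; first by apply: finite_image; exact: finite_finset.
      by move=> c [s _ <-]; exact: sign_cell_closed.
    apply: contrapT => nz.
    have nz' : nbhs z (~` \bigcup_(c in sign_tessellation C) c).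
      by apply: open_nbhs_nbhs; split => //; exact: closed_openC.
    have [y Wy ny] := convex_interior_dense (@domain_convex _ W)
      (@domain_interior _ W) Wz nz'.
    have : nbhs y (interior W `&` ~` \bigcup_(c in sign_tessellation C) c).
      apply: filterI; first exact: nbhs_interior.
      by apply: open_nbhs_nbhs; split => //; exact: closed_openC.
    move=> /rational_point_dense[q [Wq nq]]; apply: nq.
    have [s sC sq] := t2 _ Wq; exists (sign_cell s) => //.
    by exists s.
  + move=> c c' [s /= sC <-] [s' /= s'C <-] n.
    apply/seteqP; split => // z; rewrite !interior_sign_cell => zz.
    have : nbhs z (open_sign_cell s `&` open_sign_cell s').
      by case: zz => z1 z2; apply: filterI; exact: open_sign_cell_nbhs.
    move=> /rational_point_dense[q qq].
    apply: (t3 s s' sC s'C _ q qq).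
    by apply/eqP => ss'; apply: n; rewrite ss'.
- move=> [cp fc]; have [_ TC UT dT] := cp; split.
  + move=> s /fc[[z sz] _]; apply: (@rational_point_dense z).
    exact: open_sign_cell_nbhs.
  + move=> q /interior_subset; rewrite -UT => -[c [s sC <-] sq].
    by exists s.
  + move=> s s' sC s'C n q [sq sq'].
    have : (interior (sign_cell s) `&` interior (sign_cell s')) (rational_point q).
      by rewrite !interior_sign_cell.
    rewrite dT //; [by exists s|by exists s'|].
    by move=> /(full_code_inj (fc _ sC) (fc _ s'C)); apply/eqP.
  + move=> s i sC si; have [_ /(_ i si) [[z1 s1 p1] [z2 s2 p2]]] := fc _ sC.
    split; first exact: open_cell_rational (@offset_continuous _ (x i)) s1 p1.
    have cN : continuous (fun z => - offset (x i) z).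
      by move=> z; apply: cvgN; exact: offset_continuous.
    have [|q sq] := open_cell_rational cN s2; first by rewrite oppr_gt0.
    by rewrite oppr_gt0; exists q.
Qed.

End sign_cells.

(** * T-tessellations in terms of codes *)

(** [C] codes a T-tessellation with one segment on each of the lines. The codes
    have to be full in order that each tessellation have one code only. *)
Definition tessellation_code {R : realType} {I : finType} (W : convex_domain R)
    (x : I -> R * R) (C : {set {ffun I -> option bool}}) : Prop :=
  [/\ T_tessellation W (sign_tessellation W x C),
      supporting_lines (sign_tessellation W x C) =
        [set line_at (x i) | i in setT] &
      forall s, s \in C -> full_code W x s].

Section edge_tests.
Context {R : realType} {I : finType}.
Notation plane := (R * R)%type.
Notation code := {ffun I -> option bool}.
Variables (W : convex_domain R) (x : I -> plane) (C : {set code}).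
Implicit Types (s : code) (v z y : plane) (i : I) (p q : code * code).

Definition common_part p : set plane :=
  sign_cell W x p.1 `&` sign_cell W x p.2.

(** Indices of the edges: [enum_rank] selects one of the two orders of the
    cells that share an edge. *)
Definition edge_index : {set code * code} :=
  [set p | [&& p.1 \in C, p.2 \in C, (enum_rank p.1 < enum_rank p.2)%N &
     `[< exists y z, [/\ y != z, common_part p y & common_part p z] >]]]%SET.

Definition index_at v : {set code * code} :=
  [set p in edge_index | `[< endpoint v (common_part p) >]]%SET.

Definition index_on p i : Prop := common_part p `<=` line_at (x i).

Definition shape_test : Prop :=
  forall p v, p \in edge_index -> endpoint v (common_part p) ->
  (#|index_at v| = 3 /\ exists q q', [/\ q \in index_at v, q' \in index_at v,
     q != q' & exists i, index_on q i /\ index_on q' i]) \/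
  (#|index_at v| = 1 /\ frontier W v).

(** Connectedness of a trace is tested on the ends of the edges, since these
    depend measurably on the lines. *)
Definition gap_at i (r : R) : Prop :=
  [/\ (exists p v, [/\ p \in edge_index, index_on p i,
         endpoint v (common_part p) & abscissa (x i) v < r]),
      (exists p v, [/\ p \in edge_index, index_on p i,
         endpoint v (common_part p) & r < abscissa (x i) v]) &
      (forall p, p \in edge_index -> index_on p i ->
         (forall v, endpoint v (common_part p) -> abscissa (x i) v < r) \/
         (forall v, endpoint v (common_part p) -> r < abscissa (x i) v))].

Definition lines_test : Prop :=
  (forall p, p \in edge_index -> exists i, index_on p i) /\
  (forall i, (exists p, p \in edge_index /\ index_on p i) /\
             forall r : rat, ~ gap_at i (ratr r)).

Hypothesis px : forall i, polar_strip (x i).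
Let T := sign_tessellation W x C.
Hypothesis TW : cell_partition W T.
Hypothesis fullC : forall s, s \in C -> full_code W x s.

Lemma sign_cell_mem s : s \in C -> T (sign_cell W x s).
Proof. by exists s. Qed.

Lemma edge_index_edge p : p \in edge_index -> inner_edge T (common_part p).
Proof.
rewrite inE => /and4P[p1 p2 lt /asboolP[y [z [yz [y1 y2] [z1 z2]]]]].
apply: (shared_edge TW (sign_cell_mem p1) (sign_cell_mem p2) _ yz) => //.
move=> /(full_code_inj (fullC p1) (fullC p2)) pp.
by move: lt; rewrite pp ltnn.
Qed.

Lemma inner_edgeP e : inner_edge T e <->
  exists2 p, p \in edge_index & e = common_part p.
Proof.
split; last by move=> [p pE ->]; exact: edge_index_edge.
move=> ie; have [y [z [yz eE]]] := edge_segment ie.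
have ey : e y by rewrite eE; exact: segment_l.
have ez : e z by rewrite eE; exact: segment_r.
have [[c [c' [[s sC cE] [s' s'C cE'] n eE']]] _] := ie.
have ss : s != s' by apply/eqP => ss'; apply: n; rewrite -cE -cE' ss'.
have [lt|lt|/ord_inj/enum_rank_inj/eqP] := ltngtP (enum_rank s) (enum_rank s').
- have cp : common_part (s, s') = e by rewrite eE' -cE -cE'.
  exists (s, s') => //; rewrite inE /= sC s'C lt /=.
  by apply/asboolP; exists y, z; rewrite cp.
- have cp : common_part (s', s) = e by rewrite eE' -cE -cE' setIC.
  exists (s', s) => //; rewrite inE /= sC s'C lt /=.
  by apply/asboolP; exists y, z; rewrite cp.
- by rewrite (negbTE ss).
Qed.

Lemma common_part_inj p q : p \in edge_index -> q \in edge_index ->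
  common_part p = common_part q -> p = q.
Proof.
rewrite !inE => /and4P[p1 p2 ltp /asboolP[y [z [yz py pz]]]].
move=> /and4P[q1 q2 ltq _] E.
have := py; have := pz; rewrite E => -[z3 z4] [y3 y4].
case: py pz => y1 y2 [z1 z2].
have n12 : sign_cell W x p.1 <> sign_cell W x p.2.
  move=> /(full_code_inj (fullC p1) (fullC p2)) pp.
  by move: ltp; rewrite pp ltnn.
have m := sign_cell_mem.
have inj s s' : s \in C -> s' \in C -> sign_cell W x s = sign_cell W x s' -> s = s'.
  by move=> sC s'C; apply: full_code_inj; exact: fullC.
have [/(inj _ _ q1) e1|/(inj _ _ q1) e1] := common_segment_cells TW (m _ p1) (m _ p2)
  (m _ q1) n12 yz y1 z1 y2 z2 y3 z3;
have [/(inj _ _ q2) e2|/(inj _ _ q2) e2] := common_segment_cells TW (m _ p1) (m _ p2)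
  (m _ q2) n12 yz y1 z1 y2 z2 y4 z4.
- by move: ltq; rewrite e1 // e2 // ltnn.
- by rewrite [p]surjective_pairing [q]surjective_pairing e1 // e2.
- by move: ltq; rewrite e1 // e2 // => /(ltn_trans ltp); rewrite ltnn.
- by move: ltq; rewrite e1 // e2 // ltnn.
Qed.

Lemma index_atP v p : p \in index_at v ->
  p \in edge_index /\ endpoint v (common_part p).
Proof. by rewrite inE => /andP[pE /asboolP ve]. Qed.

Lemma incident_index v :
  incident T v = [set common_part p | p in [set p | p \in index_at v]].
Proof.
apply/seteqP; split => e.
  move=> [/inner_edgeP[p pE ->] ve]; exists p => //=.
  by rewrite inE pE; apply/asboolP.
move=> [p /=]; rewrite inE => /andP[pE /asboolP ve] <-.
by split => //; exact: edge_index_edge.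
Qed.

Lemma incident_card_index v k : incident T v #= `I_k <-> #|index_at v| = k.
Proof.
have E : incident T v #= `I_#|index_at v|.
  rewrite incident_index.
  have h : [set common_part p | p in [set p | p \in index_at v]] #=
      [set p | p \in index_at v].
    apply: inj_card_eq => p q; rewrite !in_setE /=.
    by move=> /index_atP[pE _] /index_atP[qE _]; exact: common_part_inj.
  apply: (card_eq_trans h).
  have -> : [set p | p \in index_at v] = [set` [fset p in index_at v]%fset].
    by apply/seteqP; split => p /=; rewrite !inE.
  apply/card_eq_fsetP; rewrite card_imfset //= -cardE.
  by apply: fintype.eq_card => p; rewrite inE.
split => [h|<-] //.
have : `I_k #= `I_#|index_at v| by apply: card_eq_trans E; rewrite card_eq_sym.
by move/card_eq_II.
Qed.

Lemma shape_testP : (forall p, p \in edge_index -> exists i, index_on p i) ->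
  (forall v, vertex T v -> T_shaped W T v) <-> shape_test.
Proof.
move=> on; split.
- move=> H p v pE ve; have vv : vertex T v.
    by exists (common_part p); split => //; exact: edge_index_edge.
  have [[/incident_card_index c3 [e [e' [ive ive' ee' [l [[y py ->] ey e'y]]]]]]|
        [/incident_card_index c1 fv]] := H v vv; last by right.
  left; split => //.
  move: ive ive'; rewrite incident_index => -[q /= qv qE] [q' /= q'v q'E].
  exists q, q'; split => //; first by apply/eqP => qq; apply: ee'; rewrite -qE -q'E qq.
  have qi : q \in edge_index by move: qv; rewrite inE => /andP[].
  have [i qon] := on _ qi; exists i; split => //.
  have xy : x i = y.
    by apply: (edge_line_unique (edge_index_edge qi)) => //; rewrite qE.
  by rewrite /index_on q'E xy.
- move=> H v [e]; rewrite incident_index => -[p /= + _].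
  rewrite inE => /andP[pE /asboolP ve].
  have [[c3 [q [q' [qv q'v qq' [i [qi q'i]]]]]]|[c1 fv]] := H p v pE ve;
    last by right; split => //; apply/incident_card_index.
  left; split; first exact/incident_card_index.
  exists (common_part q), (common_part q'); split.
  + by rewrite incident_index; exists q.
  + by rewrite incident_index; exists q'.
  + move=> E; move/eqP: qq'; apply; apply: common_part_inj => //.
      by move: qv; rewrite inE => /andP[].
    by move: q'v; rewrite inE => /andP[].
  + by exists (line_at (x i)); split => //; exists (x i).
Qed.

Lemma endpoints_edge p : p \in edge_index ->
  exists v w, [/\ v != w, common_part p = segment v w,
    endpoint v (common_part p) & endpoint w (common_part p)].
Proof.
move=> /edge_index_edge/edge_segment[v [w [vw E]]]; exists v, w; split => //.
  by exists w.
by exists v; [rewrite eq_sym|rewrite E segment_sym].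
Qed.

Lemma endpoint_mem v (e : set plane) : endpoint v e -> e v.
Proof. by move=> [w _ ->]; exact: segment_l. Qed.

Lemma trace_index i z : trace T (x i) z <->
  exists p, [/\ p \in edge_index, index_on p i & common_part p z].
Proof.
split; first by move=> [e [/inner_edgeP[p pE ->] ei] ez]; exists p.
move=> [p [pE pi pz]]; exists (common_part p) => //.
by split => //; exact: edge_index_edge.
Qed.

(** The abscissas of the trace form a closed set, so that an interval that it
    misses contains a rational number. *)
Lemma connected_trace_test i :
  connected (trace T (x i)) <-> forall r : rat, ~ gap_at i (ratr r).
Proof.
pose S := abscissa (x i) @` trace T (x i).
have ca : {within trace T (x i), continuous (abscissa (x i))}.
  by apply: continuous_subspaceT => z; exact: abscissa_continuous.
have cS : closed S.
  apply: compact_closed; first exact: norm_hausdorff.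
  by apply: continuous_compact => //; exact: (trace_compact TW).
(* the abscissas of the points of an edge lie between those of its ends *)
have btw p z (r : R) : p \in edge_index -> common_part p z ->
    ((forall v, endpoint v (common_part p) -> abscissa (x i) v < r) ->
      abscissa (x i) z < r) /\
    ((forall v, endpoint v (common_part p) -> r < abscissa (x i) v) ->
      r < abscissa (x i) z).
  move=> pE; have [v [w [_ -> ve we]]] := endpoints_edge pE.
  move=> /segmentP[t t01 ->]; rewrite abscissa_lerp.
  split => H; have := H _ ve; have := H _ we;
    move: (abscissa (x i) v) (abscissa (x i) w) => A B hB hA;
    by case: (leP t (1 / 2)) => t2; nra.

split.
- move=> ct r [[p [v [pE pi ve lt]]] [q [w [qE qi we gt]]] H].
  have iS : is_interval S.
    by apply/connected_intervalP; exact: connected_continuous_connected.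
  have Sv : S (abscissa (x i) v).
    by exists v => //; apply/trace_index; exists p; split => //; exact: endpoint_mem.
  have Sw : S (abscissa (x i) w).
    by exists w => //; apply/trace_index; exists q; split => //; exact: endpoint_mem.
  have [z /trace_index[p' [p'E p'i p'z]] zr] : S (ratr r).
    by apply: (iS _ _ Sv Sw); rewrite !ltW.
  have [b1 b2] := btw p' z (ratr r) p'E p'z.
  by have [/b1|/b2] := H p' p'E p'i; rewrite zr ltxx.
- move=> H.
  have iS : is_interval S.
    move=> a b Sa Sb t /andP[at_ tb]; apply: contrapT => nS.
    have nt : nbhs t (~` S).
      by apply: open_nbhs_nbhs; split => //; exact: closed_openC.
    have [d /= d0 dB] := (nbhs_ballP _ _).1 nt.
    have out u : S u -> t + d <= u \/ u <= t - d.
      move=> Su; have [tu|ut] := leP (t + d) u; [by left|right].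
      rewrite leNgt; apply/negP => tu'; apply: (dB u _ Su).
      by rewrite /ball /= ltr_norml; lra.
    have lt : t - d < t + d by lra.
    have [r] := rat_in_itvoo lt; rewrite in_itv /= => /andP[r1 r2].
    (* no edge crosses the abscissa [r] of the gap *)
    have side p : p \in edge_index -> index_on p i ->
        (forall v, endpoint v (common_part p) -> abscissa (x i) v < ratr r) \/
        (forall v, endpoint v (common_part p) -> ratr r < abscissa (x i) v).
      move=> pE pi; have SE y : common_part p y -> S (abscissa (x i) y).
        by move=> py; exists y => //; apply/trace_index; exists p.
      have ct : forall a b t, common_part p a -> common_part p b -> 0 <= t <= 1 ->
          common_part p (lerp a b t).
        by apply/convex_setP; exact: edge_convex (edge_index_edge pE).
      apply: contrapT => /not_orP[/existsNP[v /not_implyP[ve nv]]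
                                  /existsNP[w /not_implyP[we nw]]].
      have Sv := SE _ (endpoint_mem ve); have Sw := SE _ (endpoint_mem we).
      have {nv} rv : t + d <= abscissa (x i) v.
        case: (out _ Sv) => // h; exfalso; apply: nv; lra.
      have {nw} rw : abscissa (x i) w <= t - d.
        case: (out _ Sw) => // h; exfalso; apply: nw; lra.
      pose u := (t - abscissa (x i) w) / (abscissa (x i) v - abscissa (x i) w).
      have u01 : 0 <= u <= 1.
        by apply/andP; split; [apply: divr_ge0; lra|rewrite ler_pdivrMr; lra].
      apply: nS; have := SE _ (ct _ _ _ (endpoint_mem we) (endpoint_mem ve) u01).
      rewrite abscissa_lerp; congr S; rewrite /u; field; lra.
    have aS : a < ratr r.
      by case: (out _ Sa) => h; lra.
    have Sb' : ratr r < b.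
      by case: (out _ Sb) => h; lra.
    apply: (H r); split => //.
    - have [z /trace_index[p [pE pi pz]] za] := Sa.
      have [v [w [_ _ ve _]]] := endpoints_edge pE; exists p, v; split => //.
      have [h|h] := side p pE pi; first exact: h.
      by have [_ /(_ h)] := btw p z (ratr r) pE pz; rewrite za; lra.
    - have [z /trace_index[p [pE pi pz]] zb] := Sb.
      have [v [w [_ _ ve _]]] := endpoints_edge pE; exists p, v; split => //.
      have [h|h] := side p pE pi; last exact: h.
      by have [/(_ h) + _] := btw p z (ratr r) pE pz; rewrite zb; lra.
  have -> : trace T (x i) = line_point (x i) @` S.
    apply/seteqP; split => z.
      move=> tz; exists (abscissa (x i) z); first by exists z.
      by rewrite -line_at_abscissa //; exact: trace_line tz.
    move=> [_ [y ty <-] <-].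
    by rewrite -line_at_abscissa //; exact: trace_line ty.
  apply: connected_continuous_connected; first exact/connected_intervalP.
  by apply: continuous_subspaceT => t; exact: line_point_continuous.
Qed.

Lemma lines_testP : lines_test <->
  ((forall e, inner_edge T e -> exists i, e `<=` line_at (x i)) /\
   (forall i, edges_on T (x i) !=set0 /\ connected (trace T (x i)))).
Proof.
split => -[on tr]; split.
- by move=> e /inner_edgeP[p pE ->]; exact: on.
- move=> i; have [[p [pE pi]] ng] := tr i; split; last exact/connected_trace_test.
  by exists (common_part p); split => //; exact: edge_index_edge.
- by move=> p pE; apply: on; exact: edge_index_edge.
- move=> i; have [[e [/inner_edgeP[p pE eE] ei]] ct] := tr i.
  split; last exact/connected_trace_test.
  by exists p; split => //; rewrite /index_on -eE.
Qed.

Lemma tessellation_testP :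
  (T_tessellation W T /\ supporting_lines T = [set line_at (x i) | i in setT]) <->
  (shape_test /\ lines_test).
Proof.
split.
- move=> [[_ sh na] sl].
  have lt : lines_test.
    by apply/lines_testP; apply/(segments_by_lines T px).
  by split => //; apply/shape_testP => //; case: lt.
- move=> [sh lt]; have /lines_testP/(segments_by_lines T px)[na sl] := lt.
  split => //; split => //; first exact: cell_partition_polygonal.
  by apply/shape_testP => //; case: lt.
Qed.

End edge_tests.

(** * Events and measurable points *)

Section events.
Context {R : realType} {d} {Omega : measurableType d}.
Implicit Types (Q : Omega -> Prop).

(** Measurability of a property of [w], so that proofs of it follow the shape
    of the formula. *)
Definition event Q : Prop := measurable [set w | Q w].

Lemma event_ext Q Q' : (forall w, Q w <-> Q' w) -> event Q -> event Q'.
Proof.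
by move=> QQ; congr measurable; apply/seteqP; split => w /QQ.
Qed.

Lemma event_const (A : Prop) : event (fun _ => A).
Proof.
have [a|na] := pselect A.
  by apply: (@event_ext (fun _ => True)) => //; exact: measurableT.
by apply: (@event_ext (fun _ => False)) => //; exact: measurable0.
Qed.

Lemma event_not Q : event Q -> event (fun w => ~ Q w).
Proof. exact: measurableC. Qed.

Lemma event_and Q Q' : event Q -> event Q' -> event (fun w => Q w /\ Q' w).
Proof. exact: measurableI. Qed.

Lemma event_or Q Q' : event Q -> event Q' -> event (fun w => Q w \/ Q' w).
Proof. exact: measurableU. Qed.

Lemma event_imp Q Q' : event Q -> event Q' -> event (fun w => Q w -> Q' w).
Proof.
move=> eQ eQ'; apply: (@event_ext (fun w => ~ Q w \/ Q' w)).
  by move=> w; rewrite [X in _ <-> X]implyE.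
by apply: event_or => //; exact: event_not.
Qed.

Lemma event_ex (J : countType) (Q : J -> Omega -> Prop) :
  (forall j, event (Q j)) -> event (fun w => exists j, Q j w).
Proof.
move=> eQ; rewrite /event.
have -> : [set w | exists j, Q j w] = \bigcup_j [set w | Q j w].
  by apply/seteqP; split => w [j]; [exists j|move=> _; exists j].
exact: countable_bigcupT_measurable.
Qed.

Lemma event_all (J : countType) (Q : J -> Omega -> Prop) :
  (forall j, event (Q j)) -> event (fun w => forall j, Q j w).
Proof.
move=> eQ; apply: (@event_ext (fun w => ~ exists j, ~ Q j w)).
  move=> w; split => [H j|H [j nj]]; last exact: nj (H j).
  by apply: contrapT => nj; apply: H; exists j.
by apply: event_not; apply: event_ex => j; exact: event_not.
Qed.

Lemma event_ex2 (J : countType) (Q Q' : J -> Omega -> Prop) :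
  (forall j, event (Q j)) -> (forall j, event (Q' j)) ->
  event (fun w => exists2 j, Q j w & Q' j w).
Proof.
move=> eQ eQ'; apply: (@event_ext (fun w => exists j, Q j w /\ Q' j w)).
  by move=> w; split => -[j]; [move=> []; exists j|exists j].
by apply: event_ex => j; exact: event_and.
Qed.

Section comparisons.
Variables f g : Omega -> R.
Hypotheses (mf : measurable_fun setT f) (mg : measurable_fun setT g).

Lemma event_lt : event (fun w => f w < g w).
Proof.
have h := measurable_fun_ltr mf mg.
by have := h measurableT [set true] (I : measurable [set true]); rewrite setTI.
Qed.

Lemma event_le : event (fun w => f w <= g w).
Proof.
have h := measurable_fun_ler mf mg.
by have := h measurableT [set true] (I : measurable [set true]); rewrite setTI.
Qed.

Lemma event_eq : event (fun w => f w = g w).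
Proof.
have h := measurable_fun_eqr mf mg.
have := h measurableT [set true] (I : measurable [set true]); rewrite setTI.
by apply: event_ext => w; split => [/eqP|->] //; exact/eqP.
Qed.

End comparisons.

Lemma event_card (J : finType) (Q : J -> Omega -> Prop) (k : nat) :
  (forall j, event (Q j)) ->
  event (fun w => #|[set j | `[< Q j w >]]%SET| = k).
Proof.
move=> eQ; apply: (@event_ext (fun w => exists A : {set J},
    #|A| = k /\ forall j, (j \in A -> Q j w) /\ (Q j w -> j \in A))).
  move=> w; split.
    move=> [A [<- AQ]]; congr #|pred_of_set _|; apply/setP => j; rewrite inE.
    by apply/asboolP/idP; case: (AQ j).
  move=> <-; exists [set j | `[< Q j w >]]%SET; split => // j.
  by rewrite inE; split => /asboolP.
apply: event_ex => A; apply: event_and; first exact: event_const.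
apply: event_all => j; apply: event_and; apply: event_imp => //;
  exact: event_const.
Qed.

End events.

Section random_lines.
Context {R : realType} {d} {Omega : measurableType d}.
Notation plane := (R * R)%type.

Definition measurable_point (v : Omega -> plane) : Prop :=
  measurable_fun setT (fun w => (v w).1) /\ measurable_fun setT (fun w => (v w).2).

Lemma measurable_point_cst (z : plane) : measurable_point (fun _ => z).
Proof. by split; exact: measurable_cst. Qed.

Lemma measurable_offset (x v : Omega -> plane) :
  measurable_point x -> measurable_point v ->
  measurable_fun setT (fun w => offset (x w) (v w)).
Proof.
move=> [x1 x2] [v1 v2]; rewrite /offset.
have mc : measurable_fun setT (fun w => cos (x w).2).
  apply: (measurableT_comp _ x2).
  by apply: continuous_measurable_fun => t; exact: continuous_cos.
have ms : measurable_fun setT (fun w => sin (x w).2).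
  apply: (measurableT_comp _ x2).
  by apply: continuous_measurable_fun => t; exact: continuous_sin.
apply: measurable_funB => //; apply: measurable_funD; exact: measurable_funM.
Qed.

Lemma measurable_abscissa (x v : Omega -> plane) :
  measurable_point x -> measurable_point v ->
  measurable_fun setT (fun w => abscissa (x w) (v w)).
Proof.
move=> [x1 x2] [v1 v2]; rewrite /abscissa.
have mc : measurable_fun setT (fun w => cos (x w).2).
  apply: (measurableT_comp _ x2).
  by apply: continuous_measurable_fun => t; exact: continuous_cos.
have ms : measurable_fun setT (fun w => sin (x w).2).
  apply: (measurableT_comp _ x2).
  by apply: continuous_measurable_fun => t; exact: continuous_sin.
by apply: measurable_funB; exact: measurable_funM.
Qed.

Definition rational_box (qn : rat * rat * nat) : set plane :=
  [set z | `|z.1 - ratr qn.1.1| < qn.2.+1%:R^-1 /\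
           `|z.2 - ratr qn.1.2| < qn.2.+1%:R^-1].

Lemma rational_box_basis (U : set plane) z : open U -> U z ->
  exists2 qn, rational_box qn `<=` U & rational_box qn z.
Proof.
move=> oU Uz; have : interior U z by move/interior_id: oU => ->.
move=> /interiorP[e e0 eU].
have [n en] : exists n : nat, n.+1%:R^-1 < e / 2.
  have [n] := ltr_add_invr (divr_gt0 e0 (ltr0Sn R 1)).
  by rewrite add0r; exists n.
have [h hE] : exists h : R, h = n.+1%:R^-1 by exists n.+1%:R^-1.
have h0 : 0 < h by rewrite hE invr_gt0.
rewrite -hE in en.
have [q1 h1] := rational_near z.1 h0; have [q2 h2] := rational_near z.2 h0.
exists (q1, q2, n); last by rewrite /rational_box /= -hE.
move=> y [y1 y2]; rewrite [y]surjective_pairing; apply: eU.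
  move: h1 y1; rewrite -hE !ltr_norml /= => h1 y1; clear hE; lra.
move: h2 y2; rewrite -hE !ltr_norml /= => h2 y2; clear hE; lra.
Qed.

Lemma event_open (U : set plane) (v : Omega -> plane) : open U ->
  measurable_point v -> event (fun w => U (v w)).
Proof.
move=> oU [v1 v2].
apply: (@event_ext _ _ (fun w => exists qn, rational_box qn `<=` U /\ rational_box qn (v w))).
  move=> w; split; first by move=> [qn [sub nv]]; exact: sub.
  by move=> /(rational_box_basis oU)[qn ? ?]; exists qn.
apply: event_ex => qn; apply: event_and; first exact: event_const.
apply: event_and; (apply: event_lt; last exact: measurable_cst);
  apply: measurableT_comp => //; apply: measurable_funB => //;
  exact: measurable_cst.
Qed.

Lemma event_closed (F : set plane) (v : Omega -> plane) : closed F ->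
  measurable_point v -> event (fun w => F (v w)).
Proof.
move=> /closed_openC oF mv; apply: (@event_ext _ _ (fun w => ~ (~` F) (v w))).
  by move=> w; split => [/contrapT|] // Fv; exact.
by apply: event_not; exact: event_open.
Qed.

End random_lines.

(** * Random cells and the corners of their common parts *)

Section hitting_events.
Context {R : realType} {d} {Omega : measurableType d} {I : finType}.
Notation plane := (R * R)%type.
Variable x : I -> Omega -> plane.
Hypothesis mx : forall i, measurable_point (x i).

Lemma offset_lipschitz (a z y : plane) :
  `|offset a z - offset a y| <= `|z.1 - y.1| + `|z.2 - y.2|.
Proof.
have -> : offset a z - offset a y =
    (z.1 - y.1) * cos a.2 + (z.2 - y.2) * sin a.2 by rewrite /offset; ring.
apply: le_trans (ler_normD _ _) _; apply: lerD; rewrite normrM ler_piMr //.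
  by rewrite ler_norml cos_geN1 cos_le1.
by rewrite ler_norml sin_geN1 sin_le1.
Qed.

Definition nearly_on_side (o : option bool) (v e : R) : Prop :=
  match o with
  | None => True
  | Some b => if b then - e < v else v < e
  end.

(** That a compact set contains a point on prescribed sides of random lines can
    be tested, up to an error, on countably many of its points: a limit point
    of solutions whose errors tend to [0] has no error. *)
Lemma event_hit (J : finType) (K : set plane) (o : J -> option bool) (l : J -> I) :
  compact K ->
  event (fun w => exists z, K z /\ forall j, on_side (o j) (offset (x (l j) w) z)).
Proof.
move=> cK.
have /choice[k kP] : forall qn, exists y, forall z, K z -> rational_box qn z ->
    K y /\ rational_box qn y.
  move=> qn; have [[z [Kz nz]]|none] := pselect (exists z, K z /\ rational_box qn z).
    by exists z.
  by exists (0, 0) => z Kz nz; exfalso; apply: none; exists z.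
apply: (@event_ext _ _ (fun w => forall m : nat, exists qn, K (k qn) /\
    forall j, nearly_on_side (o j) (offset (x (l j) w) (k qn)) m.+1%:R^-1)).
  move=> w; split.
  - move=> H; have /choice[f fP] := H.
    pose z m := k (f m).
    have Kz m : K (z m) by case: (fP m).
    have : ProperFilter (z @ \oo) by apply: fmap_proper_filter.
    move=> PF; have [|y [Ky cl]] := cK (z @ \oo) PF.
      by exists 0%N => // m _; exact: Kz.
    exists y; split => // j; apply: contrapT => nj.
    have [e e0 far] : exists2 e : R, 0 < e & forall t, `|t - offset (x (l j) w) y| < e ->
        ~ nearly_on_side (o j) t e.
      move: nj; rewrite /on_side /nearly_on_side; case: (o j) => [[]|] //= /negP.
        rewrite -ltNge => h; exists (- offset (x (l j) w) y / 2); first by lra.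
        by move=> t; rewrite ltr_norml => ht h2; lra.
      rewrite -ltNge => h; exists (offset (x (l j) w) y / 2); first by lra.
      by move=> t; rewrite ltr_norml => ht h2; lra.
    have mono (t e1 e2 : R) : e1 <= e2 -> nearly_on_side (o j) t e1 ->
        nearly_on_side (o j) t e2.
      by rewrite /nearly_on_side; case: (o j) => [[]|] //= *; lra.
    have A : (z @ \oo) [set y' | nearly_on_side (o j) (offset (x (l j) w) y') e].
      have [N _ NP] : \forall m \near \oo, m.+1%:R^-1 < e.
        exact: near_infty_natSinv_lt (PosNum e0).
      exists N => // m Nm; have [_ /(_ j)] := fP m; apply: mono.
      by apply: ltW; exact: NP.
    have B : nbhs y [set y' | `|offset (x (l j) w) y' - offset (x (l j) w) y| < e].
      have := @offset_continuous _ (x (l j) w) y.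
      move=> /cvgrPdist_lt /(_ e e0); apply: filterS => y' /=.
      by rewrite distrC.
    have [y' [Ay By]] := cl _ _ A B.
    exact: far By Ay.
  - move=> [z [Kz zP]] m.
    (* two points of a box of size [h] have offsets that differ by less than [4
       * h] *)
    have [h hE] : exists h : R, h = (4 * m + 3).+1%:R^-1 by eexists.
    have h0 : 0 < h by rewrite hE invr_gt0.
    have h4 : 4 * h = m.+1%:R^-1.
      rewrite hE (_ : (4 * m + 3).+1 = 4 * m.+1)%N; last by lia.
      by rewrite natrM invfM mulrA divff ?mul1r.
    have [q1 h1] := rational_near z.1 h0; have [q2 h2] := rational_near z.2 h0.
    have nz : rational_box (q1, q2, 4 * m + 3)%N z by rewrite /rational_box /= -hE.
    have [Ky [n1 n2]] := kP _ _ Kz nz.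
    exists (q1, q2, 4 * m + 3)%N; split => // j.
    move: Ky n1 n2; set y := k _; rewrite /= -hE => Ky n1 n2.
    have lip := offset_lipschitz (x (l j) w) y z.
    have d1 : `|y.1 - z.1| < 2 * h.
      by move: h1 n1; rewrite !ltr_norml => h1 n1; clear hE h4; lra.
    have d2 : `|y.2 - z.2| < 2 * h.
      by move: h2 n2; rewrite !ltr_norml => h2 n2; clear hE h4; lra.
    rewrite -h4; have := zP j; rewrite /on_side /nearly_on_side.
    have : `|offset (x (l j) w) y - offset (x (l j) w) z| < 4 * h.
      by apply: le_lt_trans lip _; clear hE h4; lra.
    rewrite ltr_norml; case: (o j) => [[]|] //= h5 h6; clear hE h4; lra.
apply: event_all => m; apply: event_ex => qn; apply: event_and.
  exact: event_const.
apply: event_all => j; rewrite /nearly_on_side.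
have mo := measurable_offset (mx (l j)) (@measurable_point_cst _ _ Omega (k qn)).
case: (o j) => [[]|]; last exact: event_const.
  by apply: event_lt => //; exact: measurable_cst.
by apply: event_lt => //; exact: measurable_cst.
Qed.

End hitting_events.

Section corners.
Context {R : realType}.
Notation plane := (R * R)%type.
Implicit Types (e : set plane) (u : plane -> R).

Definition top u e : R := sup (u @` e).

(** The corners of the bounding box of [e]. They are measurable functions of a
    random set, and the corners that belong to a segment are its ends. *)
Definition corner e (b : bool * bool) : plane :=
  (if b.1 then top fst e else - top (fun z => - z.1) e,
   if b.2 then top snd e else - top (fun z => - z.2) e).

Lemma top_ub u e z : compact e -> continuous u -> e z -> u z <= top u e.
Proof.
move=> ce cu ez; apply: sup_upper_bound; last by exists z.
apply: compact_has_sup; first by exists (u z); exists z.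
by apply: continuous_compact => //; exact: continuous_subspaceT.
Qed.

Lemma top_attained u e : compact e -> continuous u -> e !=set0 ->
  exists2 z, e z & top u e = u z.
Proof.
move=> ce cu e0.
have [z] := compact_EVT_max e0 ce (continuous_subspaceT cu).
rewrite inE => ez zmax; exists z => //; apply/eqP; rewrite eq_le.
rewrite top_ub // andbT; apply: ge_sup; first by exists (u z); exists z.
by move=> _ [y ey <-]; apply: zmax; rewrite inE.
Qed.

Lemma fst_continuous2 : continuous (@fst R R).
Proof. by move=> z; exact: cvg_fst. Qed.

Lemma snd_continuous2 : continuous (@snd R R).
Proof. by move=> z; exact: cvg_snd. Qed.

Lemma oppr_comp_continuous u : continuous u -> continuous (fun z => - u z).
Proof. by move=> cu z; apply: cvgN; exact: cu. Qed.

Lemma bounding_interval u e : compact e -> continuous u -> e !=set0 ->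
  (exists y z, [/\ e y, e z & u y != u z]) <->
  - top (fun z => - u z) e < top u e.
Proof.
move=> ce cu e0; have cNu := oppr_comp_continuous cu; split.
- move=> [y [z [ey ez /= ne]]].
  have := top_ub ce cu ey; have := top_ub ce cu ez.
  have := top_ub ce cNu ey; have := top_ub ce cNu ez => /=.
  by move: ne; rewrite neq_lt => /orP[] ne h1 h2 h3 h4; lra.
- have [y ey ->] := top_attained ce cu e0.
  have [z ez ->] := top_attained ce cNu e0.
  by rewrite opprK => lt; exists z, y; split => //; rewrite lt_eqF.
Qed.

Lemma two_points_test e : compact e ->
  (exists y z, [/\ y != z, e y & e z]) <->
  e !=set0 /\ ((corner e (false, false)).1 < (corner e (true, true)).1 \/
               (corner e (false, false)).2 < (corner e (true, true)).2).
Proof.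
move=> ce; split.
- move=> [y [z [yz ey ez]]]; have e0 : e !=set0 by exists y.
  split => //; have [y1|y1] := eqVneq y.1 z.1; last first.
    left; apply/(bounding_interval ce fst_continuous2 e0).
    by exists y, z.
  right; apply/(bounding_interval ce snd_continuous2 e0).
  exists y, z; split => //; apply: contra yz => /eqP y2.
  by rewrite [y]surjective_pairing [z]surjective_pairing y1 y2.
- move=> [e0 [/(bounding_interval ce fst_continuous2 e0)|
              /(bounding_interval ce snd_continuous2 e0)] [y [z [ey ez yz]]]];
  by exists y, z; split => //; apply: contra yz => /eqP ->.
Qed.

Lemma segment_top u (a b : plane) : continuous u ->
  (forall t, u (lerp a b t) = (1 - t) * u a + t * u b) ->
  top u (segment a b) = Num.max (u a) (u b).
Proof.
move=> cu au; apply/eqP; rewrite eq_le; apply/andP; split.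
  apply: ge_sup; first by exists (u a); exists a => //; exact: segment_l.
  move=> _ [z /segmentP[t t01 ->] <-]; rewrite au le_max.
  by case: (leP (u a) (u b)) => ab; apply/orP; [right|left]; nra.
have cs := @segment_compact2 _ a b.
rewrite ge_max; apply/andP; split; apply: top_ub => //.
  exact: segment_l.
exact: segment_r.
Qed.

Lemma corner_segment (a b : plane) c : corner (segment a b) c =
  (if c.1 then Num.max a.1 b.1 else Num.min a.1 b.1,
   if c.2 then Num.max a.2 b.2 else Num.min a.2 b.2).
Proof.
have oo (y z : R) : - Num.max (- y) (- z) = Num.min y z.
  by rewrite oppr_max !opprK.
have f1 t : (lerp a b t).1 = (1 - t) * a.1 + t * b.1 by [].
have f2 t : (lerp a b t).2 = (1 - t) * a.2 + t * b.2 by [].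
have c1 := segment_top fst_continuous2 f1.
have c2 := segment_top snd_continuous2 f2.
have c3 : top (fun z => - z.1) (segment a b) = Num.max (- a.1) (- b.1).
  apply: segment_top => [|t]; last by rewrite f1; ring.
  by apply: oppr_comp_continuous; exact: fst_continuous2.
have c4 : top (fun z => - z.2) (segment a b) = Num.max (- a.2) (- b.2).
  apply: segment_top => [|t]; last by rewrite f2; ring.
  by apply: oppr_comp_continuous; exact: snd_continuous2.
by rewrite /corner c1 c2 c3 c4 !oo.
Qed.

Lemma endpoint_corner e (a b v : plane) : a != b -> e = segment a b ->
  endpoint v e <-> e v /\ exists c, v = corner e c.
Proof.
move=> ab eE; split.
- move=> [w vw ->]; split; first exact: segment_l.
  exists (w.1 <= v.1, w.2 <= v.2); rewrite corner_segment /=.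
  by rewrite [LHS]surjective_pairing; congr (_, _); case: leP.
- move=> [ev [c vE]].
  have /segmentP[t t01 vt] : segment a b v by rewrite -eE.
  have /orP[/eqP t0|/eqP t1] : (t == 0) || (t == 1).
    move: vE; rewrite eE corner_segment vt /lerp => -[v1 v2].
    have key (y z : R) (f : bool) : y != z ->
        (1 - t) * y + t * z = (if f then Num.max y z else Num.min y z) ->
        (t == 0) || (t == 1).
      move=> yz; have : (1 - t) * y + t * z = y \/ (1 - t) * y + t * z = z ->
          (t == 0) || (t == 1).
        case=> h; apply/orP; [left|right].
          have : t * (z - y) = 0 by lra.
          by move/eqP; rewrite mulf_eq0 subr_eq0 (eq_sym z) (negbTE yz) orbF.
        have : (1 - t) * (y - z) = 0 by lra.
        move/eqP; rewrite mulf_eq0 subr_eq0 (subr_eq0 y) (negbTE yz) orbF.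
        by rewrite eq_sym.
      by move=> H h; apply: H; rewrite h; case: f {h}; case: leP; auto.
    have [a1|a1] := eqVneq a.1 b.1; last exact: key v1.
    apply: (key _ _ _ _ v2); apply: contra ab => /eqP a2.
    by rewrite [a]surjective_pairing [b]surjective_pairing a1 a2.
  + by exists b; rewrite vt t0 lerp0.
  + by exists a; rewrite vt t1 lerp1; [rewrite eq_sym|rewrite eE segment_sym].
Qed.

End corners.

Section random_common_parts.
Context {R : realType} {d} {Omega : measurableType d} {I : finType}.
Notation plane := (R * R)%type.
Notation code := {ffun I -> option bool}.
Variables (W : convex_domain R) (x : I -> Omega -> plane).
Hypothesis mx : forall i, measurable_point (x i).
Implicit Types (p : code * code) (K : set plane).

Definition lines_at w i : plane := x i w.

Lemma event_common_part_hit p K : compact K ->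
  event (fun w => exists z, K z /\ common_part W (lines_at w) p z).
Proof.
move=> cK.
have cKW : compact (K `&` W).
  apply: compact_closedI => //.
  exact: domain_closed.
apply: event_ext (event_hit mx (fun bi : bool * I =>
  if bi.1 then p.1 bi.2 else p.2 bi.2) (fun bi => bi.2) cKW) => w; split.
- move=> [z [[Kz Wz] zP]]; exists z; split => //; split; split => // i.
    exact: (zP (true, i)).
  exact: (zP (false, i)).
- move=> [z [Kz [[Wz z1] [_ z2]]]]; exists z; split => // -[[] i] /=.
    exact: z1.
  exact: z2.
Qed.

Lemma common_part_compact y p : compact (common_part W y p).
Proof.
apply: (subclosed_compact _ (@domain_compact _ W)); last by move=> z [[]].
by apply: closedI; exact: sign_cell_closed.
Qed.

(** If the set is not empty, its [top] is at least [r] when the set meets a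
    certain compact set; if it is empty, its [top] is [0]. *)
Lemma measurable_top u p : continuous u ->
  measurable_fun setT (fun w => top u (common_part W (lines_at w) p)).
Proof.
move=> cu; apply: (measurability (@RGenCInfty.G R)).
  exact: RGenCInfty.measurableE.
move=> _ [_] [r ->] <-; rewrite setTI.
have cW : closed W.
  exact: domain_closed.
have E1 := event_common_part_hit p (@domain_compact _ W).
have cK : compact (W `&` [set z | r <= u z]).
  apply: compact_closedI; first exact: domain_compact.
  have -> : [set z | r <= u z] = u @^-1` [set t | r <= t] by [].
  by apply: preimage_closed => [z _|]; [exact: cu|exact: closed_ge].
have E2 := event_common_part_hit p cK.
have := event_or E2 (event_and (event_not E1) (event_const (r <= 0))).
congr measurable; apply/seteqP; split => w /=.
- rewrite in_itv /= andbT; case.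
    move=> [z [[Wz rz] pz]]; apply: le_trans rz _.
    by apply: top_ub => //; exact: common_part_compact.
  move=> [none r0]; suff -> : common_part W (lines_at w) p = set0.
    by rewrite /top image_set0 sup0.
  apply/seteqP; split => // z pz; apply: none; exists z; split => //.
  by case: pz => -[].
- rewrite in_itv /= andbT => rt.
  have [ne|none] := pselect (common_part W (lines_at w) p !=set0).
    left; have [z pz zE] := top_attained (@common_part_compact _ p) cu ne.
    by exists z; split => //; split; [case: pz => -[]|rewrite /= -zE].
  right; split; first by move=> [z [_ pz]]; apply: none; exists z.
  move: rt; suff -> : common_part W (lines_at w) p = set0.
    by rewrite /top image_set0 sup0.
  by apply/seteqP; split => // z pz; apply: none; exists z.
Qed.

Lemma measurable_corner p b :
  measurable_point (fun w => corner (common_part W (lines_at w) p) b).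
Proof.
split.
  rewrite /corner /=; case: b.1; first exact/measurable_top/fst_continuous2.
  apply: measurable_funN; apply: measurable_top.
  by apply: oppr_comp_continuous; exact: fst_continuous2.
rewrite /corner /=; case: b.2; first exact/measurable_top/snd_continuous2.
apply: measurable_funN; apply: measurable_top.
by apply: oppr_comp_continuous; exact: snd_continuous2.
Qed.

Lemma event_sign_cell (s : code) (v : Omega -> plane) : measurable_point v ->
  event (fun w => sign_cell W (lines_at w) s (v w)).
Proof.
move=> mv; apply: event_and.
  apply: event_closed mv.
  exact: domain_closed.
apply: event_all => i; rewrite /on_side.
have mo := measurable_offset (mx i) mv.
by case: (s i) => [[]|]; [apply: event_le|apply: event_le|exact: event_const];
  rewrite /lines_at //; exact: measurable_cst.
Qed.

Lemma event_open_sign_cell (s : code) z :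
  event (fun w => open_sign_cell W (lines_at w) s z).
Proof.
apply: event_and; first exact: event_const.
apply: event_all => i; rewrite /strictly_on_side.
have mo := measurable_offset (mx i) (@measurable_point_cst _ _ Omega z).
by case: (s i) => [[]|]; [apply: event_lt|apply: event_lt|exact: event_const];
  rewrite /lines_at //; exact: measurable_cst.
Qed.

Lemma event_common_part p (v : Omega -> plane) : measurable_point v ->
  event (fun w => common_part W (lines_at w) p (v w)).
Proof. by move=> mv; apply: event_and; exact: event_sign_cell. Qed.

End random_common_parts.

(** * The event that a set of codes gives a T-tessellation *)

Section corner_tests.
Context {R : realType} {I : finType}.
Notation plane := (R * R)%type.
Notation code := {ffun I -> option bool}.
Variables (W : convex_domain R) (x : I -> plane) (C : {set code}).
Implicit Types (v z : plane) (i : I) (p q : code * code) (c : bool * bool).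

Local Notation common p := (common_part W x p).
Local Notation edges := (edge_index W x C).

(** The tests on the ends of the edges are repeated here with corners in place
    of ends: each edge has four corners, which are measurable, among them its
    ends. *)
Definition is_end p v : Prop :=
  [/\ p \in edges, common p v & exists c, v = corner (common p) c].

Definition corner_on p i : Prop :=
  forall c, common p (corner (common p) c) ->
    offset (x i) (corner (common p) c) = 0.

Definition corner_shape_test : Prop :=
  forall p c, p \in edges -> common p (corner (common p) c) ->
  let v := corner (common p) c in
  (#|[set q | `[< is_end q v >]]%SET| = 3 /\
    exists q q', [/\ is_end q v, is_end q' v,
      q != q' & exists i, corner_on q i /\ corner_on q' i]) \/
  (#|[set q | `[< is_end q v >]]%SET| = 1 /\ frontier W v).

Definition corner_gap_at i (r : R) : Prop :=
  [/\ (exists p c, [/\ p \in edges, corner_on p i,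
         common p (corner (common p) c) & abscissa (x i) (corner (common p) c) < r]),
      (exists p c, [/\ p \in edges, corner_on p i,
         common p (corner (common p) c) & r < abscissa (x i) (corner (common p) c)]) &
      (forall p, p \in edges -> corner_on p i ->
         (forall c, common p (corner (common p) c) ->
            abscissa (x i) (corner (common p) c) < r) \/
         (forall c, common p (corner (common p) c) ->
            r < abscissa (x i) (corner (common p) c)))].

Definition corner_lines_test : Prop :=
  (forall p, p \in edges -> exists i, corner_on p i) /\
  (forall i, (exists p, p \in edges /\ corner_on p i) /\
             forall r : rat, ~ corner_gap_at i (ratr r)).

Hypothesis TW : cell_partition W (sign_tessellation W x C).
Hypothesis fullC : forall s, s \in C -> full_code W x s.

Lemma edge_end p v : p \in edges ->
  endpoint v (common p) <-> common p v /\ exists c, v = corner (common p) c.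
Proof.
move=> /(edge_index_edge TW fullC)/edge_segment[a [b [ab E]]].
exact: endpoint_corner ab E.
Qed.

Lemma is_endP p v : is_end p v <-> p \in index_at W x C v.
Proof.
split; first by move=> [pE pv cv]; rewrite inE pE; apply/asboolP/edge_end.
by move=> /index_atP[pE /(edge_end _ pE)[pv cv]].
Qed.

Lemma card_is_end v :
  #|[set q | `[< is_end q v >]]%SET| = #|index_at W x C v|.
Proof.
apply: fintype.eq_card => q; rewrite [LHS]inE.
by apply/asboolP/idP => /is_endP.
Qed.

Lemma corner_onP p i : p \in edges -> corner_on p i <-> index_on W x p i.
Proof.
move=> pE; split; last by move=> on c /on /line_atP.
have [a [b [ab E /(edge_end _ pE)[ea [c ac]] /(edge_end _ pE)[eb [c' bc]]]]] :=
  endpoints_edge TW fullC pE.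
move=> on; rewrite /index_on E; apply: segment_sub_line; apply/line_atP.
  by rewrite ac; apply: on; rewrite -ac.
by rewrite bc; apply: on; rewrite -bc.
Qed.

Lemma all_ends p (Q : plane -> Prop) : p \in edges ->
  (forall v, endpoint v (common p) -> Q v) <->
  (forall c, common p (corner (common p) c) -> Q (corner (common p) c)).
Proof.
move=> pE; split => H.
  by move=> c pc; apply: H; apply/edge_end => //; split => //; exists c.
by move=> v /(edge_end _ pE)[pv [c vE]]; rewrite vE; apply: H; rewrite -vE.
Qed.

Lemma ex_end p (Q : plane -> Prop) : p \in edges ->
  (exists2 v, endpoint v (common p) & Q v) <->
  (exists2 c, common p (corner (common p) c) & Q (corner (common p) c)).
Proof.
move=> pE; split => -[].
  by move=> v /(edge_end _ pE)[pv [c vE]] Qv; exists c; rewrite -vE.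
by move=> c pc Qc; exists (corner (common p) c) => //; apply/edge_end => //; split => //; exists c.
Qed.

Lemma corner_shape_testP : corner_shape_test <-> shape_test W x C.
Proof.
have body v : ((#|[set q | `[< is_end q v >]]%SET| = 3 /\
    exists q q', [/\ is_end q v, is_end q' v,
      q != q' & exists i, corner_on q i /\ corner_on q' i]) \/
    (#|[set q | `[< is_end q v >]]%SET| = 1 /\ frontier W v)) <->
  ((#|index_at W x C v| = 3 /\ exists q q', [/\ q \in index_at W x C v,
     q' \in index_at W x C v, q != q' &
     exists i, index_on W x q i /\ index_on W x q' i]) \/
  (#|index_at W x C v| = 1 /\ frontier W v)).
  rewrite card_is_end; split => -[[c3 [q [q' [qv q'v qq' [i [qi q'i]]]]]]|];
    try (by right); left; split => //; exists q, q'.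
    have [[qE _ _] [q'E _ _]] := (qv, q'v).
    split => //; [exact/is_endP|exact/is_endP|].
    by exists i; split; apply/corner_onP.
  have [[qE _] [q'E _]] := (index_atP qv, index_atP q'v).
  split => //; [exact/is_endP|exact/is_endP|].
  by exists i; split; apply/corner_onP.
split => H.
- move=> p v pE /(edge_end _ pE)[pv [c vE]]; apply/body.
  by rewrite vE; apply: H => //; rewrite -vE.
- by move=> p c pE pc; apply/body; apply: (H p) => //; apply/edge_end => //; split => //; exists c.
Qed.

Lemma corner_gapP i r : corner_gap_at i r <-> gap_at W x C i r.
Proof.
split => -[g1 g2 g3]; split.
- have [p [c [pE /(corner_onP _ pE) pi pc lt]]] := g1.
  have [v ve vlt] := (ex_end (fun v => abscissa (x i) v < r) pE).2 (ex_intro2 _ _ c pc lt).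
  by exists p, v.
- have [p [c [pE /(corner_onP _ pE) pi pc lt]]] := g2.
  have [v ve vlt] := (ex_end (fun v => r < abscissa (x i) v) pE).2 (ex_intro2 _ _ c pc lt).
  by exists p, v.
- move=> p pE /(corner_onP _ pE) /(g3 p pE)[h|h]; [left|right];
    exact/(all_ends _ pE).
- have [p [v [pE /(corner_onP _ pE) pi ve lt]]] := g1.
  have [c pc clt] := (ex_end (fun v => abscissa (x i) v < r) pE).1 (ex_intro2 _ _ v ve lt).
  by exists p, c.
- have [p [v [pE /(corner_onP _ pE) pi ve lt]]] := g2.
  have [c pc clt] := (ex_end (fun v => r < abscissa (x i) v) pE).1 (ex_intro2 _ _ v ve lt).
  by exists p, c.
- move=> p pE /(corner_onP _ pE) /(g3 p pE)[h|h]; [left|right].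
    exact/(all_ends (fun v => abscissa (x i) v < r) pE).
  exact/(all_ends (fun v => r < abscissa (x i) v) pE).
Qed.

Lemma corner_lines_testP : corner_lines_test <-> lines_test W x C.
Proof.
split => -[on tr]; split.
- by move=> p pE; have [i /(corner_onP _ pE)] := on p pE; exists i.
- move=> i; have [[p [pE /(corner_onP _ pE) pi]] ng] := tr i.
  by split; [exists p|move=> r /corner_gapP; exact: ng].
- by move=> p pE; have [i /(corner_onP _ pE)] := on p pE; exists i.
- move=> i; have [[p [pE /(corner_onP _ pE) pi]] ng] := tr i.
  by split; [exists p|move=> r /corner_gapP; exact: ng].
Qed.

End corner_tests.

Section test_events.
Context {R : realType} {d} {Omega : measurableType d} {I : finType}.
Notation plane := (R * R)%type.
Notation code := {ffun I -> option bool}.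
Variables (W : convex_domain R) (x : I -> Omega -> plane) (C : {set code}).
Hypothesis mx : forall i, measurable_point (x i).
Hypothesis px : forall i w, polar_strip (x i w).
Implicit Types (v : Omega -> plane) (i : I) (p q : code * code) (c : bool * bool).

Local Notation common p w := (common_part W (lines_at x w) p).
Local Notation edges w := (edge_index W (lines_at x w) C).

Lemma event_edge p : event (fun w => p \in edges w).
Proof.
apply: (@event_ext _ _ (fun w => [&& p.1 \in C, p.2 \in C &
   (enum_rank p.1 < enum_rank p.2)%N] /\
   ((exists z, (W : set plane) z /\ common p w z) /\
   ((corner (common p w) (false, false)).1 < (corner (common p w) (true, true)).1 \/
    (corner (common p w) (false, false)).2 < (corner (common p w) (true, true)).2)))).
  move=> w; rewrite inE; have := two_points_test (@common_part_compact R I W (lines_at x w) p).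
  set A := (exists y z, _) => AE.
  have ne : (exists z, (W : set plane) z /\ common p w z) <-> common p w !=set0.
    split; first by move=> [z [_ pz]]; exists z.
    by move=> [z pz]; exists z; split => //; case: pz => -[].
  split.
    move=> [/and3P[-> -> ->] [/ne e0 h]] /=; apply/asboolP; apply/AE.
    by split.
  move=> /and4P[-> -> -> /asboolP/AE[/ne e0 h]].
  by split.
apply: event_and; first exact: event_const.
apply: event_and.
  by apply: event_common_part_hit mx _ _ _; exact: domain_compact.
have [m1 m2] := measurable_corner W mx p (false, false).
have [m3 m4] := measurable_corner W mx p (true, true).
by apply: event_or; apply: event_lt.
Qed.

Lemma event_corner_in p c : event (fun w => common p w (corner (common p w) c)).
Proof. by apply: event_common_part => //; exact: measurable_corner. Qed.

Lemma event_corner_on p i :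
  event (fun w => corner_on W (lines_at x w) p i).
Proof.
apply: event_all => c; apply: event_imp; first exact: event_corner_in.
apply: event_eq; last exact: measurable_cst.
by apply: measurable_offset; [exact: mx|exact: measurable_corner].
Qed.

Lemma event_is_end p v : measurable_point v ->
  event (fun w => is_end W (lines_at x w) C p (v w)).
Proof.
move=> mv; apply: (@event_ext _ _ (fun w => p \in edges w /\ (common p w (v w) /\
   exists c, (v w).1 = (corner (common p w) c).1 /\
             (v w).2 = (corner (common p w) c).2))).
  move=> w; split; last first.
    by move=> [pE pv [c vE]]; split => //; split => //; exists c; rewrite -vE.
  move=> [pE [pv [c [c1 c2]]]]; split => //; exists c.
  by rewrite [LHS]surjective_pairing [RHS]surjective_pairing c1 c2.
apply: event_and; first exact: event_edge.
apply: event_and; first exact: event_common_part.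
apply: event_ex => c; have [m1 m2] := measurable_corner W mx p c; case: mv => v1 v2.
by apply: event_and; apply: event_eq.
Qed.

Lemma event_shape : event (fun w => corner_shape_test W (lines_at x w) C).
Proof.
apply: event_all => p; apply: event_all => c; apply: event_imp.
  exact: event_edge.
apply: event_imp; first exact: event_corner_in.
have mc := measurable_corner W mx p c.
apply: event_or; apply: event_and.
- by apply: event_card => q; exact: event_is_end.
- apply: event_ex => q; apply: event_ex => q'.
  apply: (@event_ext _ _ (fun w => (is_end W (lines_at x w) C q (corner (common p w) c) /\
     is_end W (lines_at x w) C q' (corner (common p w) c)) /\
     (q != q' /\ exists i, corner_on W (lines_at x w) q i /\
                           corner_on W (lines_at x w) q' i))).
    by move=> w; split; [move=> [[? ?] [? ?]]|move=> []].
  apply: event_and; first by apply: event_and; exact: event_is_end.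
  apply: event_and; first exact: event_const.
  by apply: event_ex => i; apply: event_and; exact: event_corner_on.
- by apply: event_card => q; exact: event_is_end.
- apply: event_and; first exact: event_closed (@closed_closure _ _) mc.
  apply: event_not; exact: event_open (@open_interior _ _) mc.
Qed.

Lemma event_gap i r : event (fun w => corner_gap_at W (lines_at x w) C i r).
Proof.
have ma p c : measurable_fun setT
    (fun w => abscissa (lines_at x w i) (corner (common p w) c)).
  by apply: measurable_abscissa; [exact: mx|exact: measurable_corner].
have mr : measurable_fun setT (fun _ : Omega => r) by exact: measurable_cst.
pose lt p c w := abscissa (lines_at x w i) (corner (common p w) c) < r.
pose gt p c w := r < abscissa (lines_at x w i) (corner (common p w) c).
have elt p c : event (lt p c) by apply: event_lt.
have egt p c : event (gt p c) by apply: event_lt.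
apply: (@event_ext _ _ (fun w =>
  ((exists p c, (p \in edges w /\ corner_on W (lines_at x w) p i) /\
       (common p w (corner (common p w) c) /\ lt p c w)) /\
   (exists p c, (p \in edges w /\ corner_on W (lines_at x w) p i) /\
       (common p w (corner (common p w) c) /\ gt p c w))) /\
  (forall p, p \in edges w -> corner_on W (lines_at x w) p i ->
     (forall c, common p w (corner (common p w) c) -> lt p c w) \/
     (forall c, common p w (corner (common p w) c) -> gt p c w)))).
  move=> w; split.
    move=> [[[p [c [[h1 h2] [h3 h4]]]] [q [c' [[h5 h6] [h7 h8]]]]] h9].
    by split => //; [exists p, c|exists q, c'].
  move=> [[p [c [h1 h2 h3 h4]]] [q [c' [h5 h6 h7 h8]]] h9].
  by split => //; split; [exists p, c|exists q, c'].
have ee p : event (fun w => p \in edges w /\ corner_on W (lines_at x w) p i).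
  by apply: event_and; [exact: event_edge|exact: event_corner_on].
apply: event_and; first apply: event_and.
- apply: event_ex => p; apply: event_ex => c; apply: event_and => //.
  by apply: event_and => //; exact: event_corner_in.
- apply: event_ex => p; apply: event_ex => c; apply: event_and => //.
  by apply: event_and => //; exact: event_corner_in.
- apply: event_all => p; apply: event_imp; first exact: event_edge.
  apply: event_imp; first exact: event_corner_on.
  by apply: event_or; apply: event_all => c; apply: event_imp => //; exact: event_corner_in.
Qed.

Lemma event_lines : event (fun w => corner_lines_test W (lines_at x w) C).
Proof.
apply: event_and.
  apply: event_all => p; apply: event_imp; first exact: event_edge.
  by apply: event_ex => i; exact: event_corner_on.
apply: event_all => i; apply: event_and.
  apply: event_ex => p; apply: event_and; first exact: event_edge.
  exact: event_corner_on.
by apply: event_all => r; apply: event_not; exact: event_gap.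
Qed.

Lemma event_partition : event (fun w => partition_test W (lines_at x w) C).
Proof.
have mq r : measurable_point (fun _ : Omega => @rational_point R r).
  exact: measurable_point_cst.
have mo i r : measurable_fun setT (fun w => offset (lines_at x w i) (rational_point r)).
  by apply: measurable_offset; [exact: mx|exact: mq].
have m0 : measurable_fun setT (fun _ : Omega => 0 : R) by exact: measurable_cst.
have eo s z : event (fun w => open_sign_cell W (lines_at x w) s z).
  exact: event_open_sign_cell.
pose t1 w := forall s, s \in C -> exists r, open_sign_cell W (lines_at x w) s (rational_point r).
pose t2 w := forall r, interior W (@rational_point R r) ->
         exists2 s, s \in C & sign_cell W (lines_at x w) s (rational_point r).
pose t3 w := forall s s', s \in C -> s' \in C -> s != s' -> forall r,
         ~ (open_sign_cell W (lines_at x w) s (rational_point r) /\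
            open_sign_cell W (lines_at x w) s' (rational_point r)).
pose t4 w := forall s i, s \in C -> s i = None ->
         (exists2 r, open_sign_cell W (lines_at x w) s (rational_point r) &
                     0 < offset (lines_at x w i) (rational_point r)) /\
         (exists2 r, open_sign_cell W (lines_at x w) s (rational_point r) &
                     offset (lines_at x w i) (rational_point r) < 0).
apply: (@event_ext _ _ (fun w => (t1 w /\ t2 w) /\ (t3 w /\ t4 w))).
  by move=> w; split; [move=> [[? ?] [? ?]]|move=> []].
apply: event_and; apply: event_and.
- apply: event_all => s; apply: event_imp; first exact: event_const.
  by apply: event_ex => r.
- apply: event_all => r; apply: event_imp; first exact: event_const.
  apply: event_ex2 => s; first exact: event_const.
  exact: event_sign_cell.
- apply: event_all => s; apply: event_all => s'.
  apply: event_imp; first exact: event_const.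
  apply: event_imp; first exact: event_const.
  apply: event_imp; first exact: event_const.
  by apply: event_all => r; apply: event_not; apply: event_and.
- apply: event_all => s; apply: event_all => i.
  apply: event_imp; first exact: event_const.
  apply: event_imp; first exact: event_const.
  by apply: event_and; apply: event_ex2 => r //; exact: event_lt.
Qed.

Lemma event_tessellation_code :
  event (fun w => tessellation_code W (lines_at x w) C).
Proof.
apply: (@event_ext _ _ (fun w => partition_test W (lines_at x w) C /\
   (corner_shape_test W (lines_at x w) C /\ corner_lines_test W (lines_at x w) C))).
  move=> w; have pxw i : polar_strip (lines_at x w i) by exact: px.
  split.
    move=> [/partition_testP[cp fc] [/(corner_shape_testP cp fc) sh
      /(corner_lines_testP cp fc) ls]].
    by have [] := (tessellation_testP pxw cp fc).2 (conj sh ls).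
  move=> [tt sl fc]; have cp : cell_partition W (sign_tessellation W (lines_at x w) C).
    by case: tt => /polygonal_cell_partition.
  have [sh ls] := (tessellation_testP pxw cp fc).1 (conj tt sl).
  split; first exact/partition_testP.
  by split; [exact/(corner_shape_testP cp fc)|exact/(corner_lines_testP cp fc)].
apply: event_and; first exact: event_partition.
by apply: event_and; [exact: event_shape|exact: event_lines].
Qed.

(** The edges are the common parts of two cells, to which
    [event_common_part_hit] applies. *)
Lemma event_skeleton_hit K : compact K ->
  event (fun w => tessellation_code W (lines_at x w) C /\
    skeleton (sign_tessellation W (lines_at x w) C) `&` K !=set0).
Proof.
move=> cK; apply: (@event_ext _ _ (fun w => tessellation_code W (lines_at x w) C /\
   exists p, p \in edges w /\ exists z, K z /\ common p w z)).
  move=> w; split => -[ct H]; split => //; have [tt _ fc] := ct;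
    have cp : cell_partition W (sign_tessellation W (lines_at x w) C) by
      (case: tt => /polygonal_cell_partition).
    have [p [pE [z [Kz pz]]]] := H; exists z; split => //.
    by exists (common p w) => //; exact: edge_index_edge.
  have [z [[e /(inner_edgeP cp fc)[p pE ->] pz] Kz]] := H.
  by exists p; split => //; exists z.
apply: event_and; first exact: event_tessellation_code.
apply: event_ex => p; apply: event_and; first exact: event_edge.
exact: event_common_part_hit.
Qed.

End test_events.

(** * The T-tessellations on given lines *)

Section tessellations_on_lines.
Context {R : realType} {I : finType}.
Notation plane := (R * R)%type.
Notation code := {ffun I -> option bool}.
Variables (W : convex_domain R) (x : I -> plane).
Implicit Types (C : {set code}).

Definition coded_tessellation C : T_W W :=
  match pselect (T_tessellation W (sign_tessellation W x C)) with
  | left TT => exist _ _ TT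
  | right _ => point
  end.

Lemma coded_tessellationE C : T_tessellation W (sign_tessellation W x C) ->
  sval (coded_tessellation C) = sign_tessellation W x C.
Proof. by rewrite /coded_tessellation; case: pselect. Qed.

Definition tessellation_codes : {set {set code}} :=
  [set C | `[< tessellation_code W x C >]]%SET.

Lemma tessellation_codesP C : reflect (tessellation_code W x C) (C \in tessellation_codes).
Proof. by rewrite inE; exact: asboolP. Qed.

Lemma tessT_inj (T T' : T_W W) : sval T = sval T' -> T = T'.
Proof. by case: T T' => T tt [T' tt'] /= E; exact: eq_exist. Qed.

Hypothesis hx : forall i, hitting_params W (x i).
Hypothesis x_inj : injective x.

Let px i : polar_strip (x i).
Proof. by case: (hx i). Qed.

(** Full codes are determined by their cells, and the cells of a tessellation
    on the lines have full codes by [partition_code]. *)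
Lemma T_on_codes : set_bij [set C | C \in tessellation_codes]
  (T_on W [set line_at (x i) | i in setT]) coded_tessellation.
Proof.
split.
- move=> C /= /tessellation_codesP[tt sl _].
  by rewrite /T_on /= /L_of coded_tessellationE.
- move=> C C'; rewrite !in_setE /= => /tessellation_codesP[tt sl f].
  move=> /tessellation_codesP[tt' sl' f'] E.
  apply: (sign_tessellation_inj f f').
  by rewrite -(coded_tessellationE tt) -(coded_tessellationE tt') E.
- move=> T /=; rewrite /T_on /= /L_of => sl.
  have tt := proj2_sig T; rewrite /= in tt.
  have cp : cell_partition W (sval T) by case: (tt) => /polygonal_cell_partition.
  have [_ _ na] := tt.
  have [on _] := (segments_by_lines (sval T) px).1 (conj na sl).
  have [C CE f] := partition_code cp on; exists C.
    by apply/tessellation_codesP; split => //; rewrite -CE.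
  apply: tessT_inj; rewrite coded_tessellationE //.
  by rewrite -CE.
Qed.

Lemma esum_codes (f : T_W W -> \bar R) : (forall T, (0 <= f T)%E) ->
  (\esum_(T in T_on W [set line_at (x i) | i in setT]) f T =
   \sum_(C in tessellation_codes) f (coded_tessellation C))%E.
Proof.
move=> f0; rewrite (@reindex_esum R _ _ _ _ _ f T_on_codes) esum_fset.
- apply/esym; apply: bigfs; first exact: index_enum_uniq.
  by move=> C _; rewrite mem_index_enum.
- exact: finite_finset.
- by move=> *; exact: f0.
Qed.

Lemma lines_one_crossing i j (a a' t t' : R) : i != j ->
  line_point (x i) a = line_point (x j) t ->
  line_point (x i) a' = line_point (x j) t' -> a = a'.
Proof.
move=> ij e e'; apply: contrapT => aa'; move/eqP: ij; apply; apply: x_inj.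
apply: (@two_points_line _ _ _ (line_point (x i) a) (line_point (x i) a')) => //.
- by apply/eqP => /line_point_inj.
- exact: line_at_line_point.
- exact: line_at_line_point.
- by rewrite e; exact: line_at_line_point.
- by rewrite e'; exact: line_at_line_point.
Qed.

(** A tessellation is determined by its segments, which form a blocked system.
    *)
Lemma tessellation_count :
  (#|tessellation_codes| <= 84 ^ #|I| * \sum_(A : {set I}) #|A| ^ (#|I| - #|A|))%N.
Proof.
have /choice[ch chP] : forall i, exists lh : R * R, [/\ lh.1 < lh.2,
    forall t, (W : set plane) (line_point (x i) t) <-> lh.1 <= t <= lh.2 &
    forall t, lh.1 < t < lh.2 -> interior W (line_point (x i) t)].
  move=> i; have [_ hi] := hx i.
  have [lo [hi' H]] := chord_exists (@domain_compact _ W) (@domain_convex _ W) hi.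
  by exists (lo, hi').
have /choice[sys sysP] : forall C, exists s : {ffun I -> R * R}, C \in tessellation_codes ->
    (forall i, trace (sign_tessellation W x C) (x i) =
       line_point (x i) @` `[(s i).1, (s i).2]%classic) /\
    blocked_system (fun i => line_point (x i)) (fun i => (ch i).1)
       (fun i => (ch i).2) predT s.
  move=> C; have [/tessellation_codesP[tt sl f]|nC] := boolP (C \in tessellation_codes);
    last by exists [ffun=> (0, 0)].
  have [s [tr bs]] := tessellation_system tt px x_inj sl
     (lo := fun i => (ch i).1) (hi := fun i => (ch i).2) chP.
  have fs : fun_of_fin (finfun s) = s by apply/funext => i; rewrite ffunE.
  by exists (finfun s) => _; rewrite fs.
rewrite cardE -(size_map sys); apply: (blocked_count lines_one_crossing).
  rewrite map_inj_in_uniq ?enum_uniq // => C C'; rewrite !mem_enum => CE CE' sE.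
  have /tessellation_codesP[tt sl f] := CE.
  have /tessellation_codesP[tt' sl' f'] := CE'.
  apply: (sign_tessellation_inj f f').
  apply: (@skeleton_inj _ W); [by case: (tt) => /polygonal_cell_partition|
                        by case: (tt') => /polygonal_cell_partition|].
  rewrite (skeleton_traces tt px sl) (skeleton_traces tt' px sl').
  apply: eq_bigcupr => i _; have [tr _] := sysP _ CE; have [tr' _] := sysP _ CE'.
  by rewrite tr tr' sE.
move=> s /mapP[C]; rewrite mem_enum => CE ->.
exact: (sysP _ CE).2.
Qed.

End tessellations_on_lines.

(** * Measurable enumeration of a random finite set *)

Section random_points.
Context {R : realType} {d} {Omega : measurableType d}.
Notation plane := (R * R)%type.
Variable X : Omega -> {fset plane}.
Hypothesis mX : forall B : set plane, measurable B ->
  measurable_fun setT (nb_points X B).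
Implicit Types (B : set plane) (w : Omega) (qn : rat * rat * nat).

Lemma event_nb_points B k : measurable B -> event (fun w => nb_points X B w = k).
Proof. by move=> mB; have := mX mB measurableT (I : measurable [set k]); rewrite setTI. Qed.

Definition unique_point B w : plane :=
  if nb_points X B w == 1%N then head (0, 0) [fset z in X w | z \in B]%fset
  else (0, 0).

Lemma unique_pointP B w : nb_points X B w = 1%N ->
  [/\ unique_point B w \in X w, B (unique_point B w) &
      forall z, z \in X w -> B z -> z = unique_point B w].
Proof.
move=> n1; rewrite /unique_point n1 eqxx.
move: n1; rewrite /nb_points; set F := [fset z in X w | z \in B]%fset => n1.
have FE z : (z \in F) = (z \in X w) && (z \in B) by rewrite !inE.
have [y yE] : exists y, enum_fset F = [:: y].
  by move: n1; case: (enum_fset F) => [//|y [|//]] _; exists y.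
have memF z : (z \in F) = (z == y) by rewrite -[RHS]mem_seq1 -yE.
have := memF y; rewrite eqxx FE yE /= => /andP[yX]; rewrite in_setE => yB.
split => // z zX zB.
by apply/eqP; rewrite -memF FE zX in_setE.
Qed.

Lemma nb_points_unique B B' w : nb_points X B w = 1%N -> B' `<=` B ->
  nb_points X B' w = 1%N <-> B' (unique_point B w).
Proof.
move=> n1 sub; have [uX uB uu] := unique_pointP n1; split.
  move=> n1'; have [u'X u'B _] := unique_pointP n1'.
  by rewrite -(uu _ u'X) //; exact: sub.
move=> B'u; rewrite /nb_points.
have -> : [fset z in X w | z \in B']%fset = [fset unique_point B w]%fset.
  apply/fsetP => z; rewrite !inE /=; apply/andP/eqP.
    by move=> [zX]; rewrite in_setE => /sub /(uu _ zX).
  by move=> ->; rewrite uX in_setE.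
by rewrite cardfs1.
Qed.

(** When [B] contains one point, this point is in a subset of [B] if and only
    if the subset contains one. *)
Lemma measurable_unique_point B : measurable B ->
  measurable_point (unique_point B).
Proof.
move=> mB.
suff H (f : plane -> R) : measurable_fun setT f -> f (0, 0) = 0 ->
    measurable_fun setT (f \o unique_point B).
  by split; apply: H.
move=> mf f0; apply: (measurability (@RGenCInfty.G R)).
  exact: RGenCInfty.measurableE.
move=> _ [_] [r ->] <-; rewrite setTI.
have mB' : measurable (B `&` [set z | r <= f z]).
  apply: measurableI => //.
  have := mf measurableT _ (measurable_itv `[r, +oo[); rewrite setTI.
  by congr measurable; apply/seteqP; split => z /=; rewrite in_itv /= andbT.
have := event_or (event_and (event_nb_points 1 mB) (event_nb_points 1 mB'))
  (event_and (event_not (event_nb_points 1 mB)) (event_const (r <= 0))).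
congr measurable; apply/seteqP; split => w /=; rewrite in_itv /= andbT.
  case=> [[n1 /(nb_points_unique n1 (@subIsetl _ _ _)) []//]|[n1 r0]].
  by rewrite /unique_point; case: eqP => //; rewrite f0.
have [n1 rf|n1] := pselect (nb_points X B w = 1%N).
  left; split => //; apply/(nb_points_unique n1 (@subIsetl _ _ _)).
  by have [_ uB _] := unique_pointP n1.
by rewrite {1}/unique_point; case: eqP => // _; rewrite f0; right.
Qed.

Lemma measurable_rational_box qn : measurable (rational_box qn : set plane).
Proof.
have h q : measurable [set t : R | `|t - ratr q| < qn.2.+1%:R^-1].
  have -> : [set t : R | `|t - ratr q| < qn.2.+1%:R^-1] =
      ball (ratr q : R) qn.2.+1%:R^-1.
    by apply/seteqP; split => t; rewrite /ball /= distrC.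
  exact: measurable_ball.
have := measurableI _ _
  (@measurable_fst _ _ (measurableTypeR R) (measurableTypeR R) measurableT _ (h qn.1.1))
  (@measurable_snd _ _ (measurableTypeR R) (measurableTypeR R) measurableT _ (h qn.1.2)).
by rewrite !setTI.
Qed.

(** Boxes from a countable family enumerate the points: each box contains one
    of them, and each point is in one box. *)
Definition isolating n (A : {ffun 'I_n -> rat * rat * nat}) w : Prop :=
  [/\ nb_points X setT w = n,
      (forall k, nb_points X (rational_box (A k)) w = 1%N) &
      injective (fun k => unique_point (rational_box (A k)) w)].

Lemma event_isolating n (A : {ffun 'I_n -> rat * rat * nat}) :
  event (isolating A).
Proof.
apply: (@event_ext _ _ (fun w => (nb_points X setT w = n /\
   forall k, nb_points X (rational_box (A k)) w = 1%N) /\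
   forall j k, ((unique_point (rational_box (A j)) w).1 =
                (unique_point (rational_box (A k)) w).1 /\
                (unique_point (rational_box (A j)) w).2 =
                (unique_point (rational_box (A k)) w).2) -> j = k)).
  move=> w; split => [[[? ?] H]|[? ? H]]; split => //.
    by move=> j k e; apply: H; rewrite e.
  move=> j k [e1 e2]; apply: H.
  by rewrite [LHS]surjective_pairing [RHS]surjective_pairing e1 e2.
have mu k := measurable_unique_point (measurable_rational_box (A k)).
apply: event_and.
  apply: event_and; first exact: event_nb_points.
  by apply: event_all => k; exact: event_nb_points (measurable_rational_box _).
apply: event_all => j; apply: event_all => k; apply: event_imp.
  by have [? ?] := mu j; have [? ?] := mu k; apply: event_and; apply: event_eq.
exact: event_const.
Qed.

Lemma isolating_points n (A : {ffun 'I_n -> rat * rat * nat}) w : isolating A w ->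
  [set` X w] = [set unique_point (rational_box (A k)) w | k in setT].
Proof.
move=> [nX n1 inj].
have XE : #|` X w| = n.
  rewrite -nX /nb_points; congr #|` _|; apply/fsetP => z.
  by rewrite !inE /= in_setT andbT.
pose F := [fset unique_point (rational_box (A k)) w | k in 'I_n]%fset.
have FX : F = X w.
  apply/eqP; rewrite eqEfcard; apply/andP; split.
    by apply/fsubsetP => z /imfsetP[k _ ->]; have [] := unique_pointP (n1 k).
  rewrite XE card_imfset //=.
  by rewrite -cardE card_ord.
apply/seteqP; split => z /=.
  by rewrite -FX => /imfsetP[k _ ->]; exists k.
by move=> [k _ <-]; have [] := unique_pointP (n1 k).
Qed.

Lemma isolating_exists w : exists n (A : {ffun 'I_n -> rat * rat * nat}),
  isolating A w.
Proof.
pose n := #|` X w|; exists n.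
pose pt (k : 'I_n) : plane := nth (0, 0) (X w) k.
have ptX k : pt k \in X w by apply: mem_nth.
have ptI : injective pt.
  by move=> j k /eqP; rewrite nth_uniq ?fset_uniq // => /eqP/ord_inj.
have /choice[A AP] : forall k, exists qn, rational_box qn (pt k) /\
    forall z, z \in X w -> rational_box qn z -> z = pt k.
  move=> k; have oU : open (~` [set` X w `\ pt k]%fset).
    apply: closed_openC.
    have acc : accessible_space plane.
      by apply: hausdorff_accessible; exact: norm_hausdorff.
    by move/accessible_finite_set_closed: acc; apply; exact: finite_fset.
  have [|qn sub qz] := rational_box_basis oU (_ : _ (pt k)).
    by rewrite /= !inE eqxx.
  exists qn; split => // z zX qz'; apply/eqP; apply: contrapT => /negP zk.
  by apply: (sub z qz'); rewrite /= !inE zk.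
exists (finfun A).
have n1 k : nb_points X (rational_box (A k)) w = 1%N.
  have [qk uk] := AP k; rewrite /nb_points.
  have -> : [fset z in X w | z \in rational_box (A k)]%fset = [fset pt k]%fset.
    apply/fsetP => z; rewrite !inE /=; apply/andP/eqP.
      by move=> [zX]; rewrite in_setE; exact: uk.
    by move=> ->; rewrite ptX in_setE.
  by rewrite cardfs1.
have uE k : unique_point (rational_box (A k)) w = pt k.
  have [uX uB _] := unique_pointP (n1 k).
  by have [_ uk] := AP k; exact: uk.
split.
- rewrite /nb_points /n; congr #|` _|; apply/fsetP => z.
  by rewrite !inE /= in_setT andbT.
- by move=> k; rewrite ffunE.
- by move=> j k; rewrite !ffunE !uE => /ptI.
Qed.

End random_points.

(** * Measurability of sums over T-tessellations *)

Section measurable_sums.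
Context {R : realType} {d} {Omega : measurableType d}.
Notation plane := (R * R)%type.
Variables (W : convex_domain R) (f : T_W W -> \bar R).
Hypotheses (mf : measurable_fun setT f) (f0 : forall T, (0 <= f T)%E).

Section coded_sum.
Context {I : finType}.
Notation code := {ffun I -> option bool}.
Variable x : I -> Omega -> plane.
Hypothesis mx : forall i, measurable_point (x i).
Hypothesis px : forall i w, polar_strip (x i w).
Implicit Types (C : {set code}).

(** It suffices to consider the generators of the hitting sigma-algebra, for
    which this is [event_skeleton_hit]. *)
Lemma event_coded_tessellation C (Y : set (T_W W)) : measurable Y ->
  event (fun w => tessellation_code W (lines_at x w) C /\
                  Y (coded_tessellation W (lines_at x w) C)).
Proof.
have eV := event_tessellation_code W C mx px.
have mcode : measurable_fun [set w | tessellation_code W (lines_at x w) C]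
    (fun w => coded_tessellation W (lines_at x w) C).
  apply: (@measurability _ _ Omega (T_W W) _ _ (@hitting_events R W)) => //.
  move=> _ [_ [K cK ->] <-].
  have := event_skeleton_hit W C mx px cK; apply: event_ext => w /=.
  by split=> -[ct]; have [tt _ _] := ct; rewrite coded_tessellationE.
move=> mY; exact: mcode eV _ mY.
Qed.

Lemma measurable_coded_sum : measurable_fun setT
  (fun w => \sum_(C in tessellation_codes W (lines_at x w))
               f (coded_tessellation W (lines_at x w) C))%E.
Proof.
under eq_fun do rewrite big_mkcond.
apply: emeasurable_sum => C _ Y mY; rewrite setTI.
have eV := event_tessellation_code W C mx px.
have mfY : measurable (f @^-1` Y) by rewrite -[X in measurable X]setTI; exact: mf.
have := event_or (event_coded_tessellation C mfY)
  (event_and (event_not eV) (event_const (Y 0%E))).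
apply: event_ext => w /=; case: tessellation_codesP => [ct|nct].
  by split => [[[]//|[]]|]; [move=> []|left].
by split => [[[]/nct//|[]]|]; [|right].
Qed.

End coded_sum.

Variable X : Omega -> {fset plane}.
Hypothesis mX : forall B : set plane, measurable B ->
  measurable_fun setT (nb_points X B).
Hypothesis hX : forall w, [set` X w] `<=` hitting_params W.

Lemma polar_strip_unique_point B w : polar_strip (unique_point X B w).
Proof.
rewrite {1}/unique_point; case: eqP => [n1|_].
  have [uX _ _] := unique_pointP n1.
  have [] := hX uX.
  by rewrite /unique_point n1 eqxx.
by rewrite /polar_strip /= lexx pi_gt0.
Qed.

Let pts n (A : {ffun 'I_n -> rat * rat * nat}) k w : plane :=
  unique_point X (rational_box (A k)) w.

Lemma isolating_lines n (A : {ffun 'I_n -> rat * rat * nat}) w : isolating X A w ->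
  line_set X w = [set line_at (lines_at (pts A) w k) | k in setT].
Proof.
move=> iA; rewrite /line_set (isolating_points iA).
by rewrite image_comp.
Qed.

Lemma isolating_hitting n (A : {ffun 'I_n -> rat * rat * nat}) w : isolating X A w ->
  forall k, hitting_params W (lines_at (pts A) w k).
Proof. by move=> [_ n1 _] k; have [uX _ _] := unique_pointP (n1 k); exact: hX uX. Qed.

Lemma isolating_esum n (A : {ffun 'I_n -> rat * rat * nat}) w : isolating X A w ->
  (\esum_(T in T_on W (line_set X w)) f T =
   \sum_(C in tessellation_codes W (lines_at (pts A) w))
      f (coded_tessellation W (lines_at (pts A) w) C))%E.
Proof.
move=> iA; rewrite (isolating_lines iA).
by apply: esum_codes => //; exact: isolating_hitting.
Qed.

(** When given boxes isolate the points, the sum is a finite sum over sets of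
    codes; there are countably many choices of boxes. *)
Lemma measurable_esum : measurable_fun setT
  (fun w => \esum_(T in T_on W (line_set X w)) f T).
Proof.
move=> _ Y mY; rewrite setTI.
have : event (fun w => exists n (A : {ffun 'I_n -> rat * rat * nat}), isolating X A w /\
    Y (\sum_(C in tessellation_codes W (lines_at (pts A) w))
         f (coded_tessellation W (lines_at (pts A) w) C))%E).
  apply: event_ex => n; apply: event_ex => A; apply: event_and.
    exact: event_isolating.
  have := @measurable_coded_sum _ (pts A) _ _ measurableT _ mY.
  rewrite setTI; apply => [k|k w]; last exact: polar_strip_unique_point.
  exact: (measurable_unique_point mX (measurable_rational_box (A k))).
apply: event_ext => w /=; split => [[n [A [iA]]]|Yw].
  by rewrite -isolating_esum.
have [n [A iA]] := isolating_exists X w; exists n, A; split => //.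
by rewrite -isolating_esum.
Qed.

End measurable_sums.

(** * The exponential series of the idempotent maps *)

Lemma sum_subsets n (F : nat -> nat) :
  (\sum_(A : {set 'I_n}) F #|A| = \sum_(j < n.+1) 'C(n, j) * F j)%N.
Proof.
pose card A : 'I_n.+1 := inord #|(A : {set 'I_n})|.
have cardE A : card A = #|A| :> nat.
  by rewrite inordK // ltnS -[n in (_ <= n)%N](card_ord n) max_card.
rewrite (partition_big card predT) //=; apply: eq_bigr => j _.
rewrite (eq_bigr (fun=> F j)) => [|A /eqP <-]; last by rewrite cardE.
rewrite sum_nat_const; congr (_ * _)%N.
have := card_draws 'I_n j; rewrite card_ord => <-.
by apply: fintype.eq_card => A; rewrite unfold_in inE -cardE eq_sym (inj_eq val_inj) eq_sym.
Qed.

Section exponential_series.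
Context {R : realType}.
Implicit Types (a z : R).

Lemma exp_partial_sum z m : 0 <= z -> \sum_(0 <= i < m) z ^+ i / i`!%:R <= expR z.
Proof.
move=> z0; apply: (nondecreasing_cvgn_le _ (is_cvg_series_exp_coeff z) m).
apply/nondecreasing_seqP => k; rewrite seriesSr lerDl.
exact: exp_coeff_ge0.
Qed.

(** There are [#|A| ^ (n - #|A|)] idempotent maps of [n] points with [A] as set
    of fixed points, and the exponential generating function of the idempotent
    maps is [exp (a exp a)]: such a map is a set of fixed points, each with the
    set of the points that are sent to it. *)
Lemma idempotent_series a m : 0 <= a ->
  \sum_(0 <= n < m) a ^+ n / n`!%:R *
     (\sum_(A : {set 'I_n}) #|A| ^ (n - #|A|))%:R <= expR (a * expR a).
Proof.
move=> a0.
pose G j i : R := a ^+ j / j`!%:R * ((a * j%:R) ^+ i / i`!%:R).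
have G0 j i : 0 <= G j i by rewrite !(mulr_ge0, exprn_ge0, invr_ge0, ler0n).
have GE n : (n < m)%N ->
    a ^+ n / n`!%:R * (\sum_(A : {set 'I_n}) #|A| ^ (n - #|A|))%:R =
    \sum_(0 <= j < m | (j <= n)%N) G j (n - j)%N.
  move=> nm; rewrite (sum_subsets n (fun j => j ^ (n - j))%N) big_mkord.
  rewrite (big_ord_widen_cond m xpredT (fun j => 'C(n, j) * j ^ (n - j))%N nm).
  rewrite natr_sum mulr_sumr; apply: eq_bigr => j jn; rewrite ltnS in jn.
  rewrite natrM natrX /G exprMn -{1}(subnKC jn) exprD -(bin_fact jn) !natrM.
  have f1 k : k`!%:R != 0 :> R by rewrite pnatr_eq0 -lt0n fact_gt0.
  have c1 : 'C(n, j)%:R != 0 :> R by rewrite pnatr_eq0 -lt0n bin_gt0.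
  by field; rewrite !f1 c1.
rewrite (eq_big_nat _ _ (fun n nm => GE n (andP nm).2)).
rewrite (exchange_big_dep predT) //=.
apply: (@le_trans _ _ (\sum_(0 <= j < m) (a * expR a) ^+ j / j`!%:R)); last first.
  by apply: exp_partial_sum; rewrite mulr_ge0 // expR_ge0.
apply: ler_sum => j _; rewrite -mulr_sumr exprMn [leRHS]mulrAC -expRM_natl.
rewrite ler_wpM2l // ?mulr_ge0 ?exprn_ge0 ?invr_ge0 //.
rewrite [leLHS](_ : _ = \sum_(0 <= i < m - j) (a * j%:R) ^+ i / i`!%:R).
  by rewrite [_%:R * _]mulrC; apply: exp_partial_sum; rewrite mulr_ge0.
rewrite -(big_nat_widenl j 0 m xpredT (fun n => (a * j%:R) ^+ (n - j) / (n - j)`!%:R)) //.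
by rewrite -{1}(add0n j) big_addn; apply: eq_bigr => i _; rewrite addnK.
Qed.
End exponential_series.

(** * The partition function *)

Section energy_bound.
Context {R : realType}.
Notation plane := (R * R)%type.

Definition idempotent_number n : nat := (\sum_(A : {set 'I_n}) #|A| ^ (n - #|A|))%N.

Lemma nb_lines_on (W : convex_domain R) (I : finType) (x : I -> plane) (T : T_W W) :
  (forall i, polar_strip (x i)) -> injective x ->
  L_of T = [set line_at (x i) | i in setT] -> nb_lines T = #|I|.
Proof.
move=> px xi LT; rewrite /nb_lines LT.
have -> : [set line_at (x i) | i in setT] =
    [set` [fset line_at (x i) | i in I]%fset].
  apply/seteqP; split => l /=; first by move=> [i _ <-]; apply/imfsetP; exists i.
  by move=> /imfsetP[i _ ->]; exists i.
rewrite set_fsetK card_imfset /= -?cardE //.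
by move=> i j /line_at_inj e; apply: xi; exact: e.
Qed.

Lemma energy_sum_bound (W : convex_domain R) (H : T_W W -> R) (C : R)
    (n : nat) (x : 'I_n -> plane) :
  (forall T, C * (nb_lines T)%:R <= H T) ->
  (forall i, hitting_params W (x i)) -> injective x ->
  (\esum_(T in T_on W [set line_at (x i) | i in setT]) (expR (- H T))%:E <=
   ((84 * expR (- C)) ^+ n * (idempotent_number n)%:R)%:E)%E.
Proof.
move=> HC hx xi.
rewrite (esum_codes hx) => [|T]; last by rewrite lee_fin expR_ge0.
rewrite sumEFin lee_fin.
apply: (@le_trans _ _ (\sum_(K in tessellation_codes W x) expR (- C) ^+ n)).
  apply: ler_sum => K KE; rewrite -expRM_natl ler_expR.
  have [/(_ K KE) LT _ _] := T_on_codes hx.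
  have := HC (coded_tessellation W x K).
  rewrite (nb_lines_on _ xi LT) ?card_ord => [|i]; last by case: (hx i).
  lra.
rewrite sumr_const -[_ *+ _]mulr_natl exprMn mulrAC -natrX -natrM.
rewrite ler_wpM2r ?exprn_ge0 ?expR_ge0 // ler_nat.
by have := tessellation_count hx xi; rewrite card_ord.
Qed.

End energy_bound.

Section partition_function_bounds.
Context {R : realType} {d} {Omega : measurableType d}.
Notation plane := (R * R)%type.
Variables (W : convex_domain R) (H : T_W W -> R) (C tau : R).
Variables (P : probability Omega R) (X : Omega -> {fset plane}).
Hypotheses (mH : measurable_fun setT H)
  (HC : forall T : T_W W, C * (nb_lines T)%:R <= H T)
  (tau0 : 0 < tau) (pX : poisson_line_params W tau P X).
Local Open Scope ereal_scope.

Let hX w : [set` X w] `<=` hitting_params W.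
Proof. by have [h _] := pX; exact: h. Qed.

Let mX B : measurable B -> measurable_fun setT (nb_points X B).
Proof. by have [_ [h _ _]] := pX; exact: h. Qed.

Let total_points (w : Omega) : nat := nb_points X setT w.

Let m : R := line_intensity W tau setT.

(** The intensity of the plane is [tau], or [0] if [fine] makes the volume [0].
    *)
Lemma line_intensity_bounds : (0 <= m <= tau)%R.
Proof.
rewrite /m /line_intensity setTI; set v := fine _.
have [->|v0] := eqVneq v 0%R; first by rewrite mulr0 lexx ltW.
by rewrite divfK // lexx ltW.
Qed.

Lemma total_points_law n :
  P [set w | total_points w = n] = (expR (- m) * m ^+ n / n`!%:R)%:E.
Proof. by have [_ [_ + _]] := pX; apply; exact: measurableT. Qed.

Let weight n : R := ((84 * expR (- C)) ^+ n * (idempotent_number n)%:R)%R.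

Let weight_ge0 n : (0 <= weight n)%R.
Proof. by rewrite /weight !(mulr_ge0, exprn_ge0, expR_ge0). Qed.

Lemma energy_sum_le w :
  \esum_(T in T_on W (line_set X w)) (expR (- H T))%:E <= (weight (total_points w))%:E.
Proof.
have [n [A iA]] := isolating_exists X w.
rewrite (isolating_lines iA) /total_points; have [-> _ inj] := iA.
by apply: energy_sum_bound => //; exact: isolating_hitting hX _ _ _ iA.
Qed.

Lemma measurable_boltzmann A : measurable A ->
  measurable_fun setT (fun T : T_W W => (\1_A T * expR (- H T))%:E).
Proof.
move=> mA; apply/measurable_EFinP; apply: measurable_funM.
  exact: measurable_indic.
by apply: measurableT_comp => //; exact: measurableT_comp.
Qed.

Lemma measurable_gibbs_sum A : measurable A ->
  measurable_fun setT (fun w => gibbs_sum H A (line_set X w)).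
Proof.
move=> mA; apply: measurable_esum => //; first exact: measurable_boltzmann.

Qed.

Lemma gibbs_sumT L : gibbs_sum H setT L = \esum_(T in T_on W L) (expR (- H T))%:E.
Proof. by apply: eq_esum => T _; rewrite indicT mul1r. Qed.

Lemma gibbs_weightT : gibbs_weight H P X setT = partition_function H P X.
Proof. by apply: eq_integral => w _; rewrite gibbs_sumT. Qed.

Lemma event_total_points n : measurable [set w | total_points w = n].
Proof. exact: event_nb_points. Qed.

(** A realisation with [n] lines contributes at most [weight n], and [n] has a
    Poisson law. *)
Lemma partition_function_lty : partition_function H P X < +oo.
Proof.
(* a factor [84 * expR (- C)] for each line, and at most [tau] from the Poisson
   law *)
pose a : R := (84 * expR (- C) * tau)%R.
pose g n w : \bar R := (weight n)%:E * (\1_[set w | total_points w = n] w)%:E.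
have g0 n w : 0 <= g n w by rewrite mule_ge0 ?lee_fin.
have mg n : measurable_fun setT (g n).
  apply: emeasurable_funM => //; apply/measurable_EFinP.
  by apply: measurable_indic; exact: event_total_points.
apply: (@le_lt_trans _ _ (\int[P]_w \sum_(n <oo) g n w)).
  apply: ge0_le_integral => //.
  - by move=> w _; apply: esum_ge0 => T _; rewrite lee_fin expR_ge0.
  - under eq_fun do rewrite -gibbs_sumT.
    exact: measurable_gibbs_sum.
  - exact: ge0_emeasurable_sum.
  - move=> w _; apply: (le_trans (energy_sum_le w)).
    apply: le_trans (nneseries_lim_ge (total_points w).+1 _) => //.
    rewrite big_nat_recr //= /g indicE mem_set // mule1.
    by apply: leeDr; apply: sume_ge0 => n _; exact: g0.
rewrite integral_nneseries //.
apply: (@le_lt_trans _ _ (expR (a * expR a))%:E); last exact: ltry.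
apply: lime_le.
  by apply: is_cvg_nneseries => n _ _; exact: integral_ge0.
near=> k; rewrite (eq_bigr (fun n => (weight n * (expR (- m) * m ^+ n / n`!%:R))%:E)).
  rewrite sumEFin lee_fin; apply: le_trans (idempotent_series k _); last first.
    by rewrite !mulr_ge0 ?expR_ge0 // ltW.
  apply: ler_sum => n _; rewrite /weight -/(idempotent_number n).
  have -> : (a ^+ n = (84 * expR (- C)) ^+ n * tau ^+ n)%R by rewrite /a exprMn.
  set c := ((84 * expR (- C)) ^+ n)%R; set i := (idempotent_number n)%:R%R.
  rewrite [leLHS](_ : _ = c * i / n`!%:R * (expR (- m) * m ^+ n))%R; last by ring.
  rewrite [leRHS](_ : _ = c * i / n`!%:R * tau ^+ n)%R; last by ring.
  have /andP[m0 mt] := line_intensity_bounds.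
  apply: ler_wpM2l; first by rewrite /c !(mulr_ge0, exprn_ge0, expR_ge0, invr_ge0).
  rewrite -[leRHS]mul1r; apply: ler_pM; rewrite ?expR_ge0 ?exprn_ge0 //.
    by rewrite -expR0 ler_expR oppr_le0.
  by apply: lerXn2r; rewrite ?nnegrE // ltW.
move=> n _; rewrite ge0_integralZl_EFin //.
  rewrite (@integral_indic _ _ _ P _ measurableT _ (event_total_points n)).
  by rewrite setIT [RHS]EFinM; congr (_ * _); exact: total_points_law.
by apply/measurable_EFinP; apply: measurable_indic; exact: event_total_points.
Unshelve. all: by end_near.
Qed.

(** With positive probability there is no line, and then the tessellation
    without segments contributes. *)
Lemma partition_function_gt0 : 0 < partition_function H P X.
Proof.
pose T0 : T_W W := point.
have noedge s : ~ tess_segment (sval T0) s.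
  by move=> [[F [[e Fe] FT _ _ _]] _]; exact: inner_edge_trivial (FT _ Fe).
have LT0 : L_of T0 = set0.
  by rewrite -subset0 => l [_ [s /noedge]].
apply: (@lt_le_trans _ _ ((expR (- H T0))%:E * P [set w | total_points w = 0%N])).
  by rewrite total_points_law expr0 fact0 mulr1 divr1 -EFinM lte_fin mulr_gt0 ?expR_gt0.
rewrite -[X in _ * P X]setIT.
rewrite -(@integral_indic _ _ _ P _ measurableT _ (event_total_points 0)).
have mi : measurable_fun setT (fun w => (\1_[set w | total_points w = 0%N] w)%:E : \bar R).
  by apply/measurable_EFinP; apply: measurable_indic; exact: event_total_points.
rewrite -ge0_integralZl_EFin ?expR_ge0 //.
apply: ge0_le_integral => //.
- exact: emeasurable_funM.
- under eq_fun do rewrite -gibbs_sumT.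
  exact: measurable_gibbs_sum.
move=> w _; have sum0 : 0 <= \esum_(T in T_on W (line_set X w)) (expR (- H T))%:E.
  by apply: esum_ge0 => T _; rewrite lee_fin expR_ge0.
have [w0|wn0] := pselect (total_points w = 0%N); last first.
  by rewrite indicE memNset // mule0.
rewrite indicE mem_set // mule1.
have X0 : X w = fset0.
  apply/eqP; rewrite -cardfs_eq0 -[X in _ == X]w0 /total_points /nb_points.
  by apply/eqP; congr #|` _|; apply/fsetP => z; rewrite !inE /= in_setT andbT.
have on0 : T_on W (line_set X w) T0.
  by rewrite /T_on /= LT0 /line_set X0 set_fset0 image_set0.
apply: esum_ge; exists [set T0]; last by rewrite fsbig_set1.
by split => [|_ ->]; [exact: finite_set1|exact: on0].
Qed.

End partition_function_bounds.

(** * The Gibbs measure *)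

Lemma finite_measure_exists d (T : measurableType d) (R : realType)
    (m : set T -> \bar R) :
  m set0 = 0%E -> (forall A, (0 <= m A)%E) -> semi_sigma_additive m ->
  (m setT < +oo)%E ->
  exists mu : {finite_measure set T -> \bar R}, forall A, mu A = m A.
Proof.
move=> m0 mge madd mT.
pose mu : {measure set T -> \bar R} := HB.pack m (isMeasure.Build d T R m m0 mge madd).
have fin : fin_num_fun mu.
  move=> A mA; rewrite ge0_fin_numE; last exact: mge.
  by apply: le_lt_trans mT; apply: (@le_measure _ _ _ mu); rewrite ?inE.
pose mu' : {finite_measure set T -> \bar R} := HB.pack (Measure.sort mu)
  (Measure_isFinite.Build d T R (Measure.sort mu) fin).
by exists mu'.
Qed.

Section gibbs_measure.
Context {R : realType} {d} {Omega : measurableType d}.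
Notation plane := (R * R)%type.
Variables (W : convex_domain R) (H : T_W W -> R) (C tau : R).
Variables (P : probability Omega R) (X : Omega -> {fset plane}).
Hypotheses (mH : measurable_fun setT H) (pX : poisson_line_params W tau P X).
Local Open Scope ereal_scope.

Lemma gibbs_sum_ge0 A L : 0 <= gibbs_sum H A L.
Proof. by apply: esum_ge0 => T _; rewrite lee_fin mulr_ge0 ?expR_ge0. Qed.

Lemma gibbs_sum_restrict A L :
  gibbs_sum H A L = \esum_(T in T_on W L `&` A) (expR (- H T))%:E.
Proof.
rewrite /gibbs_sum esum_mkcondr; apply: eq_esum => T _.
by rewrite indicE; case: (_ \in _); rewrite ?mul1r ?mul0r.
Qed.

Lemma gibbs_sum_bigcup (F : (set (T_W W))^nat) L : trivIset setT F ->
  gibbs_sum H (\bigcup_k F k) L = \sum_(k <oo) gibbs_sum H (F k) L.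
Proof.
move=> tF; rewrite gibbs_sum_restrict setI_bigcupr nneseries_sum_bigcup.
- by apply: eq_eseriesr => k _; rewrite gibbs_sum_restrict.
- exact: trivIset_setIl.
- by move=> T; rewrite lee_fin expR_ge0.
Qed.

Lemma gibbs_weight_sigma_additive : semi_sigma_additive (gibbs_weight H P X).
Proof.
move=> F mF tF mUF; have -> : gibbs_weight H P X (\bigcup_k F k) =
    \sum_(k <oo) gibbs_weight H P X (F k).
  rewrite /gibbs_weight -integral_nneseries //.
  - by apply: eq_integral => w _; exact: gibbs_sum_bigcup.
  - by move=> k; exact: (measurable_gibbs_sum mH pX).
  - by move=> k w _; exact: gibbs_sum_ge0.
by apply: is_cvg_nneseries => k _ _; apply: integral_ge0 => w _; exact: gibbs_sum_ge0.
Qed.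

End gibbs_measure.

Theorem theorem2p2 (R : realType) (W : convex_domain R)
    (H : T_W W -> R) (C : R) (tau : R)
    (d : measure_display) (Omega : measurableType d)
    (P : probability Omega R) (X : Omega -> {fset (R * R)}) :
  measurable_fun setT H ->
  (forall T : T_W W, C * (nb_lines T)%:R <= H T) ->
  0 < tau ->
  poisson_line_params W tau P X ->
  [/\ (forall A : set (T_W W), measurable A ->
         measurable_fun setT (fun w => gibbs_sum H A (line_set X w))),
      (0 < partition_function H P X)%E,
      (partition_function H P X < +oo)%E &
      exists mu : {finite_measure set (T_W W) -> \bar R},
        forall A : set (T_W W), measurable A ->
          mu A = (((fine (partition_function H P X))^-1)%:E *
                  gibbs_weight H P X A)%E].
Proof.
move=> mH HC tau0 pX.
have mG := measurable_gibbs_sum mH pX.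
have Zgt0 := partition_function_gt0 mH pX.
have Zlty := partition_function_lty mH HC tau0 pX.
split => //.
have [||||weight weightE] := @finite_measure_exists _ (T_W W) R (gibbs_weight H P X).
- apply: integral0_eq => w _; apply: esum1 => T _.
  by rewrite indic0 mul0r.
- by move=> A; apply: integral_ge0 => w _; exact: gibbs_sum_ge0.
- exact: (gibbs_weight_sigma_additive mH pX).
- by rewrite gibbs_weightT.
have Z0 : 0 <= (fine (partition_function H P X))^-1.
  by rewrite invr_ge0 fine_ge0 // ltW.
exists (mscale (NngNum Z0) weight) => A mA.
by rewrite /mscale /=; congr (_ * _)%E; exact: weightE.
Qed.
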